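(* There is an absolute constant $C>0$ such that the following holds. In the setting described in the context, suppose $\mathcal A\subseteq\{A\in\mathbb R^{d_1\times d_2}:\|A\|_{\mathrm{op}}\le 1\}$ and that the pilot estimator $\Theta_0$ and the pilot error bound $R_0$ satisfy $\max_{A\in\mathcal A}|\langle \Theta_0-\Theta^*,A\rangle|\le R_0$. Let $\hat\Theta$ be the output of LowPopArt run on $n_0$ samples with $Q=Q(\pi)$, $\Theta_0$, $R_0$ and $\delta\in(0,1)$. Then with probability at least $1-\delta$: $\operatorname{rank}(\hat\Theta)\le r$ and $$\|\hat\Theta-\Theta^*\|_{\mathrm{op}}\le C(\sigma+R_0)\sqrt{\frac{B(Q)}{n_0}\ln\frac{2d}{\delta}} .$$
   Context: Notation: $d=\max(d_1,d_2)$; $\langle A,B\rangle=\operatorname{tr}(A^\top B)$; $\|\cdot\|_{\mathrm{op}}$ is the largest singular value; $\operatorname{vec}$ stacks the columns of a $d_1\times d_2$ matrix into a vector of $\mathbb R^{d_1d_2}$ and $\operatorname{reshape}$ is its inverse. Data: $\mathcal A\subset\mathbb R^{d_1\times d_2}$ spans $\mathbb R^{d_1\times d_2}$, $\pi$ is a probability distribution on $\mathcal A$ whose covariance $Q=Q(\pi)=\mathbb E_{a\sim\pi}[\operatorname{vec}(a)\operatorname{vec}(a)^\top]$ is invertible and known. $\Theta^*\in\mathbb R^{d_1\times d_2}$ is unknown with rank at most $r$. The samples $(X_i,Y_i)_{i=1}^{n_0}$ are i.i.d. with $X_i\sim\pi$, $Y_i=\langle\Theta^*,X_i\rangle+\eta_i$,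 where $\eta_i$ is zero-mean $\sigma$-subgaussian ($\mathbb E e^{s\eta_i}\le e^{s^2\sigma^2/2}$ for all $s\in\mathbb R$, $\sigma>0$) and independent of $X_i$. $\Theta_0$ is fixed (non-random, or independent of the samples). Definition of $B(Q)$: for $i\in[d_2]$, let $D_i^{(\mathrm{col})}$ be the $d_1\times d_1$ principal submatrix of $Q^{-1}$ with row and column indices $\{(i-1)d_1+1,\dots,i d_1\}$; for $i\in[d_1]$, let $D_i^{(\mathrm{row})}$ be the $d_2\times d_2$ principal submatrix of $Q^{-1}$ with indices $\{i+d_1(\ell-1):\ell\in[d_2]\}$. Then $B(Q)=\max\big(\lambda_{\max}(\sum_{i=1}^{d_2}D_i^{(\mathrm{col})}),\ \lambda_{\max}(\sum_{i=1}^{d_1}D_i^{(\mathrm{row})})\big)$. Matrix functions: $\phi_0(x)=\log(1+x+x^2/2)$ for $x>0$ and $\phi_0(x)=-\log(1-x+x^2/2)$ otherwise; for symmetric $M=U\operatorname{diag}(\lambda_j)U^\top$, $\phi(M)=U\operatorname{diag}(\phi_0(\lambda_j))U^\top$. The dilation of $A\in\mathbb R^{d_1\times d_2}$ is $\mathcal H(A)=\begin{bmatrix} 0 & A \\ A^\top & 0 \end{bmatrix}$, and for $M\in\mathbb R^{(d_1+d_2)\times(d_1+d_2)}$, $(M)_{\mathsf{ht}}$ is the block with rows $1,\dots,d_1$ and columns $d_1+1,\dots,d_1+d_2$. LowPopArt (inputs: samples, $n_0$, $Q$, $\Theta_0$, $R_0$, $\delta$): (1) $\tilde\Theta_i=Q^{-1}(Y_i-\langle\Theta_0,X_i\rangle)\operatorname{vec}(X_i)$.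 (2) $\Theta_1=\Theta_0+\Big(\frac1{n_0\nu}\sum_{i=1}^{n_0}\phi\big(\nu\,\mathcal H(\operatorname{reshape}(\tilde\Theta_i))\big)\Big)_{\mathsf{ht}}$ with $\nu=\frac1{\sigma+R_0}\sqrt{\frac{2}{B(Q)n_0}\ln\frac{2d}{\delta}}$. (3) Take an SVD $\Theta_1=U_1\Sigma_1V_1^\top$ and let $\tilde\Sigma_1$ be $\Sigma_1$ with all diagonal entries that are at most $2(R_0+\sigma)\sqrt{B(Q)\ln(2d/\delta)/n_0}$ replaced by $0$; output $\hat\Theta=U_1\tilde\Sigma_1V_1^\top$. *)

(* Defs.v *)
From HB Require Import structures.
From mathcomp Require Import all_boot all_order all_algebra.
From mathcomp Require Import all_classical all_reals all_analysis.

Set Implicit Arguments.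
Unset Strict Implicit.
Unset Printing Implicit Defensive.

Import Order.TTheory GRing.Theory Num.Theory.
Import numFieldNormedType.Exports.

Local Open Scope classical_set_scope.
Local Open Scope ring_scope.

(* mxvec is row-major, so transposing first gives column stacking; the
   coordinates are therefore indexed by 'I_(d2 * d1), and mxvec_index i k is the
   (zero-based) position i * d1 + k of row k of column i. *)
Lemma mxvec_index_val (m n : nat) (i : 'I_m) (k : 'I_n) :
  val (mxvec_index i k) = (i * n + k)%N.
Proof.
have index_pair (s : seq 'I_m) (t : seq 'I_n) : i \in s -> k \in t ->
    index (i, k) [seq (a, b) | a <- s, b <- t]
      = (index i s * size t + index k t)%N.
  move=> + kt; elim: s => //= a s IH; rewrite inE index_cat size_map.
  have [<- _|ia /= si] := eqVneq i a.
    by rewrite map_f // mul0n index_map // => ? ? [].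
  rewrite ifN ?IH ?mulSn ?addnA //.
  by apply/mapP => -[b _ [/eqP]]; rewrite (negPf ia).
have -> : (i * n + k)%N =
    index (i, k) [seq (a, b) | a <- enum 'I_m, b <- enum 'I_n].
  by rewrite index_pair ?mem_enum // !index_enum_ord size_enum_ord.
rewrite -[val _]/(val (enum_rank (i, k))).
have -> : [seq (a, b) | a <- enum 'I_m, b <- enum 'I_n] = enum {: 'I_m * 'I_n}.
  by rewrite [RHS]enumT [Finite.enum in RHS]unlock.
by rewrite -{2}(enum_rankK (i, k)) /enum_val index_uniq ?enum_uniq // -cardE.
Qed.

Section matrices.
Context {R : realType}.

Definition vec (d1 d2 : nat) (A : 'M[R]_(d1, d2)) : 'cV[R]_(d2 * d1) :=
  (mxvec A^T)^T.

Definition reshape (d1 d2 : nat) (v : 'cV[R]_(d2 * d1)) : 'M[R]_(d1, d2) :=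
  (vec_mx v^T)^T.

Definition mxdot (d1 d2 : nat) (A B : 'M[R]_(d1, d2)) : R := \tr (A^T *m B).

Definition singular_values (d1 d2 : nat) (A : 'M[R]_(d1, d2)) : set R :=
  [set Num.sqrt l | l in [set l | eigenvalue (A^T *m A) l]].

(* For d2 > 0 the set is finite and nonempty, so sup is a maximum. *)
Definition opnorm (d1 d2 : nat) (A : 'M[R]_(d1, d2)) : R :=
  sup (singular_values A).

(* Only used on symmetric matrices, whose spectrum is nonempty if n > 0. *)
Definition lambda_max (n : nat) (M : 'M[R]_n) : R :=
  sup [set l | eigenvalue M l].

Definition spans (d1 d2 : nat) (A : set 'M[R]_(d1, d2)) : Prop :=
  forall M : 'M[R]_(d1, d2), exists (k : nat) (c : 'I_k -> R)
    (a : 'I_k -> 'M[R]_(d1, d2)),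
    (forall i, A (a i)) /\ M = \sum_(i < k) c i *: a i.

Definition Dcol (d1 d2 : nat) (Q : 'M[R]_(d2 * d1)) (i : 'I_d2) : 'M[R]_d1 :=
  mxsub (fun k : 'I_d1 => mxvec_index i k) (fun k : 'I_d1 => mxvec_index i k)
    (invmx Q).

Definition Drow (d1 d2 : nat) (Q : 'M[R]_(d2 * d1)) (i : 'I_d1) : 'M[R]_d2 :=
  mxsub (fun l : 'I_d2 => mxvec_index l i) (fun l : 'I_d2 => mxvec_index l i)
    (invmx Q).

Definition BQ (d1 d2 : nat) (Q : 'M[R]_(d2 * d1)) : R :=
  Num.max (lambda_max (\sum_(i < d2) Dcol Q i))
          (lambda_max (\sum_(i < d1) Drow Q i)).

Definition phi0 (x : R) : R :=
  if 0 < x then ln (1 + x + x ^+ 2 / 2) else - ln (1 - x + x ^+ 2 / 2).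

Definition orthogonal_mx (n : nat) (U : 'M[R]_n) : Prop := U^T *m U = 1%:M.

Definition spectral_images (f : R -> R) (n : nat) (M : 'M[R]_n) :
    set 'M[R]_n :=
  [set N | exists (U : 'M[R]_n) (l : 'rV[R]_n),
    [/\ orthogonal_mx U, M = U *m diag_mx l *m U^T
      & N = U *m diag_mx (map_mx f l) *m U^T]].

(* For symmetric M there is exactly one spectral image (it does not depend on
   the chosen diagonalization); 0 is a dummy value for the other matrices. *)
Definition mxfun (f : R -> R) (n : nat) (M : 'M[R]_n) : 'M[R]_n :=
  xget 0 (spectral_images f M).

Definition dilation (d1 d2 : nat) (A : 'M[R]_(d1, d2)) : 'M[R]_(d1 + d2) :=
  block_mx 0 A A^T 0.

Definition is_svd (d1 d2 : nat) (A : 'M[R]_(d1, d2))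
    (U : 'M[R]_d1) (S : 'M[R]_(d1, d2)) (V : 'M[R]_d2) : Prop :=
  [/\ orthogonal_mx U, orthogonal_mx V,
      forall (i : 'I_d1) (j : 'I_d2), 0 <= S i j /\ (i != j :> nat -> S i j = 0)
    & A = U *m S *m V^T].

Definition hard_threshold (tau : R) (d1 d2 : nat) (S : 'M[R]_(d1, d2)) :
    'M[R]_(d1, d2) :=
  \matrix_(i, j) if S i j <= tau then 0 else S i j.

End matrices.

Section lowpopart.
Context {R : realType} (d1 d2 n0 : nat).
Context (sigma : R) (Q : 'M[R]_(d2 * d1)) (Theta0 : 'M[R]_(d1, d2)).
Context (R0 delta : R).

Definition log_term : R := ln (2 * (maxn d1 d2)%:R / delta).

Definition one_sample (x : 'M[R]_(d1, d2)) (y : R) : 'cV[R]_(d2 * d1) :=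
  (y - mxdot Theta0 x) *: (invmx Q *m vec x).

Definition catoni_scale : R :=
  (sigma + R0)^-1 * Num.sqrt (2 / (BQ Q * n0%:R) * log_term).

Definition Theta1 (x : 'I_n0 -> 'M[R]_(d1, d2)) (y : 'I_n0 -> R) :
    'M[R]_(d1, d2) :=
  Theta0 + ursubmx ((n0%:R * catoni_scale)^-1 *:
    \sum_(i < n0)
      mxfun phi0 (catoni_scale *: dilation (reshape (one_sample (x i) (y i))))).

Definition sv_cutoff : R :=
  2 * (R0 + sigma) * Num.sqrt (BQ Q * log_term / n0%:R).

(* A relation, because the algorithm may use any SVD of Theta1. *)
Definition LowPopArt_output (x : 'I_n0 -> 'M[R]_(d1, d2)) (y : 'I_n0 -> R)
    (Theta : 'M[R]_(d1, d2)) : Prop :=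
  exists (U : 'M[R]_d1) (S : 'M[R]_(d1, d2)) (V : 'M[R]_d2),
    is_svd (Theta1 x y) U S V /\
    Theta = U *m hard_threshold sv_cutoff S *m V^T.

End lowpopart.

Arguments LowPopArt_output {R d1 d2 n0} sigma Q Theta0 R0 delta x y Theta.

(* Real matrices with their Borel sigma-algebra. *)
Definition borel_mx (R : realType) (d1 d2 : nat) :=
  g_sigma_algebraType (@open 'M[R]_(d1, d2)).

Section probability.
Context {R : realType}.

(* A probability on the ambient matrix space comes from one on A (with the trace
   sigma-algebra) iff every measurable superset of A has full measure; A itself
   need not be measurable, and if it is, this says pi A = 1. *)
Definition distribution_on (d1 d2 : nat) (pi : probability (borel_mx R d1 d2) R)
    (A : set 'M[R]_(d1, d2)) : Prop :=
  forall B : set (borel_mx R d1 d2), measurable B -> A `<=` B -> pi B = 1%E.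

Definition covariance_mx (d1 d2 : nat)
    (pi : probability (borel_mx R d1 d2) R) : 'M[R]_(d2 * d1) :=
  \matrix_(k, l) Rintegral pi setT
    (fun a : borel_mx R d1 d2 => vec a k 0 * vec a l 0).

Context (disp : measure_display) (T : measurableType disp).
Variable P : probability T R.

Definition independent2 (e1 e2 : measure_display)
    (E1 : measurableType e1) (E2 : measurableType e2)
    (Z1 : T -> E1) (Z2 : T -> E2) : Prop :=
  forall (B1 : set E1) (B2 : set E2), measurable B1 -> measurable B2 ->
    P (Z1 @^-1` B1 `&` Z2 @^-1` B2) = (P (Z1 @^-1` B1) * P (Z2 @^-1` B2))%E.

(* The product rule for subfamilies is the case where some B i are setT. *)
Definition mutually_independent (e : measure_display) (E : measurableType e)
    (n : nat) (Z : 'I_n -> T -> E) : Prop :=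
  forall B : 'I_n -> set E, (forall i, measurable (B i)) ->
    P (\bigcap_(i in [set: 'I_n]) (Z i @^-1` B i)) =
    (\prod_(i < n) P (Z i @^-1` B i))%E.

Definition identically_distributed (e : measure_display) (E : measurableType e)
    (n : nat) (Z : 'I_n -> T -> E) : Prop :=
  forall (i j : 'I_n) (B : set E), measurable B ->
    P (Z i @^-1` B) = P (Z j @^-1` B).

Definition has_law (e : measure_display) (E : measurableType e)
    (Z : T -> E) (mu : probability E R) : Prop :=
  forall B : set E, measurable B -> P (Z @^-1` B) = mu B.

(* The second condition makes eta integrable, so its expectation is genuine. *)
Definition centered_subgaussian (sigma : R) (eta : T -> R) : Prop :=
  ('E_P[eta] = 0)%E /\
  forall s : R,
    ('E_P[fun w => expR (s * eta w)] <= (expR (s ^+ 2 * sigma ^+ 2 / 2))%:E)%E.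

(* The set S is not required to be measurable: it contains an event of
   probability at least p. *)
Definition with_probability_ge (p : R) (S : set T) : Prop :=
  exists2 E : set T, measurable E /\ (p%:E <= P E)%E & E `<=` S.

End probability.

(* Main.v *)
(* Write L = ln (2 d / delta), B = B(Q), Z_i = nu H(reshape(tilde Theta_i)) and
   Delta = Theta^* - Theta_0.  The influence function satisfies
   exp (phi (Z)) <= 1 + Z + Z^2 / 2, and the mean of the right-hand side is at most
   exp (nu H(Delta) + L / n_0), because E Z = nu H(Delta) and E Z^2 is at most
   nu^2 (sigma^2 + R_0^2) times the block diagonal matrix of the sums of the D^(col)
   and of the D^(row).

   To pass to the sum of the phi (Z_i), Lieb's concavity theorem is used in tangent
   form: for symmetric K and H there is a G with tr (G e^H) = tr e^(K + H) and
   tr e^(K + F) <= tr (G e^F) for all symmetric F.  The right-hand side is linear in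
   e^F, so the samples can be integrated out one at a time, which gives
   E tr exp (sum_i phi (Z_i) - n_0 nu H(Delta)) <= (d_1 + d_2) e^L.  By Markov's
   inequality this trace is at most e^(2 L) with probability at least 1 - delta, and
   then ||Theta_1 - Theta^*|| is at most the cutoff, since the image of a dilation
   under the odd function phi is a dilation.  A singular vector argument shows that
   thresholding at the cutoff then leaves rank at most r and error at most twice the
   cutoff.

   The tangent form of Lieb's theorem comes from relative entropy: the tangent
   inequality of (X, Y) |-> <X, Y^-1 X> at the operators W |-> W A + s T W is a
   completed square, and integrating it over s in [0, +oo) gives
   tr T (ln T - ln T_0 - ln A + ln B) >= tr T - tr (G A), which is applied to
   T = e^(K + F), A = e^F, T_0 = e^(K + H), B = e^H. *)

Require Import Defs.
From HB Require Import structures.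
From mathcomp Require Import all_boot all_order all_algebra.
From mathcomp Require Import all_classical all_reals all_analysis.
From mathcomp Require Import measurable_realfun complex ring lra zify.
Set Implicit Arguments.
Unset Strict Implicit.
Unset Printing Implicit Defensive.
Import Order.TTheory GRing.Theory Num.Theory.
Import numFieldNormedType.Exports.
Local Open Scope classical_set_scope.
Local Open Scope ring_scope.

(** * Spectral calculus of real symmetric matrices *)

(** The tangent form keeps every expectation real-valued. Once the earlier samples are frozen, [G]
    is one fixed matrix and [\tr (G *m _)] a linear functional. Freezing is Tonelli's theorem on a
    product law, and a random pilot is frozen in the same way, outermost.

    The inequality for all [F] also makes [\tr (G *m _)] monotone along a common eigenbasis. This is
    how the scalar bounds [exp (phi0 x) <= 1 + x + x ^+ 2 / 2] and [1 + h <= exp h] pass to matrices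
    under the trace.

    Integrals over [s] appear only as explicit antiderivatives: their derivatives are compared
    pointwise, and [s] then goes to infinity along the integers.

    Two obstacles concern measurability. The functional calculus is defined by choice and collapses
    to 0 off the symmetric matrices, so its measurability comes from a continuous extension. The set
    of actions may be nonmeasurable, so each property of an action is moved to a measurable superset
    of full measure. *)

Lemma orthogonal_mxV (R : realType) n (U : 'M[R]_n) :
  orthogonal_mx U -> U *m U^T = 1%:M.
Proof. exact: mulmx1C. Qed.

Lemma orthogonal_mx_tr (R : realType) n (U : 'M[R]_n) :
  orthogonal_mx U -> orthogonal_mx U^T.
Proof. by move=> oU; rewrite /orthogonal_mx trmxK; exact: orthogonal_mxV. Qed.

Lemma orthogonal_mxM (R : realType) n (U V : 'M[R]_n) :
  orthogonal_mx U -> orthogonal_mx V -> orthogonal_mx (U *m V).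
Proof.
rewrite /orthogonal_mx => oU oV.
by rewrite trmx_mul mulmxA -(mulmxA V^T) oU mulmx1.
Qed.

Lemma mulmx_tr_sqr (R : realType) n (v : 'rV[R]_n) :
  (v *m v^T) 0 0 = \sum_i v 0 i ^+ 2.
Proof. by rewrite !mxE; apply: eq_bigr => i _; rewrite mxE expr2. Qed.

Lemma mulmx_tr_gt0 (R : realType) n (v : 'rV[R]_n) :
  v != 0 -> 0 < (v *m v^T) 0 0.
Proof.
rewrite mulmx_tr_sqr => v0; rewrite lt_def sumr_ge0 ?andbT; last first.
  by move=> i _; exact: sqr_ge0.
apply: contra v0; rewrite psumr_eq0 => [|i _]; last exact: sqr_ge0.
move=> /allP v0; apply/eqP/rowP => i; rewrite mxE; apply/eqP.
by have := v0 i; rewrite mem_index_enum sqrf_eq0 => /(_ isT).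
Qed.

(** Over the complex numbers [M] is Hermitian, so it is unitarily diagonalizable with real spectrum.
    A real eigenvalue is a root of the characteristic polynomial, and this property descends to
    [R]. *)
Lemma symmetric_eigenvalue (R : realType) n (M : 'M[R]_n.+1) :
  M^T = M -> exists a, eigenvalue M a.
Proof.
move=> Msym; pose f := real_complex R; pose MC := map_mx f M.
have MCh : MC \is hermsymmx.
  apply/is_hermitianmxP; rewrite expr0 scale1r; apply/matrixP => i j.
  rewrite !mxE -[in LHS]Msym mxE.
  by apply/esym/CrealP; apply/complex_realP; exists (M j i).
have /mxOverP/(_ 0 0)/complex_realP[a sp0] := hermitian_spectral_diag_real MCh.
exists a; rewrite eigenvalue_root_char -(fmorph_root f) map_char_poly.
rewrite -eigenvalue_root_char -/MC; apply/eigenvalueP.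
have /hermitian_normalmx/orthomx_spectralP MCE := MCh.
have uP := spectral_unit MC.
move: (spectralmx MC) (spectral_diag MC) MCE uP sp0 => U s -> uU s0.
exists (row 0 U); last first.
  apply: contraTneq uU => r0; rewrite -row_free_unit -kermx_eq0.
  apply/negP => /eqP k0.
  have : delta_mx 0 0 *m U = 0 :> 'rV_ _ by rewrite -rowE.
  move=> /eqP; rewrite -sub_kermx k0 submx0 => /eqP/matrixP/(_ 0 0).
  by rewrite !mxE eqxx /= => /eqP; rewrite oner_eq0.
rewrite -row_mul !mulmxA mulmxV // mul1mx row_mul row_diag_mx s0.
by rewrite -scalemxAl -rowE.
Qed.

(* A Householder reflection maps the first basis vector to v. *)
Lemma orthogonal_mx_first_row (R : realType) n (v : 'rV[R]_n.+1) :
  (v *m v^T) 0 0 = 1 -> exists2 U : 'M[R]_n.+1, orthogonal_mx U & row 0 U = v.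
Proof.
move=> v1; pose e : 'rV[R]_n.+1 := delta_mx 0 0.
have [->|ve] := eqVneq v e.
  exists 1%:M; first by rewrite /orthogonal_mx trmx1 mul1mx.
  by rewrite rowE mulmx1.
have [w wE] : exists w, w = v - e by exists (v - e).
have w0 : 0 < (w *m w^T) 0 0 by apply: mulmx_tr_gt0; rewrite wE subr_eq0.
set c := (w *m w^T) 0 0 in w0.
have wwE : w *m w^T = c%:M by exact: mx11_scalar.
have ewE : e *m w^T = (v 0 0 - 1)%:M.
  by apply/matrixP => i j; rewrite !ord1 -rowE wE !mxE eqxx mulr1n.
have cE : c = 2 - 2 * v 0 0.
  have ev : (e *m v^T) 0 0 = v 0 0 by rewrite -rowE !mxE.
  have ee : (e *m e^T) 0 0 = 1 by rewrite -rowE !mxE eqxx.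
  have cB (a b : 'M[R]_1) : (a - b) 0 0 = a 0 0 - b 0 0 by rewrite !mxE.
  rewrite /c wE linearB /= mulmxBr 2!mulmxBl !cB v1 ev ee.
  have -> : (v *m e^T) 0 0 = v 0 0 by rewrite -[v *m _]trmxK trmx_mul trmxK mxE
    ev.
  by ring.
exists (1%:M - (2 / c) *: (w^T *m w)).
  rewrite /orthogonal_mx.
  have -> : (1%:M - (2 / c) *: (w^T *m w))^T = 1%:M - (2 / c) *: (w^T *m w).
    by rewrite raddfB /= linearZ /= trmx_mul trmxK trmx1.
  rewrite mulmxBl mul1mx mulmxBr mulmx1 -!scalemxAl -!scalemxAr !mulmxA.
  rewrite -(mulmxA w^T) wwE mul_mx_scalar -scalemxAl !scalerA.
  have -> : 2 / c * (2 / c * c) = 2 / c + 2 / c by field; rewrite gt_eqF.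
  by rewrite scalerDl opprB addrK subrK.
rewrite rowE mulmxBr mulmx1 -scalemxAr mulmxA ewE mul_scalar_mx scalerA.
have -> : 2 / c * (v 0 0 - 1) = - 1.
  have : c != 0 by rewrite gt_eqF.
  rewrite cE => c0; field; exact: c0.
by rewrite scaleN1r opprK wE addrC subrK.
Qed.

(** Deflation: an orthogonal matrix whose first row is a unit eigenvector turns [M] into a block
    diagonal matrix, and the induction hypothesis diagonalizes the lower block. *)
Lemma spectral_symmetric (R : realType) n (M : 'M[R]_n) : M^T = M ->
  exists U l, orthogonal_mx U /\ M = U *m diag_mx l *m U^T.
Proof.
elim: n M => [|n IH] M Msym.
  by exists 1%:M, 0; split; apply/matrixP => -[].
have [a /eigenvalueP[v vM v0]] := symmetric_eigenvalue Msym.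
pose c := (v *m v^T) 0 0; have c0 : 0 < c := mulmx_tr_gt0 v0.
pose u := (Num.sqrt c)^-1 *: v.
have [|U oU Uu] := @orthogonal_mx_first_row R n u.
  rewrite /u linearZ /= -scalemxAr -scalemxAl scalerA mxE -/c -expr2 exprVn.
  by rewrite sqr_sqrtr ?mulVf ?gt_eqF // ltW.
have uM : u *m M = a *: u by rewrite /u -scalemxAl vM !scalerA mulrC.
pose N : 'M[R]_(1 + n) := U *m M *m U^T.
have Nsym : N^T = N by rewrite /N !trmx_mul trmxK Msym mulmxA.
have N0 : row 0 N = a *: row 0 1%:M.
  by rewrite /N !row_mul Uu uM -scalemxAl -Uu -row_mul orthogonal_mxV.
have Nur : ursubmx N = 0.
  apply/matrixP => i j; rewrite !ord1 !mxE.
  have /rowP/(_ (rshift 1 j)) := N0; rewrite !mxE.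
  have -> : lshift n (0 : 'I_1) = 0 by exact: val_inj.
  by move=> ->; rewrite mulr0.
have Nul : ulsubmx N = a%:M.
  apply/matrixP => i j; rewrite !ord1 !mxE.
  have /rowP/(_ 0) := N0; rewrite !mxE.
  have -> : lshift n (0 : 'I_1) = 0 by exact: val_inj.
  by move=> ->; rewrite eqxx mulr1 mulr1n.
have Ndl : dlsubmx N = 0 by rewrite -[dlsubmx N]trmxK trmx_dlsub Nsym Nur trmx0.
have [|W [l [oW WE]]] := IH (drsubmx N); first by rewrite trmx_drsub Nsym.
have NE : N = block_mx a%:M 0 0 (drsubmx N) 
  by rewrite -[LHS]submxK Nul Nur Ndl.
pose V : 'M[R]_(1 + n) := block_mx 1%:M 0 0 W.
have oV : orthogonal_mx V.
  rewrite /orthogonal_mx tr_block_mx mulmx_block !trmx0 trmx1 !mulmx0 !mul0mx.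
  by rewrite !addr0 add0r mulmx1 oW -scalar_mx_block.
exists (U^T *m V), (row_mx a%:M l); split.
  by apply: orthogonal_mxM oV; exact: orthogonal_mx_tr.
have VN : V *m diag_mx (row_mx a%:M l) *m V^T = N.
  rewrite /V tr_block_mx !trmx0 trmx1 diag_mx_row !mulmx_block.
  rewrite !mulmx0 !mul0mx !addr0 !add0r mul1mx !mulmx1 NE WE.
  congr block_mx; last by rewrite mul0mx.
  by apply/matrixP => i j; rewrite !ord1 !mxE eqxx mulr1n.
rewrite trmx_mul trmxK -!mulmxA (mulmxA V) (mulmxA (V *m _)) VN.
by rewrite !mulmxA oU mul1mx -mulmxA oU mulmx1.
Qed.

Section spectral_calculus.
Context {R : realType}.
Implicit Types (n : nat) (f g : R -> R).

Definition spec n (U : 'M[R]_n) (l : 'rV[R]_n) := U *m diag_mx l *m U^T.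

Lemma specE n (U : 'M[R]_n) l i j :
  spec U l i j = \sum_k U i k * l 0 k * U j k.
Proof.
by rewrite /spec mul_mx_diag mxE; apply: eq_bigr => k _; rewrite !mxE.
Qed.

Lemma spec_tr n (U : 'M[R]_n) l : (spec U l)^T = spec U l.
Proof. by rewrite /spec !trmx_mul trmxK tr_diag_mx mulmxA. Qed.

(** With the eigenbasis [U] on the left and [V] on the right, each term becomes a diagonal scaling
    of the overlap matrix [U^T *m V], by rows or by columns. *)
Lemma spec_conj n (U V : 'M[R]_n) l m i j :
  orthogonal_mx U -> orthogonal_mx V ->
  (U^T *m (spec U l - spec V m) *m V) i j =
    (l 0 i - m 0 j) * (U^T *m V) i j.
Proof.
move=> oU oV; rewrite /spec mulmxBr mulmxBl !mulmxA oU mul1mx.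
rewrite -[_ *m V^T *m V]mulmxA oV mulmx1 -[_ *m U^T *m V]mulmxA.
move: (U^T *m V) => C; rewrite mul_diag_mx mul_mx_diag !mxE; ring.
Qed.

Lemma orthogonal_conj_inj n (U V X Y : 'M[R]_n) :
  orthogonal_mx U -> orthogonal_mx V -> U^T *m X *m V = U^T *m Y *m V -> X = Y.
Proof.
move=> oU oV /(congr1 (fun Z => U *m Z *m V^T)).
rewrite !mulmxA orthogonal_mxV // !mul1mx -!mulmxA orthogonal_mxV //.
by rewrite !mulmx1.
Qed.

(** Wherever the overlap of the [i]-th and [j]-th eigenvectors is nonzero, the eigenvalues [l 0 i]
    and [m 0 j] agree, hence so do their images under [f]. *)
Lemma spec_map_unique f n (U V : 'M[R]_n) l m :
  orthogonal_mx U -> orthogonal_mx V -> spec U l = spec V m ->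
  spec U (map_mx f l) = spec V (map_mx f m).
Proof.
move=> oU oV lm; apply/eqP; rewrite -subr_eq0; apply/eqP.
apply: (orthogonal_conj_inj oU oV); rewrite mulmx0 mul0mx.
apply/matrixP => i j; rewrite spec_conj // !mxE.
have : (U^T *m (spec U l - spec V m) *m V) i j = 0.
  by rewrite lm subrr mulmx0 mul0mx mxE.
rewrite spec_conj // => /eqP; rewrite mulf_eq0 subr_eq0.
by case/orP => /eqP; rewrite ?mxE => ->; rewrite ?subrr ?mul0r ?mulr0.
Qed.

Lemma spectral_spec n (M : 'M[R]_n) : M^T = M ->
  exists U l, orthogonal_mx U /\ M = spec U l.
Proof. exact: spectral_symmetric. Qed.

Lemma mxfun_spec f n (U : 'M[R]_n) l : orthogonal_mx U ->
  mxfun f (spec U l) = spec U (map_mx f l).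
Proof.
move=> oU; rewrite /mxfun;
  case: xgetP => [N _ [V [m [oV lm ->]]]|/(_ (spec U (map_mx f l)))].
  by apply: spec_map_unique => //; rewrite [LHS]lm.
by case; exists U, l.
Qed.

Lemma mxfun_nonsym f n (M : 'M[R]_n) : M^T != M -> mxfun f M = 0.
Proof.
move=> /eqP Msym; rewrite /mxfun; case: xgetP => // N _ [V [m [oV MV _]]].
by case: Msym; rewrite MV (spec_tr V m).
Qed.

Lemma mxfun_tr f n (M : 'M[R]_n) : (mxfun f M)^T = mxfun f M.
Proof.
have [Msym|/mxfun_nonsym->] := eqVneq M^T M; last by rewrite trmx0.
by have [U [l [oU ->]]] := spectral_spec Msym; rewrite mxfun_spec // spec_tr.
Qed.

Lemma mxtrace_spec n (U : 'M[R]_n) l : orthogonal_mx U ->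
  \tr (spec U l) = \sum_i l 0 i.
Proof.
move=> oU; rewrite mxtrace_mulC mulmxA oU mul1mx.
by apply: eq_bigr => i _; rewrite mxE eqxx.
Qed.

Lemma mxtrace_mul_spec n (U V : 'M[R]_n) l m :
  \tr (spec U l *m spec V m) =
    \sum_i \sum_j l 0 i * m 0 j * (U^T *m V) i j ^+ 2.
Proof.
have -> : \tr (spec U l *m spec V m) =
    \tr (diag_mx l *m (U^T *m V) *m diag_mx m *m (U^T *m V)^T).
  by rewrite /spec trmx_mul trmxK -!mulmxA mxtrace_mulC !mulmxA.
move: (U^T *m V) => C; rewrite mul_diag_mx mul_mx_diag.
apply: eq_bigr => i _; rewrite mxE; apply: eq_bigr => j _; rewrite !mxE; ring.
Qed.

Lemma spec_scalar n (U : 'M[R]_n) a : orthogonal_mx U ->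
  spec U (const_mx a) = a%:M.
Proof.
by move=> oU; rewrite /spec diag_const_mx mul_mx_scalar -scalemxAl
  orthogonal_mxV ?scalemx1.
Qed.

Lemma specD n (U : 'M[R]_n) l m : spec U (l + m) = spec U l + spec U m.
Proof. by rewrite /spec linearD /= mulmxDr mulmxDl. Qed.

Lemma specB n (U : 'M[R]_n) l m : spec U (l - m) = spec U l - spec U m.
Proof. by rewrite /spec linearB /= mulmxBr mulmxBl. Qed.

Lemma specZ n (U : 'M[R]_n) a l : spec U (a *: l) = a *: spec U l.
Proof. by rewrite /spec linearZ /= -scalemxAr -scalemxAl. Qed.

Lemma spec_sqr n (U : 'M[R]_n) l : orthogonal_mx U ->
  spec U l *m spec U l = spec U (map_mx (fun x => x ^+ 2) l).
Proof.
move=> oU; rewrite /spec !mulmxA -(mulmxA _ U^T U) oU mulmx1.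
rewrite -(mulmxA U) mulmx_diag; congr (_ *m diag_mx _ *m _).
by apply/rowP => i; rewrite !mxE expr2.
Qed.

Definition mexp n (M : 'M[R]_n) := mxfun expR M.

Lemma mexp_spec n (U : 'M[R]_n) l : orthogonal_mx U ->
  mexp (spec U l) = spec U (map_mx expR l).
Proof. exact: mxfun_spec. Qed.

End spectral_calculus.

(** * Lieb's concavity theorem in tangent form *)

Section antiderivatives.
Context {R : realType}.
Implicit Types (p q b s : R).

Lemma is_derive_sumf n (h : 'I_n -> R -> R) (dh : 'I_n -> R) (x : R) :
  (forall i, is_derive x 1 (h i) (dh i)) ->
  is_derive x 1 (fun s => \sum_i h i s) (\sum_i dh i).
Proof.
have -> : (fun s => \sum_i h i s) = \sum_i h i.
  by apply/funext => s; rewrite fct_sumE.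
exact: is_derive_sum.
Qed.

Lemma is_derive_mull (k x df : R) (f : R -> R) :
  is_derive x 1 f df -> is_derive x 1 (fun s => k * f s) (k * df).
Proof. by move=> fd; apply: (is_deriveZ (f := f) k). Qed.

Lemma is_derive_addf (x df dg : R) (f g : R -> R) : is_derive x 1 f df ->
  is_derive x 1 g dg -> is_derive x 1 (fun s => f s + g s) (df + dg).
Proof. by move=> fd gd; exact: (is_deriveD (f := f) (g := g)). Qed.

Lemma is_derive_subf (x df dg : R) (f g : R -> R) : is_derive x 1 f df ->
  is_derive x 1 g dg -> is_derive x 1 (fun s => f s - g s) (df - dg).
Proof. by move=> fd gd; exact: (is_deriveB (f := f) (g := g)). Qed.

Lemma is_derive_affine (b p s : R) : is_derive s 1 (fun s => b + s * p) p.
Proof.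
rewrite -[X in is_derive _ _ _ X]add0r; apply: is_derive_addf.
rewrite (_ : (fun s => _) = (fun s => p * s)); last by apply/funext => x;
  rewrite mulrC.
by rewrite -[X in is_derive _ _ _ X]mulr1; apply: is_derive_mull.
Qed.

(** Plays the part of integration over [[0, s]]: an inequality between integrands becomes one
    between antiderivatives. *)
Lemma nondecreasing_from0 (f df : R -> R) s : 0 <= s ->
  (forall x : R, 0 <= x -> is_derive x 1 f (df x)) ->
  (forall x : R, 0 <= x -> 0 <= df x) -> f 0 <= f s.
Proof.
move=> s0 fd df0.
have [x||c] := @MVT_segment R f df 0 s s0.
- by rewrite in_itv /= => /andP[x0 _]; apply: fd; exact: ltW.
- apply: derivable_within_continuous => x; rewrite in_itv /= => /andP[x0 _].
  by have [] := fd _ x0.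
- rewrite in_itv /= => /andP[c0 _] fE.
  by rewrite -subr_ge0 fE mulr_ge0 ?df0 // subr0.
Qed.

Lemma is_derive_ln_affine b p s : 0 < b + s * p ->
  is_derive s 1 (fun s => ln (b + s * p)) (p / (b + s * p)).
Proof.
move=> bsp.
have d1 := is_derive_affine b p s.
have d2 := is_derive1_ln bsp.
have := is_derive1_comp (f := @ln R) (g := fun s => b + s * p) d2 d1.
by rewrite mulrC.
Qed.

Lemma is_derive_inv_affine b p s : 0 < b + s * p ->
  is_derive s 1 (fun s => (b + s * p)^-1) (- (p / (b + s * p) ^+ 2)).
Proof.
move=> bsp.
have d1 := is_derive_affine b p s.
apply: is_derive_eq; first by apply: (is_deriveV (f := fun s => b + s * p));
  rewrite gt_eqF.
by rewrite /GRing.scale /= mulNr mulrC.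
Qed.

(** Dividing [b + s * p] by [s = n.+1] leaves a sequence that converges to [p]; both limits below
    reduce to this. *)
Lemma harmonic_affine b p n :
  b * harmonic n + p = (b + n.+1%:R * p) / n.+1%:R.
Proof.
have : n.+1%:R != 0 :> R by rewrite pnatr_eq0.
by rewrite /harmonic /=; move: (n.+1%:R) => k k0; field.
Qed.

Lemma cvg_ln_affine b p : 0 < p ->
  (fun n => ln (b + n.+1%:R * p) - ln n.+1%:R) @ \oo --> ln p.
Proof.
move=> p0.
have hc : (fun n => b * harmonic n + p) @ \oo --> p.
  rewrite -[X in _ --> X]add0r -[X in _ --> X + _](mulr0 b).
  by apply: cvgD; [apply: cvgMr; exact: cvg_harmonic|exact: cvg_cst].
have : (fun n => ln (b * harmonic n + p)) @ \oo --> ln p.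
  by apply: continuous_cvg => //; exact: continuous_ln.
apply: cvg_trans; apply: near_eq_cvg; near=> n.
have bp0 : 0 < b * harmonic n + p by near: n; exact: (cvgr_gt p).
move: bp0; rewrite harmonic_affine pmulr_lgt0 ?invr_gt0 // => bp0.
by rewrite ln_div ?posrE.
Unshelve. all: by end_near. Qed.

Lemma cvg_inv_affine b p : 0 < p ->
  (fun n => (b + n.+1%:R * p)^-1) @ \oo --> 0.
Proof.
move=> p0.
have hc : (fun n => b * harmonic n + p) @ \oo --> p.
  rewrite -[X in _ --> X]add0r -[X in _ --> X + _](mulr0 b).
  by apply: cvgD; [apply: cvgMr; exact: cvg_harmonic|exact: cvg_cst].
have : (fun n => (b * harmonic n + p)^-1 * harmonic n) @ \oo --> p^-1 * 0.
  by apply: cvgM; [apply: cvgV; rewrite ?gt_eqF|exact: cvg_harmonic].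
rewrite mulr0; apply: cvg_trans; apply: near_eq_cvg; near=> n.
rewrite harmonic_affine invfM invrK -mulrA mulfV ?mulr1 //; exact: lt0r_neq0.
Unshelve. all: by end_near. Qed.

(** For [b > 0], the antiderivative in [s], zero at 0, of [x + y - s * x * y], where
    [x = p / (b + s * p)] and [y = q / (b + s * q)]. The case [p = q] is the limit of the divided
    difference. *)
Definition ent_cross p q b s : R :=
  if p == q then ln (b + s * p) - ln b + (1 - b * (b + s * p)^-1)
  else (p * (ln (b + s * p) - ln b) - q * (ln (b + s * q) - ln b)) / (p - q).

(** The divided difference of [x * ln x] at [p] and [q], which is the derivative when they
    coincide. *)
Definition ent_cross_lim p q : R :=
  if p == q then ln p + 1 else (p * ln p - q * ln q) / (p - q).

Lemma ent_cross0 p q b : 0 < b -> ent_cross p q b 0 = 0.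
Proof.
move=> b0; rewrite /ent_cross !mul0r !addr0; case: ifP => _.
  by rewrite mulfV ?gt_eqF // !subrr addr0.
by rewrite subrr !mulr0 subrr mul0r.
Qed.

Lemma is_derive_ent_cross p q b s : 0 < p -> 0 < q -> 0 < b -> 0 <= s ->
  is_derive s 1 (ent_cross p q b)
    (p / (b + s * p) + q / (b + s * q)
      - s * (p / (b + s * p)) * (q / (b + s * q))).
Proof.
move=> p0 q0 b0 s0; rewrite /ent_cross.
have bp : 0 < b + s * p by rewrite ltr_wpDr ?mulr_ge0 // ltW.
have bq : 0 < b + s * q by rewrite ltr_wpDr ?mulr_ge0 // ltW.
have dp := is_derive_ln_affine bp; have dq := is_derive_ln_affine bq.
case: (eqVneq p q) => [pq|pq].
  have di := is_derive_inv_affine bp.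
  apply: is_derive_eq.
  by rewrite -pq /GRing.scale /=; field; rewrite gt_eqF.
apply: is_derive_eq.
by rewrite /GRing.scale /=; field; rewrite (gt_eqF bp) (gt_eqF bq) subr_eq0.
Qed.

Lemma cvg_ent_cross p q b : 0 < p -> 0 < q -> 0 < b ->
  (fun n => ent_cross p q b n.+1%:R - ln n.+1%:R) @ \oo
    --> ent_cross_lim p q - ln b.
Proof.
move=> p0 q0 b0; have cp := cvg_ln_affine b p0; have cq := cvg_ln_affine b q0.
rewrite /ent_cross /ent_cross_lim; case: (eqVneq p q) => [pq|pq].
  have ci := cvg_inv_affine b p0.
  rewrite (_ : (fun n => _) = (fun n => (ln (b + n.+1%:R * p) - ln n.+1%:R)
      - ln b + (1 - b * (b + n.+1%:R * p)^-1))); last by apply/funext => n;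
          ring.
  rewrite (_ : ln p + 1 - ln b = ln p - ln b + (1 - b * 0)); last by ring.
  apply: cvgD; first by apply: cvgB => //; exact: cvg_cst.
  by apply: cvgB; [exact: cvg_cst|exact: cvgMr].
rewrite (_ : (fun n => _) = (fun n => (p * (ln (b + n.+1%:R * p) - ln n.+1%:R)
    - q * (ln (b + n.+1%:R * q) - ln n.+1%:R)) / (p - q) - ln b)); last first.
  by apply/funext => n; field; rewrite subr_eq0.
apply: cvgB; last exact: cvg_cst.
by apply: cvgMl; apply: cvgB; exact: cvgMr.
Qed.

(** The antiderivative in [s], zero at 0, of the product of [p / (b + s * p)] and
    [p / (b' + s * p)]. *)
Definition ent_quad p b b' s : R :=
  if b == b' then p / b - p * (b + s * p)^-1
  else p / (b' - b) * (ln (b + s * p) - ln (b' + s * p) - (ln b - ln b')).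

(** [p] times the divided difference of [ln] at [b] and [b']. *)
Definition ent_quad_lim p b b' : R :=
  if b == b' then p / b else p / (b' - b) * (ln b' - ln b).

Lemma ent_quad0 p b b' : ent_quad p b b' 0 = 0.
Proof. by rewrite /ent_quad !mul0r !addr0 !subrr mulr0 if_same. Qed.

Lemma is_derive_ent_quad p b b' s : 0 < p -> 0 < b -> 0 < b' -> 0 <= s ->
  is_derive s 1 (ent_quad p b b') ((p / (b + s * p)) * (p / (b' + s * p))).
Proof.
move=> p0 b0 b0' s0; rewrite /ent_quad.
have bp : 0 < b + s * p by rewrite ltr_wpDr ?mulr_ge0 // ltW.
have bp' : 0 < b' + s * p by rewrite ltr_wpDr ?mulr_ge0 // ltW.
case: (eqVneq b b') => [bb'|bb'].
  have di := is_derive_inv_affine bp.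
  apply: is_derive_eq.
  by rewrite -bb' /GRing.scale /=; field; rewrite gt_eqF.
have dp := is_derive_ln_affine bp; have dq := is_derive_ln_affine bp'.
apply: is_derive_eq.
by rewrite /GRing.scale /=; field;
  rewrite (gt_eqF bp) (gt_eqF bp') subr_eq0 eq_sym.
Qed.

Lemma cvg_ent_quad p b b' : 0 < p ->
  (fun n => ent_quad p b b' n.+1%:R) @ \oo --> ent_quad_lim p b b'.
Proof.
move=> p0; rewrite /ent_quad /ent_quad_lim; case: (eqVneq b b') => [bb'|bb'].
  rewrite -[X in _ --> X]subr0 -[X in _ --> _ - X](mulr0 p).
  by apply: cvgB; [exact: cvg_cst|apply: cvgMr; exact: cvg_inv_affine].
rewrite (_ : ln b' - ln b = (ln p - ln p) - (ln b - ln b')); last by ring.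
apply: cvgMr; apply: cvgB; last exact: cvg_cst.
rewrite (_ : (fun n => _) = (fun n => (ln (b + n.+1%:R * p) - ln n.+1%:R) -
  (ln (b' + n.+1%:R * p) - ln n.+1%:R))); last by apply/funext => n; ring.
by apply: cvgB; exact: cvg_ln_affine.
Qed.

End antiderivatives.

(** * Tangent inequality for relative entropy *)

Section relative_entropy.
Context {R : realType}.

Lemma cvg_sumf m (g : 'I_m -> nat -> R) (l : 'I_m -> R) :
  (forall i, g i @ \oo --> l i) ->
  (fun k => \sum_i g i k) @ \oo --> \sum_i l i.
Proof.
move=> gl; have -> : (fun k => \sum_i g i k) = \sum_i g i.
  by apply/funext => k; rewrite fct_sumE.
elim/big_ind2 : _ => [|f x h y fx hy|i _];
  [exact: cvg_cst|exact: cvgD|exact: gl].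
Qed.

Lemma mxtrace_diag_mul n (D Y : 'M[R]_n) (t : 'rV[R]_n) :
  \tr (diag_mx t *m D *m Y^T) = \sum_k \sum_j t 0 k * D k j * Y k j.
Proof.
rewrite mul_diag_mx; apply: eq_bigr => k _; rewrite mxE.
by apply: eq_bigr => j _; rewrite !mxE.
Qed.

(* Joint convexity of [(X, Y) |-> <X, Y^-1 X>] at the commuting positive
   operators [W |-> W A + s T W]: completing the square in the eigenbases. *)
Lemma frac_tangent n (P Q W : 'M[R]_n) (t a : 'rV[R]_n) (s : R) :
  orthogonal_mx P -> orthogonal_mx Q ->
  (forall k, 0 < t 0 k) -> (forall j, 0 < a 0 j) -> 0 <= s ->
  2 * \tr (spec P t *m W^T) - \tr (W^T *m W *m spec Q a)
    - s * \tr (W *m W^T *m spec P t) <=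
  \sum_k \sum_j (P^T *m Q) k j ^+ 2 * t 0 k * (t 0 k / (a 0 j + s * t 0 k)).
Proof.
move=> oP oQ t0 a0 s0; pose Y := P^T *m W *m Q; pose D := P^T *m Q.
have WE : W = P *m Y *m Q^T.
  by rewrite /Y !mulmxA orthogonal_mxV // mul1mx -mulmxA orthogonal_mxV ?mulmx1.
have DE : P^T *m Q = D by [].
move: Y WE D DE => Y -> D DE.
have -> : \tr (spec P t *m (P *m Y *m Q^T)^T) =
    \sum_k \sum_j t 0 k * D k j * Y k j.
  rewrite -mxtrace_diag_mul -DE !trmx_mul trmxK /spec -!mulmxA mxtrace_mulC.
  by rewrite !mulmxA -[_ *m P^T *m P]mulmxA oP mulmx1.
have -> : \tr ((P *m Y *m Q^T)^T *m (P *m Y *m Q^T) *m spec Q a) =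
    \sum_k \sum_j a 0 j * Y k j ^+ 2.
  rewrite exchange_big /= !trmx_mul trmxK /spec !mulmxA.
  rewrite -[_ *m P^T *m P]mulmxA oP mulmx1 -[_ *m Q^T *m Q]mulmxA oQ mulmx1.
  rewrite mxtrace_mulC !mulmxA oQ mul1mx mxtrace_mulC mulmxA.
  rewrite -[X in _ *m X]trmxK mxtrace_diag_mul; apply: eq_bigr => j _.
  by apply: eq_bigr => k _; rewrite !mxE expr2 mulrA.
have -> : \tr (P *m Y *m Q^T *m (P *m Y *m Q^T)^T *m spec P t) =
    \sum_k \sum_j t 0 k * Y k j ^+ 2.
  rewrite !trmx_mul trmxK /spec !mulmxA.
  rewrite -[_ *m Q^T *m Q]mulmxA oQ mulmx1 -[_ *m P^T *m P]mulmxA oP mulmx1.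
  rewrite mxtrace_mulC !mulmxA oP mul1mx mxtrace_mulC mulmxA.
  rewrite mxtrace_diag_mul; apply: eq_bigr => k _.
  by apply: eq_bigr => j _; rewrite expr2 mulrA.
rewrite !mulr_sumr -!sumrB ler_sum // => k _.
rewrite !mulr_sumr -!sumrB ler_sum // => j _.
rewrite DE; move: (Y k j) (D k j) => y d.
have c0 : 0 < a 0 j + s * t 0 k by rewrite ltr_wpDr ?mulr_ge0 // ltW.
rewrite -subr_ge0.
rewrite (_ : _ - _ = (t 0 k * d / (a 0 j + s * t 0 k) - y) ^+ 2 * (a 0 j + s *
  t 0 k)).
  by rewrite mulr_ge0 ?sqr_ge0 // ltW.
by field; rewrite gt_eqF.
Qed.

Lemma tr_mul_mx m n (X : 'M[R]_(m, n)) (Y : 'M[R]_(n, m)) :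
  \tr (X *m Y) = \sum_i \sum_j X i j * Y j i.
Proof. by apply: eq_bigr => i _; rewrite mxE. Qed.

(** The test matrix is [U *m w *m V^T], with [w] the entrywise product of [x] and the overlap matrix
    [C]. For eigenbases [U] and [V] of a reference pair, [T'] and [A'] are free of [s] and only the
    scalars [x k i] will vary with it, so the left side integrates term by term. *)
Lemma frac_tangent_coord n (P Q U V C T' A' : 'M[R]_n)
    (t a : 'rV[R]_n) (s : R) (x : 'I_n -> 'I_n -> R) :
  orthogonal_mx P -> orthogonal_mx Q -> orthogonal_mx U -> orthogonal_mx V ->
  (forall k, 0 < t 0 k) -> (forall j, 0 < a 0 j) -> 0 <= s ->
  C = U^T *m V -> T' = U^T *m spec P t *m U -> A' = V^T *m spec Q a *m V ->
  \sum_k \sum_k' \sum_i (T' k k' * (C k i * C k' i))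
      * (x k i + x k' i - s * x k i * x k' i)
    - \sum_i \sum_i' \sum_k (A' i i' * (C k i * C k i')) * (x k i * x k i') <=
  \sum_k \sum_j (P^T *m Q) k j ^+ 2 * t 0 k * (t 0 k / (a 0 j + s * t 0 k)).
Proof.
move=> oP oQ oU oV t0 a0 s0 CE TE AE.
pose w : 'M[R]_n := \matrix_(k, i) (x k i * C k i).
have T's : T'^T = T' by rewrite TE 2!trmx_mul trmxK spec_tr mulmxA.
apply: le_trans (frac_tangent (U *m w *m V^T) oP oQ t0 a0 s0).
rewrite le_eqVlt; apply/orP; left; apply/eqP.
have -> : \tr (spec P t *m (U *m w *m V^T)^T) = \tr (T' *m (C *m w^T)).
  rewrite TE CE !trmx_mul trmxK !mulmxA -[_ *m U *m U^T]mulmxA.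
  by rewrite orthogonal_mxV // mulmx1 mxtrace_mulC !mulmxA.
have -> : \tr ((U *m w *m V^T)^T *m (U *m w *m V^T) *m spec Q a) =
    \tr (A' *m (w^T *m w)).
  rewrite AE !trmx_mul trmxK !mulmxA -[_ *m U^T *m U]mulmxA oU mulmx1.
  by rewrite -!mulmxA mulmxA mulmxA mxtrace_mulC !mulmxA.
have -> : \tr ((U *m w *m V^T) *m (U *m w *m V^T)^T *m spec P t) =
    \tr (T' *m (w *m w^T)).
  rewrite TE !trmx_mul trmxK !mulmxA -[_ *m V^T *m V]mulmxA oV mulmx1.
  by rewrite -!mulmxA mulmxA mulmxA mxtrace_mulC !mulmxA.
have wE k i : w k i = x k i * C k i by rewrite mxE.
have T'sym k k' : T' k' k = T' k k' by rewrite -[in LHS]T's mxE.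
have E1 : \tr (T' *m (C *m w^T)) =
    \sum_k \sum_k' \sum_i (T' k k' * (C k i * C k' i)) * x k i.
  rewrite tr_mul_mx; apply: eq_bigr => k _; apply: eq_bigr => k' _.
  by rewrite mxE mulr_sumr; apply: eq_bigr => i _; rewrite [w^T _ _]mxE wE;
    ring.
(* The symmetry of [T'] splits the factor 2 of the linear term into [x k i + x k' i], the shape of
   the integrand of [ent_cross]. *)
have E2 : \tr (T' *m (C *m w^T)) =
    \sum_k \sum_k' \sum_i (T' k k' * (C k i * C k' i)) * x k' i.
  rewrite E1 exchange_big /=; apply: eq_bigr => k _; apply: eq_bigr => k' _.
  by apply: eq_bigr => i _; rewrite T'sym [C k' i * _]mulrC.
rewrite mulrDl mul1r {1}E1 E2 !tr_mul_mx.
have -> : \sum_i \sum_i' \sum_k (A' i i' * (C k i * C k i')) * (x k i * x k i')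
    = \sum_i \sum_j A' i j * (w^T *m w) j i.
  apply: eq_bigr => i _; apply: eq_bigr => j _; rewrite mxE mulr_sumr.
  by apply: eq_bigr => k _; rewrite mxE !wE; ring.
rewrite -addrA [- _ - _]addrC addrA; congr (_ - _).
rewrite mulr_sumr -!big_split -sumrB /=; apply: eq_bigr => k _.
rewrite mulr_sumr -!big_split -sumrB /=; apply: eq_bigr => k' _.
rewrite mxE !mulr_sumr -!big_split -sumrB /=; apply: eq_bigr => i _.
by rewrite [w^T _ _]mxE !wE; ring.
Qed.

(* The integral of [frac_tangent_coord] over [s] in [0, +oo): the two sides
   grow like [\tr T * ln s], and this common divergent part cancels. *)
Lemma entropy_tangent n (P Q U V C T' A' : 'M[R]_n) (t a tau b : 'rV[R]_n) :
  orthogonal_mx P -> orthogonal_mx Q -> orthogonal_mx U -> orthogonal_mx V ->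
  (forall k, 0 < t 0 k) -> (forall j, 0 < a 0 j) ->
  (forall k, 0 < tau 0 k) -> (forall j, 0 < b 0 j) ->
  C = U^T *m V -> T' = U^T *m spec P t *m U -> A' = V^T *m spec Q a *m V ->
  \sum_k \sum_k' \sum_i (T' k k' * (C k i * C k' i))
      * (ent_cross_lim (tau 0 k) (tau 0 k') - ln (b 0 i))
    - \sum_i \sum_i' \sum_k (A' i i' * (C k i * C k i'))
      * ent_quad_lim (tau 0 k) (b 0 i) (b 0 i') <=
  \sum_k \sum_j (P^T *m Q) k j ^+ 2 * t 0 k * (ln (t 0 k) - ln (a 0 j)).
Proof.
move=> oP oQ oU oV t0 a0 tau0 b0 CE TE AE; set D := P^T *m Q.
pose f1 s := \sum_k \sum_k' \sum_i (T' k k' * (C k i * C k' i))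
  * ent_cross (tau 0 k) (tau 0 k') (b 0 i) s.
pose f2 s := \sum_i \sum_i' \sum_k (A' i i' * (C k i * C k i'))
  * ent_quad (tau 0 k) (b 0 i) (b 0 i') s.
pose f3 s := \sum_k \sum_j D k j ^+ 2 * t 0 k
  * (ln (a 0 j + s * t 0 k) - ln (a 0 j)).
have f_ge0 s : 0 <= s -> f1 s - f2 s <= f3 s.
  move=> s0.
  have f00 : f3 0 - (f1 0 - f2 0) = 0.
    rewrite /f1 /f2 /f3.
    under eq_bigr do under eq_bigr do rewrite mul0r addr0 subrr mulr0.
    under [X in _ - (X - _)]eq_bigr do under eq_bigr do under eq_bigr do
      rewrite ent_cross0 // mulr0.
    under [X in _ - (_ - X)]eq_bigr do under eq_bigr do under eq_bigr do
      rewrite ent_quad0 mulr0.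
    by do ?[rewrite big1 // => *]; rewrite !subr0.
  (* The maximizing test matrix of the reference pair [tau], [b]: with it the square behind
     [frac_tangent] vanishes when the two pairs coincide, so the bound is a tangent there. *)
  pose x s k i := tau 0 k / (b 0 i + s * tau 0 k).
  rewrite -subr_ge0 -f00.
  apply: (@nondecreasing_from0 _ (fun s => f3 s - (f1 s - f2 s)) (fun s =>
    \sum_k \sum_j D k j ^+ 2 * t 0 k * (t 0 k / (a 0 j + s * t 0 k)) -
    (\sum_k \sum_k' \sum_i (T' k k' * (C k i * C k' i))
      * (x s k i + x s k' i - s * x s k i * x s k' i)
    - \sum_i \sum_i' \sum_k (A' i i' * (C k i * C k i')) * (x s k i * x s k
        i')))) => //.
    move=> y y0; apply: is_derive_subf.
      apply: is_derive_sumf => k; apply: is_derive_sumf => j.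
      apply: is_derive_mull; rewrite -[X in is_derive _ _ _ X]subr0.
      apply: is_derive_subf.
      by apply: is_derive_ln_affine; rewrite ltr_wpDr ?mulr_ge0 // ltW.
    apply: is_derive_subf.
      apply: is_derive_sumf => k; apply: is_derive_sumf => k'.
      apply: is_derive_sumf => i; apply: is_derive_mull.
      exact: is_derive_ent_cross.
    apply: is_derive_sumf => i; apply: is_derive_sumf => i'.
    apply: is_derive_sumf => k; apply: is_derive_mull.
    exact: is_derive_ent_quad.
  move=> y y0; rewrite subr_ge0.
  exact: (frac_tangent_coord (x y) oP oQ oU oV t0 a0 y0 CE TE AE).
have c13 : \sum_k \sum_k' \sum_i T' k k' * (C k i * C k' i) =
    \sum_k \sum_j D k j ^+ 2 * t 0 k.
  transitivity (\tr (T' *m (C *m C^T))).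
    rewrite tr_mul_mx; apply: eq_bigr => k _; apply: eq_bigr => k' _.
    by rewrite mxE mulr_sumr; apply: eq_bigr => i _;
      rewrite mxE [C k i * _]mulrC.
  have -> : C *m C^T = 1%:M.
    by apply: orthogonal_mxV; rewrite CE; apply: orthogonal_mxM => //;
      exact: orthogonal_mx_tr.
  rewrite mulmx1 TE mxtrace_mulC mulmxA orthogonal_mxV //
    mul1mx mxtrace_spec //.
  apply: eq_bigr => k _; rewrite -mulr_suml.
  have : (D *m D^T) k k = 1.
    rewrite orthogonal_mxV; first by rewrite mxE eqxx.
    by apply: orthogonal_mxM => //; exact: orthogonal_mx_tr.
  rewrite mxE; under eq_bigr do rewrite [D^T _ _]mxE -expr2.
  by move=> ->; rewrite mul1r.
pose L (m : nat) : R := ln m.+1%:R.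
have l1 : (fun m => \sum_k \sum_k' \sum_i (T' k k' * (C k i * C k' i))
    * (ent_cross (tau 0 k) (tau 0 k') (b 0 i) m.+1%:R - L m)) @ \oo -->
  \sum_k \sum_k' \sum_i (T' k k' * (C k i * C k' i))
      * (ent_cross_lim (tau 0 k) (tau 0 k') - ln (b 0 i)).
  apply: cvg_sumf => k; apply: cvg_sumf => k'; apply: cvg_sumf => i.
  by apply: cvgMr; exact: cvg_ent_cross.
have l2 : (fun m => f2 m.+1%:R) @ \oo -->
    \sum_i \sum_i' \sum_k (A' i i' * (C k i * C k i'))
      * ent_quad_lim (tau 0 k) (b 0 i) (b 0 i').
  apply: cvg_sumf => i; apply: cvg_sumf => i'; apply: cvg_sumf => k.
  by apply: cvgMr; exact: cvg_ent_quad.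
have l3 : (fun m => \sum_k \sum_j D k j ^+ 2 * t 0 k
    * (ln (a 0 j + m.+1%:R * t 0 k) - L m - ln (a 0 j))) @ \oo -->
  \sum_k \sum_j D k j ^+ 2 * t 0 k * (ln (t 0 k) - ln (a 0 j)).
  apply: cvg_sumf => k; apply: cvg_sumf => j.
  by apply: cvgMr; apply: cvgB; [exact: cvg_ln_affine|exact: cvg_cst].
apply: ler_cvg_to (cvgB l1 l2) l3 _; apply: nearW => m; rewrite fctE /=.
have := f_ge0 m.+1%:R (ler0n _ _).
set u1 := (X in X - _ <= _ -> _); set u3 := (X in _ <= X -> _).
have -> : \sum_k \sum_k' \sum_i (T' k k' * (C k i * C k' i))
    * (ent_cross (tau 0 k) (tau 0 k') (b 0 i) m.+1%:R - L m) = u1 -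
    (\sum_k \sum_k' \sum_i T' k k' * (C k i * C k' i)) * L m.
  rewrite /u1 /f1 mulr_suml -sumrB; apply: eq_bigr => k _.
  rewrite mulr_suml -sumrB; apply: eq_bigr => k' _.
  by rewrite mulr_suml -sumrB; apply: eq_bigr => i _; rewrite mulrBr.
have -> : \sum_k \sum_j D k j ^+ 2 * t 0 k
    * (ln (a 0 j + m.+1%:R * t 0 k) - L m - ln (a 0 j)) = u3 -
    (\sum_k \sum_j D k j ^+ 2 * t 0 k) * L m.
  rewrite /u3 /f3 mulr_suml -sumrB; apply: eq_bigr => k _.
  by rewrite mulr_suml -sumrB; apply: eq_bigr => j _; ring.
by rewrite c13 addrAC lerD2r.
Qed.

End relative_entropy.

Section lieb.
Context {R : realType}.

Lemma orthogonal_row_sqr n (D : 'M[R]_n) k : orthogonal_mx D ->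
  \sum_j D k j ^+ 2 = 1.
Proof.
move=> oD; have : (D *m D^T) k k = 1 by rewrite orthogonal_mxV // mxE eqxx.
by rewrite mxE => <-; apply: eq_bigr => j _; rewrite [D^T _ _]mxE expr2.
Qed.

Lemma mxtrace_mul_specr n (M U : 'M[R]_n) l :
  \tr (M *m spec U l) = \sum_k (U^T *m M *m U) k k * l 0 k.
Proof.
rewrite /spec !mulmxA mxtrace_mulC !mulmxA mul_mx_diag.
by apply: eq_bigr => k _; rewrite mxE.
Qed.

Lemma mxtrace_mexp_ge0 n (M : 'M[R]_n) : 0 <= \tr (mexp M).
Proof.
have [Ms|/mxfun_nonsym ns] := eqVneq M^T M; last by rewrite /mexp ns linear0.
have [W [m [oW ->]]] := spectral_spec Ms.
by rewrite mexp_spec // mxtrace_spec // sumr_ge0 // => i _;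
  rewrite mxE expR_ge0.
Qed.

(** [F] stands for the logarithm of a positive definite argument. The point of contact is left out:
    later steps use only the domination. *)
Definition supergradient n (K G : 'M[R]_n) := forall F, F^T = F ->
  \tr (mexp (K + F)) <= \tr (G *m mexp F).

(* The concave function [A |-> \tr (exp (K + ln A))] is homogeneous of degree
   one, so it lies below its differential [G] at [exp H] (Lieb). *)
Lemma lieb_supergradient n (K H : 'M[R]_n) : K^T = K -> H^T = H ->
  exists G, \tr (G *m mexp H) = \tr (mexp (K + H)) /\ supergradient K G.
Proof.
move=> Ks Hs.
have [V [h [oV HE]]] := spectral_spec Hs.
have [|U [kap [oU KHE]]] := @spectral_spec _ _ (K + H);
  first by rewrite linearD /= Ks Hs.
pose b := map_mx expR h; pose tau := map_mx expR kap; pose C := U^T *m V.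
have oC : orthogonal_mx C by apply: orthogonal_mxM => //;
  exact: orthogonal_mx_tr.
have b0 i : 0 < b 0 i by rewrite mxE expR_gt0.
have tau0 i : 0 < tau 0 i by rewrite mxE expR_gt0.
(* In the eigenbasis of [H], this is the derivative of the matrix logarithm at [exp H], applied to
   [exp (K + H)]: divided differences of [ln] times the entries of [exp (K + H)]. *)
pose Gm : 'M[R]_n := \matrix_(i', i)
  \sum_k (C k i * C k i') * ent_quad_lim (tau 0 k) (b 0 i) (b 0 i').
exists (V *m Gm *m V^T); split.
  rewrite KHE HE !mexp_spec // mxtrace_spec // mxtrace_mul_specr.
  rewrite !mulmxA oV mul1mx -mulmxA oV mulmx1.
  transitivity (\sum_k \sum_i C k i ^+ 2 * tau 0 k); last first.
    by apply: eq_bigr => k _; rewrite -mulr_suml orthogonal_row_sqr //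
      mul1r mxE.
  rewrite exchange_big; apply: eq_bigr => i _; rewrite mxE mulr_suml.
  apply: eq_bigr => k _; rewrite /ent_quad_lim eqxx /b mxE.
  by field; rewrite gt_eqF ?expR_gt0.
move=> F Fs.
have [Q [f [oQ FE]]] := spectral_spec Fs.
have [|P [th [oP KFE]]] := @spectral_spec _ _ (K + F);
  first by rewrite linearD /= Ks Fs.
pose a := map_mx expR f; pose t := map_mx expR th.
have a0 i : 0 < a 0 i by rewrite mxE expR_gt0.
have t0 i : 0 < t 0 i by rewrite mxE expR_gt0.
have oD : orthogonal_mx (P^T *m Q) by apply: orthogonal_mxM => //;
  exact: orthogonal_mx_tr.
have := entropy_tangent oP oQ oU oV t0 a0 tau0 b0 (erefl C) (erefl _) (erefl _).
have -> : mexp (K + F) = spec P t by rewrite KFE mexp_spec.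
have -> : mexp F = spec Q a by rewrite FE mexp_spec.
set T := spec P t; set A := spec Q a.
(* [K] is [ln T - ln A], so the relative entropy of [T] and [A] is linear in [K]. *)
have -> : \sum_k \sum_j (P^T *m Q) k j ^+ 2 * t 0 k * (ln (t 0 k) - ln (a 0 j))
    = \tr (T *m K).
  have -> : K = spec P th - spec Q f by rewrite -KFE -FE addrK.
  rewrite mulmxBr linearB /= !mxtrace_mul_spec -sumrB.
  apply: eq_bigr => k _; rewrite -sumrB.
  under eq_bigr do rewrite mulrBr.
  rewrite [LHS]sumrB [RHS]sumrB; congr (_ - _); last first.
    by apply: eq_bigr => j _; rewrite [a _ _]mxE expRK -[LHS]mulrA [LHS]mulrC.
  rewrite -!mulr_suml orthogonal_row_sqr // oP.
  rewrite (bigD1 k) //= big1 => [|j jk];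
    last by rewrite [X in X ^+ 2]mxE eq_sym (negPf jk) expr0n mulr0.
  by rewrite [X in X ^+ 2]mxE eqxx expr1n addr0 mul1r mulr1 [t _ _]mxE expRK.
(* [K] is also the difference of the logarithms of the reference pair. Orthogonality of [C] keeps
   only the diagonal divided differences [ln p + 1], and their 1 produces the extra [\tr T]. *)
have -> : \sum_k \sum_k' \sum_i ((U^T *m T *m U) k k' * (C k i * C k' i))
    * (ent_cross_lim (tau 0 k) (tau 0 k') - ln (b 0 i)) =
    \tr (T *m K) + \tr T.
  have -> : K = spec U kap - spec V h by rewrite -KHE -HE addrK.
  have -> : \tr T = \sum_k (U^T *m T *m U) k k.
    rewrite -/(\tr (U^T *m T *m U)) [RHS]mxtrace_mulC mulmxA.
    by rewrite orthogonal_mxV // mul1mx.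
  rewrite mulmxBr linearB /= mxtrace_mul_specr.
  have -> : \tr (T *m spec V h) =
      \sum_k \sum_k' \sum_i (U^T *m T *m U) k k' * (C k i * C k' i) * ln (b 0
        i).
    transitivity (\tr (U^T *m T *m U *m spec C h)).
      rewrite /spec /C trmx_mul trmxK !mulmxA -[_ *m U *m U^T]mulmxA.
      rewrite orthogonal_mxV // mulmx1 [RHS]mxtrace_mulC !mulmxA.
      by rewrite orthogonal_mxV // mul1mx.
    rewrite tr_mul_mx; apply: eq_bigr => k _; apply: eq_bigr => k' _.
    rewrite specE mulr_sumr; apply: eq_bigr => i _.
    by rewrite [b _ _]mxE expRK; ring.
  rewrite addrAC -big_split -sumrB /=; apply: eq_bigr => k _.
  have -> : (U^T *m T *m U) k k * kap 0 k + (U^T *m T *m U) k k =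
      \sum_k' \sum_i (U^T *m T *m U) k k' * (C k i * C k' i)
        * ent_cross_lim (tau 0 k) (tau 0 k').
    under eq_bigr do rewrite -mulr_suml -mulr_sumr.
    have CC k' : \sum_i C k i * C k' i = (k == k')%:R.
      have /matrixP/(_ k k') := orthogonal_mxV oC; rewrite !mxE => <-.
      by apply: eq_bigr => i _; rewrite [C^T _ _]mxE.
    rewrite (bigD1 k) //= CC eqxx big1 => [|k' k'k]; last first.
      by rewrite CC eq_sym (negPf k'k) mulr0 mul0r.
    by rewrite /ent_cross_lim eqxx [tau _ _]mxE expRK addr0 mulr1 mulrDr mulr1.
  rewrite -sumrB; apply: eq_bigr => k' _; rewrite -sumrB.
  by apply: eq_bigr => i _; rewrite mulrBr.
have -> : \sum_i \sum_i' \sum_k ((V^T *m A *m V) i i' * (C k i * C k i'))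
    * ent_quad_lim (tau 0 k) (b 0 i) (b 0 i') = \tr (V *m Gm *m V^T *m A).
  rewrite -(mulmxA _ V^T) mxtrace_mulC (mulmxA _ V Gm) tr_mul_mx.
  apply: eq_bigr => i _; apply: eq_bigr => i' _.
  by rewrite [Gm _ _]mxE mulr_sumr; apply: eq_bigr => k _; rewrite -[LHS]mulrA.
by rewrite -addrA gerDl subr_le0.
Qed.

(* [lieb_supergradient] makes [\tr (G *m _)] monotone: a positive definite
   matrix is an exponential. *)
Lemma supergradient_ge0 n (K G U : 'M[R]_n) (l : 'rV[R]_n) : orthogonal_mx U ->
  supergradient K G ->
  (forall i, 0 <= l 0 i) -> 0 <= \tr (G *m spec U l).
Proof.
move=> oU GK l0.
(* The eigenvalues may be 0, so the logarithm is taken of [l + e], and [e] is made arbitrarily small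
   afterwards. *)
have Ge e : 0 < e -> 0 <= \tr (G *m spec U l) + e * \tr G.
  move=> e0; pose F := spec U (map_mx (fun x => ln (x + e)) l).
  have -> : \tr (G *m spec U l) + e * \tr G = \tr (G *m mexp F).
    rewrite mexp_spec // (_ : map_mx _ _ = l + const_mx e); last first.
      by apply/rowP => i; rewrite !mxE lnK // posrE ltr_wpDl.
    by rewrite specD spec_scalar // mulmxDr mxtraceD mul_mx_scalar mxtraceZ.
  by apply: (le_trans _ (GK F _)); rewrite ?mxtrace_mexp_ge0 ?spec_tr.
apply/ler_addgt0Pr => e e0.
have g0 : 0 < `|\tr G| + 1 by rewrite ltr_wpDl.
have := Ge (e / (`|\tr G| + 1)) (divr_gt0 e0 g0).
move=> /le_trans; apply; rewrite lerD2l -mulrA.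
rewrite -[leRHS]mulr1 ler_pM2l // mulrC ler_pdivrMr //
  mul1r (le_trans (ler_norm _)) //.
by rewrite lerDl.
Qed.

Lemma supergradient_le n (K G U : 'M[R]_n) (l m : 'rV[R]_n) : orthogonal_mx U ->
  supergradient K G ->
  (forall i, l 0 i <= m 0 i) -> \tr (G *m spec U l) <= \tr (G *m spec U m).
Proof.
move=> oU GK lm; rewrite -subr_ge0 -linearB /= -mulmxBr -specB.
by apply: supergradient_ge0 GK _ => // i; rewrite !mxE subr_ge0.
Qed.

End lieb.

(** * Influence function, dilations and thresholding *)

Section influence.
Context {R : realType}.
Implicit Types x y h : R.

Lemma expR_ge_quad h : 0 <= h -> 1 + h + h ^+ 2 / 2 <= expR h.
Proof.
move=> h0; rewrite -subr_ge0.
have -> : 0 = expR 0 - (1 + 0 + 0 ^+ 2 / 2) :> R.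
  by rewrite expR0 expr0n mul0r !addr0 subrr.
apply: (@nondecreasing_from0 _ (fun s : R => expR s - (1 + s + s ^+ 2 / 2))
  (fun s => expR s - (1 + s))) => // s s0; last by rewrite subr_ge0 expR_ge1Dx.
apply: is_derive_eq.
by rewrite /GRing.scale /=; field.
Qed.

(** Twice the bound of [cosh] by its quadratic Taylor polynomial, from two differentiations. It
    extracts a second moment from exponential moments. *)
Lemma expRDN_ge_sqr x : 2 + x ^+ 2 <= expR x + expR (- x).
Proof.
wlog x0 : x / 0 <= x.
  move=> H; have [/H//|/ltW x0] := leP 0 x.
  by have := H (- x); rewrite opprK sqrrN [_ + expR x]addrC; apply;
    rewrite oppr_ge0.
have sinh_ge y : 0 <= y -> 0 <= expR y - expR (- y) - 2 * y.
  move=> y0.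
  have -> : 0 = expR 0 - expR (- 0) - 2 * 0 :> R by rewrite oppr0 mulr0 !subrr.
  apply: (@nondecreasing_from0 _ (fun s : R => expR s - expR (- s) - 2 * s)
    (fun s => expR s + expR (- s) - 2)) => // s s0.
    by apply: is_derive_eq; rewrite /GRing.scale /=; ring.
  by have := expR_ge1Dx s; have := expR_ge1Dx (- s); lra.
rewrite -subr_ge0.
have -> : 0 = expR 0 + expR (- 0) - (2 + 0 ^+ 2) :> R.
  by rewrite oppr0 expR0 expr0n addr0; ring.
apply: (@nondecreasing_from0 _ (fun s : R => expR s + expR (- s) - (2 + s ^+ 2))
  (fun s => expR s - expR (- s) - 2 * s)) => // s s0.
by apply: is_derive_eq; rewrite /GRing.scale /=; ring.
Qed.

Lemma quad_gt0 x : 0 < 1 + x + x ^+ 2 / 2.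
Proof.
rewrite (_ : _ + _ = ((1 + x) ^+ 2 + 1) / 2); last by field.
by rewrite divr_gt0 // ltr_wpDl ?sqr_ge0.
Qed.

Lemma quadN_gt0 x : 0 < 1 - x + x ^+ 2 / 2.
Proof. by have := quad_gt0 (- x); rewrite sqrrN. Qed.

(** For [x <= 0] the claim is [1 <= (1 + x + x ^+ 2 / 2) * (1 - x + x ^+ 2 / 2)], and the product
    equals [1 + x ^+ 4 / 4]. *)
Lemma expR_phi0_le x : expR (phi0 x) <= 1 + x + x ^+ 2 / 2.
Proof.
rewrite /phi0; case: ifPn => [x0|]; first by rewrite lnK ?posrE ?quad_gt0.
rewrite -leNgt => x0; rewrite expRN lnK ?posrE ?quadN_gt0 //.
rewrite -[_^-1]mul1r ler_pdivrMr ?quadN_gt0 //.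
rewrite [leRHS](_ : _ = 1 + (x ^+ 2) ^+ 2 / 4); last by field.
by rewrite lerDl mulr_ge0 // sqr_ge0.
Qed.

Lemma phi0N x : phi0 (- x) = - phi0 x.
Proof.
rewrite /phi0 oppr_gt0 sqrrN opprK.
case: (ltgtP x 0) => [_|_|->]; rewrite ?opprK //.
by rewrite subr0 expr0n mul0r !addr0 ln1 oppr0.
Qed.

Lemma phi0_ge0E x : 0 <= x -> phi0 x = ln (1 + x + x ^+ 2 / 2).
Proof.
rewrite /phi0 le_eqVlt => /predU1P[<-|->//].
by rewrite ltxx subr0 expr0n mul0r !addr0 ln1 oppr0.
Qed.

(** With [q x = 1 + x + x ^+ 2 / 2], the upper bound is [q y <= q (y - x) * q x <= expR (y - x) * q
    x]. *)
Lemma phi0_le_mono x y : 0 <= x -> x <= y -> 0 <= phi0 y - phi0 x <= y - x.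
Proof.
move=> x0 xy; have y0 := le_trans x0 xy.
have p0 := quad_gt0; rewrite !phi0_ge0E //.
have yx0 : 0 <= y - x by rewrite subr_ge0.
apply/andP; split.
  rewrite subr_ge0 ler_ln ?posrE //.
  by apply: lerD; [rewrite lerD2l|rewrite ler_pM2r // lerXn2r].
rewrite -ln_div ?posrE // -ler_expR lnK ?posrE ?divr_gt0 // ler_pdivrMr //.
apply: le_trans (_ : (1 + (y - x) + (y - x) ^+ 2 / 2) * (1 + x + x ^+ 2 / 2) <=
  _); last first.
  by rewrite ler_pM2r // expR_ge_quad.
rewrite -subr_ge0.
rewrite (_ : _ - _ = (y - x) * x ^+ 2 / 2 + (y - x) ^+ 2 / 2 * (x + x ^+ 2 /
  2)); last by field.
have half_ge0 z : 0 <= z ^+ 2 / 2 :> R by rewrite divr_ge0 ?sqr_ge0.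
by rewrite -mulrA addr_ge0 // mulr_ge0 ?half_ge0 // addr_ge0.
Qed.

(** Oddness reduces to nonnegative arguments, and arguments of opposite sign are compared through 0.
    The bound serves the measurability of the truncated summands. *)
Lemma phi0_lipschitz x y : `|phi0 y - phi0 x| <= `|y - x|.
Proof.
wlog xy : x y / x <= y.
  move=> H; have [/H//|/ltW/H] := leP x y.
  by rewrite distrC [leRHS]distrC.
rewrite [leRHS]ger0_norm ?subr_ge0 //.
have [x0|/ltW x0] := leP 0 x.
  by have /andP[? ?] := phi0_le_mono x0 xy; rewrite ger0_norm.
have phi00 : phi0 0 = 0 :> R by rewrite phi0_ge0E // expr0n mul0r !addr0 ln1.
have [y0|/ltW y0] := leP y 0.
  have := @phi0_le_mono (- y) (- x); rewrite oppr_ge0 lerN2 => /(_ y0 xy).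
  by rewrite !phi0N => /andP[? ?]; rewrite ger0_norm; lra.
have := @phi0_le_mono 0 (- x); rewrite oppr_ge0 => /(_ (lexx _) x0).
have := @phi0_le_mono 0 y (lexx _) y0.
rewrite phi0N phi00 !subr0 => /andP[? ?] /andP[? ?].
by rewrite ger0_norm; lra.
Qed.

End influence.

Section dilations.
Context {R : realType}.

Lemma dilation_tr d1 d2 (A : 'M[R]_(d1, d2)) : (dilation A)^T = dilation A.
Proof. by rewrite /dilation tr_block_mx !trmx0 trmxK. Qed.

Lemma dilationZ d1 d2 c (A : 'M[R]_(d1, d2)) : dilation (c *: A) = c *:
  dilation A.
Proof. by rewrite /dilation scale_block_mx !scaler0 linearZ. Qed.

Lemma dilationD d1 d2 (A B : 'M[R]_(d1, d2)) : dilation (A + B) = dilation A +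
  dilation B.
Proof. by rewrite /dilation add_block_mx !addr0 linearD. Qed.

Lemma dilationB d1 d2 (A B : 'M[R]_(d1, d2)) : dilation (A - B) = dilation A -
  dilation B.
Proof. by rewrite -scaleN1r dilationD dilationZ scaleN1r. Qed.

Lemma dilation_sum d1 d2 n (A : 'I_n -> 'M[R]_(d1, d2)) :
  dilation (\sum_i A i) = \sum_i dilation (A i).
Proof.
elim/big_ind2 : _ => [|A1 B1 A2 B2 <- <-|//]; last by rewrite dilationD.
by rewrite -[in LHS](scale0r 0) dilationZ scale0r.
Qed.

(* Conjugating by [diag (1, -1)] negates a dilation, hence also its image under
   an odd function: the image is again a dilation. *)
Lemma mxfun_dilation (f : R -> R) d1 d2 (A : 'M[R]_(d1, d2)) :
  (forall x, f (- x) = - f x) ->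
  mxfun f (dilation A) = dilation (ursubmx (mxfun f (dilation A))).
Proof.
move=> fN; set N := mxfun f _.
pose J : 'M[R]_(d1 + d2) := block_mx 1%:M 0 0 (- 1%:M).
have oJ : orthogonal_mx J.
  rewrite /orthogonal_mx tr_block_mx !trmx0 trmx1 raddfN /= trmx1 mulmx_block.
  rewrite !mulmx0 !mul0mx !addr0 add0r mulmx1 mulNmx mulmxN opprK mulmx1.
  by rewrite -scalar_mx_block.
have JMJ (M : 'M[R]_(d1 + d2)) : J *m M *m J^T =
    block_mx (ulsubmx M) (- ursubmx M) (- dlsubmx M) (drsubmx M).
  rewrite -{1}[M]submxK tr_block_mx !trmx0 trmx1 raddfN /= trmx1 !mulmx_block.
  by rewrite !mulmx0 !mul0mx !addr0 !add0r !mulmxN !mulNmx opprK !mulmx1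
    !mul1mx.
have [U [l [oU dE]]] := spectral_spec (dilation_tr A).
have NE : N = spec U (map_mx f l) by rewrite /N dE mxfun_spec.
have JN : J *m N *m J^T = - N.
  have -> : J *m N *m J^T = spec (J *m U) (map_mx f l).
    by rewrite NE /spec trmx_mul !mulmxA.
  rewrite -mxfun_spec; last exact: orthogonal_mxM.
  have -> : spec (J *m U) l = spec U (- l).
    have -> : spec U (- l) = - dilation A by rewrite dE /spec linearN /= mulmxN
      mulNmx.
    have -> : spec (J *m U) l = J *m dilation A *m J^T.
      by rewrite dE /spec trmx_mul !mulmxA.
    rewrite JMJ /dilation block_mxKul block_mxKur block_mxKdl block_mxKdr.
    by rewrite opp_block_mx !oppr0.
  rewrite mxfun_spec // NE /spec; rewrite -mulNmx -mulmxN -linearN.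
  by congr (_ *m diag_mx _ *m _); apply/rowP => i; rewrite !mxE fN.
have Nt : N^T = N by exact: mxfun_tr.
have z (p q : nat) (M : 'M[R]_(p, q)) : M = - M -> M = 0.
  move=> /matrixP MN; apply/matrixP => i j.
  by have := MN i j; rewrite !mxE; lra.
move: JN; rewrite JMJ -{5}[N]submxK opp_block_mx => /eq_block_mx[ul _ _ dr].
rewrite /dilation trmx_ursub Nt -[LHS]submxK.
by rewrite (z _ _ _ ul) (z _ _ _ dr).
Qed.

Lemma spec_form n (U : 'M[R]_n) l (x : 'rV[R]_n) :
  (x *m spec U l *m x^T) 0 0 = \sum_k l 0 k * (x *m U) 0 k ^+ 2.
Proof.
have -> : x *m spec U l *m x^T = (x *m U) *m diag_mx l *m (x *m U)^T.
  by rewrite trmx_mul !mulmxA.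
rewrite mul_mx_diag mxE; apply: eq_bigr => k _.
by rewrite mxE [(x *m U)^T _ _]mxE expr2 mulrAC mulrC mulrA.
Qed.

(** Operator norm bounds are carried as [sqnorm (x *m M) <= c ^+ 2 * sqnorm x], for rows acting from
    the left, and meet the supremum in [opnorm] only at the end. *)
Definition sqnorm n (x : 'rV[R]_n) : R := (x *m x^T) 0 0.

Lemma sqnorm_ge0 n (x : 'rV[R]_n) : 0 <= sqnorm x.
Proof. by rewrite /sqnorm mulmx_tr_sqr sumr_ge0 // => i _; exact: sqr_ge0. Qed.

Lemma sqnorm_orthogonal n (x : 'rV[R]_n) (U : 'M[R]_n) : orthogonal_mx U ->
  sqnorm (x *m U) = sqnorm x.
Proof.
by move=> /orthogonal_mxV oU;
  rewrite /sqnorm trmx_mul mulmxA -(mulmxA x) oU mulmx1.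
Qed.

(** Every term of the trace is positive, so each eigenvalue of [a *: dilation N] is at most [c]. The
    quadratic form at the row [(g x, x N)], with [g = c / a], then reads
    [2 |x N|^2 <= g^2 |x|^2 + |x N|^2]. This weight [g] balances the two blocks. *)
Lemma dilation_mexp_bound d1 d2 (N : 'M[R]_(d1, d2)) (a c : R) (x : 'rV[R]_d1) :
  0 < a -> 0 < c -> \tr (mexp (a *: dilation N)) <= expR c ->
  sqnorm (x *m N) <= (c / a) ^+ 2 * sqnorm x.
Proof.
move=> a0 c0.
have [|U [l [oU dE]]] := @spectral_spec _ _ (a *: dilation N).
  by rewrite linearZ /= dilation_tr.
rewrite {1}dE mexp_spec // mxtrace_spec // => trc.
have lc k : l 0 k <= c.
  rewrite -ler_expR; apply: le_trans trc; rewrite (bigD1 k) //= mxE lerDl.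
  by rewrite sumr_ge0 // => i _; rewrite mxE expR_ge0.
have [g gE] : exists g, g = c / a by exists (c / a).
set y := x *m N; rewrite -gE; have g0 : 0 < g by rewrite gE divr_gt0.
pose z : 'rV[R]_(d1 + d2) := row_mx (g *: x) y.
have zz : sqnorm z = g ^+ 2 * sqnorm x + sqnorm y.
  rewrite /sqnorm /z tr_row_mx mul_row_col linearZ /= -scalemxAl -scalemxAr.
  by rewrite scalerA -expr2 [LHS]mxE; congr (_ + _); rewrite [LHS]mxE.
have zdz : (z *m dilation N *m z^T) 0 0 = 2 * g * sqnorm y.
  rewrite /z /dilation mul_row_block !mulmx0 add0r addr0 tr_row_mx mul_row_col.
  rewrite linearZ /= -scalemxAl -/y -scalemxAr.
  have -> : y *m N^T *m x^T = (y *m y^T) by rewrite -mulmxA -trmx_mul.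
  by rewrite -scalemxAl /sqnorm !mxE; ring.
have : (z *m (a *: dilation N) *m z^T) 0 0 <= c * sqnorm z.
  rewrite dE spec_form -(sqnorm_orthogonal z oU) /sqnorm mulmx_tr_sqr mulr_sumr.
  by apply: ler_sum => k _; rewrite ler_wpM2r ?sqr_ge0.
rewrite -scalemxAr -scalemxAl [leLHS]mxE zdz zz.
have -> : c = g * a by rewrite gE mulfVK // gt_eqF.
rewrite [leLHS](_ : _ = g * a * (2 * sqnorm y)); last by ring.
by rewrite ler_pM2l ?mulr_gt0 //; lra.
Qed.

(** For an eigenvector [v] of [M^T *m M] with eigenvalue [l > 0], the test row [v *m M^T] gives
    [l <= c ^+ 2]. An empty spectrum has supremum 0. *)
Lemma opnorm_le d1 d2 (M : 'M[R]_(d1, d2)) (c : R) : 0 <= c ->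
  (forall x : 'rV[R]_d1, sqnorm (x *m M) <= c ^+ 2 * sqnorm x) -> opnorm M <= c.
Proof.
move=> c0 Mc.
have ub : ubound (singular_values M) c.
  move=> _ [l /eigenvalueP[v vM v0] <-].
  have [l0|l0] := leP l 0; first by rewrite ler0_sqrtr.
  have vv : sqnorm (v *m M^T) = l * sqnorm v.
    by rewrite /sqnorm trmx_mul trmxK mulmxA -(mulmxA v) vM -scalemxAl mxE.
  have := Mc (v *m M^T); rewrite vv -mulmxA vM /sqnorm.
  rewrite linearZ /= -scalemxAr -scalemxAl scalerA [leLHS]mxE mulrA.
  rewrite ler_pM2r ?mulmx_tr_gt0 // ler_pM2r // => lc.
  by rewrite -(ger0_norm c0) -sqrtr_sqr ler_wsqrtr.
have [/eqP s0|/set0P s0] := boolP (singular_values M == set0).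
  by rewrite /opnorm s0 sup0.
exact: ge_sup.
Qed.

Lemma eigenvalue_spec n (U : 'M[R]_n) (l : 'rV[R]_n) a : orthogonal_mx U ->
  eigenvalue (spec U l) a <-> exists k, a = l 0 k.
Proof.
move=> oU; split=> [/eigenvalueP[v vU v0]|[k ->]].
  have [/existsP[k yk]|] := boolP [exists k, (v *m U) 0 k != 0].
    exists k.
    have : (v *m U *m diag_mx l) = a *: (v *m U).
      by rewrite scalemxAl -vU /spec !mulmxA -[RHS]mulmxA oU mulmx1.
    move=> /rowP/(_ k); rewrite mul_mx_diag mxE [RHS]mxE mulrC.
    by move=> /(mulIf yk).
  rewrite negb_exists => /forallP y0; move: v0.
  rewrite -(mulmx1 v) -(orthogonal_mxV oU) mulmxA (_ : v *m U = 0) ?mul0mx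
    ?eqxx //.
  by apply/rowP => k; have := y0 k; rewrite negbK mxE => /eqP ->; rewrite mxE.
apply/eigenvalueP; exists (row k U^T).
  rewrite -row_mul /spec !mulmxA oU mul1mx row_mul row_diag_mx -scalemxAl.
  by rewrite -rowE.
apply: contraTneq isT => rU.
have := oU => /(congr1 (row k)); rewrite row_mul rU mul0mx => /rowP/(_ k).
by rewrite !mxE eqxx => /eqP; rewrite eq_sym oner_eq0.
Qed.

Lemma le_sum_ge0 n (F : 'I_n -> R) k : F k <= \sum_i `|F i|.
Proof.
rewrite (bigD1 k) //= ler_wpDr ?ler_norm //; exact: sumr_ge0.
Qed.

Lemma lambda_max_ge n (U : 'M[R]_n) (l : 'rV[R]_n) k : orthogonal_mx U ->
  l 0 k <= lambda_max (spec U l).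
Proof.
move=> oU; apply: ub_le_sup; last by apply/eigenvalue_spec => //; exists k.
exists (\sum_i `|l 0 i|) => a /(eigenvalue_spec _ _ oU)[i ->].
exact: le_sum_ge0.
Qed.

(** The square of the entry is at most the diagonal entry [(M^T *m M) j j], an average of
    eigenvalues that are at most 1. Bounded entries give the actions finite second moments. *)
Lemma opnorm1_entry d1 d2 (M : 'M[R]_(d1, d2)) i j :
  opnorm M <= 1 -> `|M i j| <= 1.
Proof.
move=> M1; have [|U [l [oU dE]]] := @spectral_spec _ _ (M^T *m M).
  by rewrite trmx_mul trmxK.
have lE k : eigenvalue (M^T *m M) (l 0 k) by rewrite dE;
  apply/eigenvalue_spec => //; exists k.
have l_ge0 k : 0 <= l 0 k.
  have /eigenvalueP[v vM v0] := lE k.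
  have := sqnorm_ge0 (v *m M^T).
  rewrite /sqnorm trmx_mul trmxK mulmxA -(mulmxA v) vM -scalemxAl mxE.
  by rewrite pmulr_lge0 // mulmx_tr_gt0.
have l_le1 k : l 0 k <= 1.
  rewrite -ler_sqrt // sqrtr1; apply: le_trans M1; apply: ub_le_sup.
    exists (\sum_i `|Num.sqrt (l 0 i)|) => _ [a + <-].
    rewrite /= dE => /(eigenvalue_spec _ _ oU)[m ->].
    exact: (le_sum_ge0 (fun m => Num.sqrt (l 0 m))).
  by exists (l 0 k) => //; exact: lE.
have : M i j ^+ 2 <= 1.
  apply: le_trans (_ : (M^T *m M) j j <= 1).
    rewrite mxE (bigD1 i) //= mxE -expr2 lerDl sumr_ge0 // => k _.
    by rewrite mxE -expr2 sqr_ge0.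
  rewrite dE specE; apply: le_trans (_ : \sum_k U j k ^+ 2 <= 1).
    by apply: ler_sum => k _; rewrite mulrAC -expr2 ler_piMr ?sqr_ge0.
  by rewrite orthogonal_row_sqr.
by rewrite -[X in _ <= X -> _](expr1n _ 2) -(real_normK (num_real (M i j)))
  ler_pXn2r ?nnegrE.
Qed.

Definition rect_diag d1 d2 (S : 'M[R]_(d1, d2)) :=
  forall (i : 'I_d1) (j : 'I_d2), (i != j :> nat) -> S i j = 0.

Lemma sqnorm_mul_diag d1 d2 (S : 'M[R]_(d1, d2)) (y : 'rV[R]_d1) :
  rect_diag S -> sqnorm (y *m S) = \sum_i y 0 i ^+ 2 * \sum_j S i j ^+ 2.
Proof.
move=> Sd; rewrite /sqnorm trmx_mul mulmxA -(mulmxA y).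
have -> : S *m S^T = diag_mx (\row_i \sum_j S i j ^+ 2).
  apply/matrixP => i i'; rewrite !mxE.
  have [<-|ii'] := eqVneq i i'.
    by rewrite mulr1n; apply: eq_bigr => j _; rewrite mxE expr2.
  rewrite mulr0n big1 // => j _; rewrite mxE.
  have [ij|/Sd->] := eqVneq (i : nat) j; last by rewrite mul0r.
  rewrite [S i' j]Sd ?mulr0 //; apply: contra ii' => /eqP i'j.
  by apply/eqP/val_inj; rewrite /= ij i'j.
rewrite mul_mx_diag mxE; apply: eq_bigr => i _.
by rewrite !mxE expr2 mulrAC.
Qed.

Lemma sqnormD_le n (x y : 'rV[R]_n) :
  sqnorm (x + y) <= 2 * (sqnorm x + sqnorm y).
Proof.
rewrite /sqnorm !mulmx_tr_sqr -big_split mulr_sumr /=; apply: ler_sum => i _.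
rewrite mxE -subr_ge0 (_ : _ - _ = (x 0 i - y 0 i) ^+ 2) ?sqr_ge0 //; ring.
Qed.

(** If the rank grew, some nonzero [x] would be spanned by left singular vectors with singular
    values above [tau] and be killed by [N]; then [x (M - N) = x M] is longer than [tau |x|]. For
    the error, both [M' - M] and [M - N] have norm at most [tau]. *)
Lemma hard_threshold_svd d1 d2 (M N : 'M[R]_(d1, d2)) U S V (tau : R) :
  0 <= tau -> is_svd M U S V ->
  (forall x : 'rV[R]_d1, sqnorm (x *m (M - N)) <= tau ^+ 2 * sqnorm x) ->
  let M' := U *m hard_threshold tau S *m V^T in
  (\rank M' <= \rank N)%N /\ opnorm (M' - N) <= 2 * tau.
Proof.
move=> tau0 [oU oV Sd ME] MN /=; set H := hard_threshold tau S.
have S0 i j : 0 <= S i j by have [] := Sd i j.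
have Sdiag : rect_diag S by move=> i j ij; have [_ ->] := Sd i j.
have Hdiag : rect_diag H by move=> i j ij; rewrite mxE Sdiag // if_same.
have oVT := orthogonal_mx_tr oV.
split.
  rewrite leqNgt; apply/negP => rk; set M' := U *m H *m V^T in rk.
  (* The ranks [\rank M'] and [d1 - \rank N] add up to more than [d1]. *)
  have cap0 : (M'^T :&: kermx N)%MS != 0.
    rewrite -mxrank_eq0 -lt0n.
    have := mxrank_sum_cap M'^T (kermx N); rewrite mxrank_tr mxrank_ker.
    have := rank_leq_col (M'^T + kermx N)%MS; have := rank_leq_row N.
    lia.
  have [x xcap x0] : exists2 x : 'rV_d1, (x <= M'^T :&: kermx N)%MS & x != 0.
    exists (nz_row (M'^T :&: kermx N)%MS); first exact: nz_row_sub.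
    by rewrite nz_row_eq0.
  move: xcap; rewrite sub_capmx => /andP[/submxP[z xE] /sub_kermxP xN].
  pose y := z *m V *m H^T.
  have xy : x = y *m U^T.
    by rewrite xE /M' !trmx_mul trmxK !mulmxA.
  have xM : x *m (M - N) = y *m S *m V^T.
    by rewrite mulmxBr xN subr0 ME xy !mulmxA -[y *m U^T *m U]mulmxA oU mulmx1.
  have := MN x; rewrite xM sqnorm_orthogonal // xy sqnorm_orthogonal;
    last exact: orthogonal_mx_tr.
  rewrite sqnorm_mul_diag // /sqnorm mulmx_tr_sqr mulr_sumr -subr_ge0 -sumrB.
  (* A nonzero coordinate needs a surviving entry in row [i] of [H]. Entries equal to [tau] are
     removed, which makes the inequality strict. *)
  have yS i : y 0 i != 0 -> tau ^+ 2 < \sum_j S i j ^+ 2.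
    move=> yi.
    have /existsP[j Hij] : [exists j, H i j != 0].
      apply: contraR yi; rewrite negb_exists => /forallP H0.
      rewrite mxE big1 ?eqxx // => j _; rewrite [H^T _ _]mxE.
      by have := H0 j; rewrite negbK => /eqP ->; rewrite mulr0.
    rewrite (bigD1 j) //= ltr_wpDr ?sumr_ge0 // => [k _|]; first exact: sqr_ge0.
    rewrite ltr_pXn2r ?nnegrE //; move: Hij; rewrite mxE.
    by case: ifPn; rewrite ?eqxx // -ltNge => ? _.
  apply/negP; rewrite -ltNge.
  have [/existsP[i yi]|] := boolP [exists i, y 0 i != 0]; last first.
    rewrite negb_exists => /forallP y0; move: x0; rewrite xy.
    rewrite (_ : y = 0) ?mul0mx ?eqxx //; apply/rowP => i.
    by have := y0 i; rewrite negbK => /eqP ->; rewrite mxE.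
  rewrite -oppr_gt0 -sumrN (bigD1 i) //= ltr_wpDr //.
    apply: sumr_ge0 => k _; rewrite opprB subr_ge0 [leLHS]mulrC.
    have [->|/yS/ltW] := eqVneq (y 0 k) 0; first by rewrite expr0n !mul0r.
    exact/ler_wpM2l/sqr_ge0.
  rewrite opprB subr_gt0 [ltLHS]mulrC ltr_pM2l ?yS //.
  by rewrite lt_def sqr_ge0 sqrf_eq0 yi.
apply: opnorm_le => [|x]; first by rewrite mulr_ge0.
have -> : x *m (U *m H *m V^T - N) = x *m U *m (H - S) *m V^T + x *m (M - N).
  by rewrite ME !mulmxBr !mulmxBl !mulmxA addrA subrK.
apply: le_trans (sqnormD_le _ _) _.
rewrite exprMn -(mulrA (2 ^+ 2)) expr2 -mulrA ler_pM2l // mulr_natl mulr2n.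
rewrite lerD // sqnorm_orthogonal // -(sqnorm_orthogonal x oU).
rewrite sqnorm_mul_diag => [|i j ij];
  last by rewrite !mxE Sdiag // if_same subrr.
rewrite /sqnorm mulmx_tr_sqr mulr_sumr; apply: ler_sum => i _.
rewrite [leRHS]mulrC ler_wpM2l ?sqr_ge0 //.
have HS j : (H - S) i j ^+ 2 <= tau ^+ 2.
  rewrite !mxE -real_normK ?num_real // ler_pXn2r ?nnegrE //; case: ifPn => Sij.
    by rewrite sub0r normrN ger0_norm.
  by rewrite subrr normr0.
have [/existsP[j /eqP ij]|] := boolP [exists j : 'I_d2, (i : nat) == j].
  rewrite (bigD1 j) //= big1 ?addr0 // => k kj.
  rewrite !mxE Sdiag ?if_same ?subrr ?expr0n //; apply: contra kj => /eqP ik.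
  by apply/eqP/val_inj; rewrite /= -ij ik.
rewrite negb_exists => /forallP ij; rewrite big1 ?sqr_ge0 // => j _.
by rewrite !mxE Sdiag ?if_same ?subrr ?expr0n.
Qed.

End dilations.

(** * Measurability of matrix functions *)

Section matrix_measurability.
Context {R : realType}.

Definition rat_box m n (q : 'M[rat * rat]_(m, n)) : set 'M[R]_(m, n) :=
  [set M | forall i j, ratr (q i j).1 < M i j < ratr (q i j).2].

(** The boxes are indexed by a countable type and each is a finite intersection of conditions on
    single entries, so Borel measurability of a matrix-valued map can be checked entrywise. *)
Lemma open_bigcup_rat_box m n (O : set 'M[R]_(m, n)) : open O ->
  O = \bigcup_(q in [set q | rat_box q `<=` O]) rat_box q.
Proof.
move=> oO; apply/seteqP; split=> [M OM|M [q /= qO qM]]; last exact: qO.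
have [e /= e0 eO] : exists2 e : R, 0 < e & ball M e `<=` O.
  by apply/nbhs_ballP; exact: open_nbhs_nbhs.
have h1 (x : R) : exists q : rat * rat, [/\ x - e < ratr q.1, ratr q.1 < x,
   x < ratr q.2 & ratr q.2 < x + e].
  have [|p] := @rat_in_itvoo R (x - e) x; first by rewrite ltrBlDr ltrDl.
  move=> /itvP pP.
  have [|p'] := @rat_in_itvoo R x (x + e); first by rewrite ltrDl.
  move=> /itvP p'P; exists (p, p'); split=> /=; by rewrite ?pP ?p'P.
have /choice[f fP] := h1.
exists (\matrix_(i, j) f (M i j)) => /=.
  move=> N NM; apply: eO; split => // i j.
  have := NM i j; rewrite mxE; have [a1 a2 a3 a4] := fP (M i j).
  move=> /andP[b1 b2]; rewrite /ball /= ltr_norml; apply/andP; split; lra.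
by move=> i j; rewrite mxE; have [_ -> -> _] := fP (M i j).
Qed.

Context d (T : measurableType d).

Lemma measurable_fun_mx m n (f : T -> borel_mx R m n) :
  (forall i j, measurable_fun [set: T] (fun w => f w i j)) ->
  measurable_fun [set: T] f.
Proof.
move=> mf; apply: (@measurability _ _ T (borel_mx R m n) setT f (@open
  'M[R]_(m, n)) erefl).
move=> _ [V oV <-]; rewrite setTI (open_bigcup_rat_box oV) preimage_bigcup.
rewrite bigcup_mkcond; apply: countable_bigcupT_measurable => [|q].
  exact: countableP.
case: ifP => // _.
rewrite (_ : _ @^-1` _ = \bigcap_(ij in [set: 'I_m * 'I_n])
    ((fun w => f w ij.1 ij.2) @^-1` `]ratr (q ij.1 ij.2).1, ratr (q ij.1
      ij.2).2[)).
  apply: fin_bigcap_measurable => // -[i j] _.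
  rewrite -[X in measurable X]setTI; exact: mf.
apply/seteqP; split=> [w /= wq [i j] _ /=|w /= wq i j].
  by rewrite in_itv /=; exact: wq.
by have := wq (i, j) I; rewrite /= in_itv.
Qed.

Lemma measurable_continuous_mx m n (g : 'M[R]_(m, n) -> R) (f : T ->
  borel_mx R m n) :
  continuous g -> measurable_fun [set: T] f -> measurable_fun [set: T] (g \o f).
Proof.
move=> /continuousP cg mf.
apply: (measurability _ (measurable_realfun.RGenOpens.measurableE R)).
move=> _ [_ [a [b ->] <-]];
  rewrite setTI comp_preimage -[X in measurable X]setTI.
by apply: mf => //; apply: sub_sigma_algebra; exact/cg/interval_open.
Qed.

Lemma measurable_mx_entry m n (f : T -> borel_mx R m n) i j :
  measurable_fun [set: T] f -> measurable_fun [set: T] (fun w => f w i j).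
Proof. exact: (measurable_continuous_mx (@coord_continuous R m n i j)). Qed.

End matrix_measurability.

Section matrix_function_continuity.
Context {R : realType}.

(** The square of the Frobenius norm. *)
Definition frob m n (M : 'M[R]_(m, n)) : R := \sum_i \sum_j M i j ^+ 2.

Lemma frob_entry m n (M : 'M[R]_(m, n)) i j : `|M i j| <= Num.sqrt (frob M).
Proof.
rewrite -sqrtr_sqr ler_wsqrtr // /frob (bigD1 i) //= (bigD1 j) //= -addrA lerDl.
rewrite addr_ge0 ?sumr_ge0 // => [k _|k _]; first exact: sqr_ge0.
by apply: sumr_ge0 => l _; exact: sqr_ge0.
Qed.

Lemma frobE n (M : 'M[R]_n) : frob M = \tr (M *m M^T).
Proof.
by apply: eq_bigr => i _; rewrite mxE; apply: eq_bigr => j _; rewrite mxE expr2.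
Qed.

Lemma frob_conj n (M U V : 'M[R]_n) : orthogonal_mx U -> orthogonal_mx V ->
  frob (U^T *m M *m V) = frob M.
Proof.
move=> oU oV; rewrite !frobE !trmx_mul trmxK !mulmxA -[_ *m V *m V^T]mulmxA.
rewrite (orthogonal_mxV oV) mulmx1 mxtrace_mulC !mulmxA (orthogonal_mxV oU).
by rewrite mul1mx.
Qed.

Lemma frob_spec n (U : 'M[R]_n) (l : 'rV[R]_n) : orthogonal_mx U ->
  frob (spec U l) = \sum_i l 0 i ^+ 2.
Proof.
move=> oU; rewrite frobE spec_tr spec_sqr // mxtrace_spec //.
by apply: eq_bigr => i _; rewrite mxE.
Qed.

(** The constant may depend on the interval, as it must for [expR]. *)
Definition bounded_lipschitz (f : R -> R) := forall K, exists L, 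
  forall x y, `|x| <= K -> `|y| <= K -> `|f x - f y| <= L * `|x - y|.

(* In the eigenbases of A and B, [f A - f B] has the entries
   [(f a_i - f b_j) <u_i, v_j>]. *)
Lemma frob_mxfun_lipschitz f n (A B : 'M[R]_n) K L :
  (forall x y, `|x| <= K -> `|y| <= K -> `|f x - f y| <= L * `|x - y|) ->
  A^T = A -> B^T = B -> Num.sqrt (frob A) <= K -> Num.sqrt (frob B) <= K ->
  frob (mxfun f A - mxfun f B) <= L ^+ 2 * frob (A - B).
Proof.
move=> fL As Bs AK BK.
have [U [a [oU AE]]] := spectral_spec As.
have [V [b [oV BE]]] := spectral_spec Bs.
have bnd (l : 'rV[R]_n) W i : orthogonal_mx W ->
  Num.sqrt (frob (spec W l)) <= K ->
    `|l 0 i| <= K.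
  move=> oW; apply: le_trans; rewrite frob_spec // -sqrtr_sqr ler_wsqrtr //.
  by rewrite (bigD1 i) //= lerDl sumr_ge0 // => k _; exact: sqr_ge0.
rewrite AE BE !mxfun_spec //
  -(frob_conj _ oU oV) -[in leRHS](frob_conj _ oU oV).
rewrite mulr_sumr; apply: ler_sum => i _; rewrite mulr_sumr;
  apply: ler_sum => j _.
rewrite !spec_conj // !exprMn [leRHS]mulrA ler_wpM2r ?sqr_ge0 // -exprMn.
rewrite -[leLHS]real_normK ?num_real // -[leRHS]real_normK ?num_real //.
rewrite lerXn2r ?nnegrE // normrM.
apply: (@le_trans _ _ (L * `|a 0 i - b 0 j|)); last first.
  by rewrite ler_wpM2r // ler_norm.
rewrite [map_mx _ _ _ _]mxE [map_mx _ b _ _]mxE.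
by apply: fL; [apply: bnd oU _; rewrite -AE|apply: bnd oV _; rewrite -BE].
Qed.

(** [mxfun f] is 0 off the symmetric matrices, a jump in general. Composition with this projection
    gives a continuous function on all matrices that agrees with it on the symmetric ones. *)
Definition symm n (M : 'M[R]_n) := 2^-1 *: (M + M^T).

Lemma symm_tr n (M : 'M[R]_n) : (symm M)^T = symm M.
Proof. by rewrite /symm linearZ /= linearD /= trmxK addrC. Qed.

Lemma symm_id n (M : 'M[R]_n) : M^T = M -> symm M = M.
Proof.
by rewrite /symm => ->; rewrite -mulr2n -(scaler_nat 2 M) scalerA mulVf
  ?scale1r // pnatr_eq0.
Qed.

Lemma continuous_sumf n (g : 'I_n -> 'M[R]_n -> R) :
  (forall i, continuous (g i)) -> continuous (fun M => \sum_i g i M).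
Proof.
move=> gc M; rewrite (_ : (fun M => _) = \sum_i g i); last first.
  by apply/funext => N; rewrite fct_sumE.
elim/big_ind : _ => [|f h fc hc|i _]; last exact: gc.
  exact: (@cst_continuous _ _ (0 : R)).
exact: (continuousD fc hc).
Qed.

Lemma continuous_frob_symm n (M : 'M[R]_n) :
  continuous (fun N : 'M[R]_n => frob (symm N - M)).
Proof.
apply: continuous_sumf => i; apply: continuous_sumf => j N.
rewrite (_ : (fun N : 'M[R]_n => _) =
    (fun N => (2^-1 * (N i j + N j i) - M i j) ^+ 2)); last first.
  by apply/funext => N'; rewrite !mxE.
have c1 : {for N, continuous (fun N : 'M[R]_n =>
  2^-1 * (N i j + N j i) - M i j)}.
  apply: continuousB; last exact: cst_continuous.
  apply: continuousM; first exact: cst_continuous.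
  by apply: continuousD; exact: coord_continuous.
exact: (continuousM c1 c1).
Qed.

Lemma continuous_mxfun f n i j : bounded_lipschitz f ->
  continuous (fun M : 'M[R]_n => mxfun f (symm M) i j).
Proof.
move=> fL M.
pose K := Num.sqrt (frob (symm M) + 1).
have MK : Num.sqrt (frob (symm M)) <= K by rewrite ler_wsqrtr // lerDl.
have [L fLK] := fL K.
have near1 : \forall N \near M, Num.sqrt (frob (symm N)) <= K.
  have /cvgr_lt := @continuous_frob_symm n 0 M.
  rewrite subr0 => /(_ (frob (symm M) + 1)); rewrite ltrDl => /(_ ltr01).
  by apply: filterS => N; rewrite subr0 => /ltW; exact: ler_wsqrtr.
pose g (N : 'M[R]_n) : R := `|L| * Num.sqrt (frob (symm N - symm M)).
have gM : g M = 0.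
  rewrite /g subrr [frob _]big1 ?sqrtr0 ?mulr0 // => k _.
  by rewrite big1 // => l _; rewrite mxE expr0n.
have g0 : {for M, continuous g}.
  apply: continuousM; first exact: cst_continuous.
  apply: (@continuous_comp _ _ _ (fun N =>
    frob (symm N - symm M)) (@Num.sqrt R)).
    exact: continuous_frob_symm.
  exact: sqrt_continuous.
rewrite /continuous_at /prop_for gM in g0.
apply/(@cvgrPdist_lt _ _ _ (nbhs M) (nbhs_filter M)) => e e0; near=> N.
have NK : Num.sqrt (frob (symm N)) <= K by near: N.
have gN : `|0 - g N| < e by near: N;
  move/(@cvgrPdist_lt _ _ _ (nbhs M) (nbhs_filter M)) : g0; exact.
apply: le_lt_trans gN; rewrite sub0r normrN [leRHS]ger0_norm; last first.
  by rewrite /g mulr_ge0 // sqrtr_ge0.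
rewrite distrC.
have -> : mxfun f (symm N) i j - mxfun f (symm M) i j =
   (mxfun f (symm N) - mxfun f (symm M)) i j by rewrite !mxE.
apply: le_trans (frob_entry _ _ _) _.
rewrite /g -sqrtr_sqr -sqrtrM ?sqr_ge0 // ler_wsqrtr //.
exact: frob_mxfun_lipschitz (symm_tr _) (symm_tr _) NK MK.
Unshelve. all: by end_near. Qed.

End matrix_function_continuity.

Section measurable_mxfun.
Context {R : realType}.

Lemma phi0_bounded_lipschitz : bounded_lipschitz (@phi0 R).
Proof. by move=> K; exists 1 => x y _ _; rewrite mul1r;
  exact: phi0_lipschitz. Qed.

Lemma expR_bounded_lipschitz : bounded_lipschitz (@expR R).
Proof.
move=> K; exists (expR K) => x y.
wlog yx : x y / y <= x.
  move=> H; have [/H//|/ltW xy xK yK] := leP y x.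
  by rewrite distrC [`|x - y|]distrC; exact: H.
move=> xK _; rewrite !ger0_norm ?subr_ge0 ?ler_expR //.
have -> : expR x - expR y = expR x * (1 - expR (y - x)).
  by rewrite mulrBr mulr1 -expRD [x + _]addrC subrK.
apply: ler_pM; rewrite ?expR_ge0 ?subr_ge0 //.
- by rewrite -expR0 ler_expR subr_le0.
- by rewrite ler_expR (le_trans (ler_norm _)).
- by have := expR_ge1Dx (y - x); lra.
Qed.

Context d (T : measurableType d).

Lemma measurable_mxfun f n (S : T -> borel_mx R n n) : bounded_lipschitz f ->
  (forall w, (S w)^T = S w :> 'M[R]_n) -> measurable_fun [set: T] S ->
  measurable_fun [set: T] ((fun w => mxfun f (S w)) : T -> borel_mx R n n).
Proof.
move=> fL Ss mS; apply: measurable_fun_mx => i j.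
rewrite (_ : (fun w => _) = (fun M : 'M[R]_n => mxfun f (symm M) i j) \o S).
  exact: measurable_continuous_mx (continuous_mxfun fL) mS.
by apply/funext => w /=; rewrite symm_id.
Qed.

Lemma measurable_mxtrace n (S : T -> borel_mx R n n) :
  measurable_fun [set: T] S -> measurable_fun [set: T] (fun w => \tr (S w)).
Proof.
by move=> mS; apply: measurable_sum => i; exact: measurable_mx_entry.
Qed.

End measurable_mxfun.

(** * Independence *)

Section independence.
Context {R : realType} (d : measure_display) (T : measurableType d).
Variable P : probability T R.

Lemma preimage_measurable d' (E : measurableType d') (f : T -> E) B :
  measurable_fun [set: T] f -> measurable B -> measurable (f @^-1` B).
Proof. by move=> mf mB; rewrite -[X in measurable X]setTI; exact: mf. Qed.

Section freeze.
Context (e1 e2 : measure_display) (E1 : measurableType e1) (E2 : measurableType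
  e2).

(** Independence says that the joint law is the product law, so Tonelli's theorem lets [U w] be
    frozen in the inner integral. *)
Lemma integral_independent2 (U : T -> E1) (V : T -> E2) (f : E1 * E2 ->
  \bar R) :
  measurable_fun [set: T] U -> measurable_fun [set: T] V ->
    independent2 P U V ->
  measurable_fun setT f -> (forall z, 0 <= f z)%E ->
  (\int[P]_w f (U w, V w) = \int[P]_w \int[P]_w' f (U w, V w'))%E.
Proof.
move=> mU mV UV mf f0.
pose U' : {mfun T >-> E1} := HB.pack U (isMeasurableFun.Build _ _ _ _ _ mU).
pose V' : {mfun T >-> E2} := HB.pack V (isMeasurableFun.Build _ _ _ _ _ mV).
pose W w := (U w, V w).
have mW : measurable_fun [set: T] W by exact: measurable_fun_pair.
pose W' : {mfun T >-> (E1 * E2)%type} :=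
  HB.pack W (isMeasurableFun.Build _ _ _ _ _ mW).
have WE X : measurable X ->
    (distribution P U' \x distribution P V')%E X = distribution P W' X.
  apply: product_measure_unique => A B mA mB.
  by rewrite -UV.
transitivity (\int[distribution P W']_z f z)%E.
  by rewrite ge0_integral_distribution.
transitivity (\int[distribution P U' \x distribution P V']_z f z)%E.
  by apply: eq_measure_integral => A mA _; apply/esym; exact: WE.
rewrite fubini_tonelli1 // ge0_integral_distribution //; last 2 first.
- exact: measurable_fun_fubini_tonelli_F.
- by move=> x; exact: integral_ge0.
apply: eq_integral => w _ /=; rewrite /fubini_F ge0_integral_distribution //.
exact: measurableT_comp.
Qed.

Lemma le_integral_independent2 (U : T -> E1) (V : T -> E2)
    (f : E1 * E2 -> \bar R) (g : E1 -> \bar R) :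
  measurable_fun [set: T] U -> measurable_fun [set: T] V ->
    independent2 P U V ->
  measurable_fun setT f -> (forall z, 0 <= f z)%E ->
  measurable_fun setT g -> (forall z, 0 <= g z)%E ->
  {ae P, forall w, \int[P]_w' f (U w, V w') <= g (U w)}%E ->
  (\int[P]_w f (U w, V w) <= \int[P]_w g (U w))%E.
Proof.
move=> mU mV UV mf f0 mg g0 fg; rewrite integral_independent2 //.
apply: ae_ge0_le_integral => //.
- by move=> w _; exact: integral_ge0.
- pose V' : {mfun T >-> E2} := HB.pack V (isMeasurableFun.Build _ _ _ _ _ mV).
  rewrite (_ : (fun w => _) = fubini_F (distribution P V') f \o U).
    apply: measurableT_comp => //; exact: measurable_fun_fubini_tonelli_F.
  apply/funext => w; rewrite /= /fubini_F ge0_integral_distribution //.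
  exact: measurableT_comp.
- exact: measurableT_comp.
- by apply: filterS fg => w.
Qed.

End freeze.

Section tuples.
Context (e : measure_display) (E : measurableType e).

Definition tuple_box n (B : 'I_n -> set E) : set (n.-tuple E) :=
  \bigcap_(i in [set: 'I_n]) ((fun t => tnth t i) @^-1` B i).

Lemma measurable_tuple_box n (B : 'I_n -> set E) :
  (forall i, measurable (B i)) -> measurable (tuple_box B).
Proof.
move=> mB; apply: fin_bigcap_measurable => // i _.
by rewrite -[X in measurable X]setTI; exact: measurable_tnth.
Qed.

Lemma tuple_box_generates n : @measurable _ (n.-tuple E) =
  <<s [set X | exists2 B : 'I_n ->
    set E, (forall i, measurable (B i)) & X = tuple_box B] >>.
Proof.
apply/seteqP; split=> [X|X].
  apply: smallest_sub; first exact: smallest_sigma_algebra.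
  move=> Y; rewrite -bigcup_seq => -[i _ [B mB <-]]; rewrite setTI.
  apply: sub_sigma_algebra.
  exists (fun j => if j == i then B else setT) => [j|]; first by case: ifP.
  apply/seteqP; split=> [t /= Bt j _ /=|t /= /(_ i I) /=]; last by rewrite eqxx.
  by case: eqVneq => // ->.
apply: smallest_sub; first by exact: sigma_algebra_measurable.
by move=> Y [B mB ->]; exact: measurable_tuple_box.
Qed.

(** For fixed [C], the sets [B] that satisfy the product rule form a Dynkin class, and the boxes are
    an intersection-stable generator inside it. *)
Lemma independent2_tuple n (Z : 'I_n.+1 -> T -> E) :
  (forall i, measurable_fun [set: T] (Z i)) -> mutually_independent P Z ->
  independent2 P (fun w => [tuple Z (widen_ord (leqnSn n) i) w | i < n])
    (Z ord_max).
Proof.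
move=> mZ iZ B C mB mC; set U := fun w => _.
have mU : measurable_fun [set: T] U.
  apply/measurable_fun_tnthP => i.
  by rewrite (_ : _ \o _ = Z (widen_ord (leqnSn n) i)) //; apply/funext => w;
    rewrite /= tnth_mktuple.
set VC := Z ord_max @^-1` C.
have mVC : measurable VC by exact: preimage_measurable.
have mUB X : measurable X ->
  measurable (U @^-1` X) by exact: preimage_measurable.
move: B mB; rewrite tuple_box_generates.
apply: (dynkin_induction (tuple_box_generates n)).
- move=> _ _ [B mB ->] [B' mB' ->]; exists (fun i => B i `&` B' i).
    by move=> i; exact: measurableI.
  by apply/seteqP; split=> [t [h h'] i _|t h]; [split;
    [exact: h|exact: h']|split=> i _; have [] := h i I].
- by rewrite preimage_setT setTI probability_setT mul1e.
- move=> _ [B mB ->].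
  (* The box [B] completed by [D] in the last coordinate. Taking [D = setT] below identifies the
     product over the first [n] coordinates as the probability of the box. *)
  pose B' D (i : 'I_n.+1) := if unlift ord_max i is Some j then B j else D.
  have mB' D : measurable D -> forall i, measurable (B' D i).
    by move=> mD i; rewrite /B'; case: unliftP => [j _|_].
  have B'E D : \bigcap_(i in [set: 'I_n.+1]) (Z i @^-1` B' D i) =
      U @^-1` tuple_box B `&` Z ord_max @^-1` D.
    apply/seteqP; split=> [w h|w [h hD] i _]; last first.
      rewrite /= /B'; case: unliftP => [j ->|-> //].
      by have := h j I; rewrite /= tnth_mktuple; congr (B j (Z _ w));
        apply/val_inj => /=; rewrite /bump leqNgt ltn_ord.
    split=> [j _ /=|]; last by have := h ord_max I; rewrite /= /B' unlift_none.
    have := h (lift ord_max j) I; rewrite /= /B' liftK tnth_mktuple.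
    by congr (B j (Z _ w)); apply/val_inj => /=; rewrite /bump leqNgt ltn_ord.
  have PE D : measurable D -> (P (U @^-1` tuple_box B `&` Z ord_max @^-1` D) =
      (\prod_(i < n) P (Z (widen_ord (leqnSn n) i) @^-1` B i)) * P (Z ord_max
        @^-1` D))%E.
    move=> mD; rewrite -B'E iZ; last exact: mB'.
    rewrite big_ord_recr /= {2}/B' unlift_none; congr (_ * _)%E.
    apply: eq_bigr => i _; rewrite /B' (_ : widen_ord _ i = lift ord_max i)
      ?liftK //.
    by apply/val_inj => /=; rewrite /bump leqNgt ltn_ord.
  rewrite -/VC PE //; congr (_ * _)%E.
  have := PE _ measurableT; rewrite preimage_setT setIT => ->.
  by rewrite probability_setT mule1.
- move=> S mS /= SE.
  have -> : U @^-1` (~` S) = ~` (U @^-1` S) by [].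
  have DE : P (VC `\` U @^-1` S) = (P VC - P (U @^-1` S `&` VC))%E.
    rewrite setIC; apply: measureD => //; first exact: mUB.
    by rewrite (le_lt_trans (probability_le1 _ _)) // ltry.
  have CE : P (~` (U @^-1` S)) = (1 - P (U @^-1` S))%E.
    by apply: probability_setC; exact: mUB.
  rewrite setIC -setDE DE SE CE.
  rewrite muleBl ?mul1e //; first exact: fin_num_measure.
- move=> F mF tF FE.
  have tUF : trivIset setT (fun k => U @^-1` F k).
    apply/trivIsetP => k l _ _ kl; move/trivIsetP : tF => /(_ k l I I kl) FkFl.
    by rewrite -preimage_setI FkFl preimage_set0.
  rewrite preimage_bigcup setI_bigcupl measure_bigcup //; last 2 first.
  + by move=> k _; apply: measurableI => //; exact: mUB.
  + by exact: trivIset_setIr.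
  rewrite measure_bigcup //; last first.
  + by move=> k _; exact: mUB.
  have PV : P VC = (fine (P VC))%:E by rewrite fineK // fin_num_measure.
  rewrite PV muleC -nneseriesZl; last by move=> k _; exact: measure_ge0.
  by apply: eq_eseriesr => k _; rewrite [LHS]FE muleC PV.
Qed.

End tuples.

End independence.

(** * Trace exponential of an independent sum *)

Section matrix_laplace.
Context {R : realType} (d : measure_display) (T : measurableType d).
Variable P : probability T R.
Context (e : measure_display) (E : measurableType e).

Lemma integral_cst_probability (c : \bar R) : (\int[P]__ c = c)%E.
Proof.
rewrite integral_cst // [X in (_ * X)%E](_ : _ = 1%E) ?mule1 //.
exact: probability_setT.
Qed.

Lemma measurable_mxtrace_mexp d' (T' : measurableType d') n (S : T' ->
  borel_mx R n n) :
  (forall w, (S w)^T = S w :> 'M[R]_n) -> measurable_fun [set: T'] S ->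
  measurable_fun [set: T'] (fun w => \tr (mexp (S w : 'M[R]_n))).
Proof.
move=> Ss mS; apply: (measurable_mxtrace (S := (fun w =>
  mexp (S w)) : T' -> borel_mx R n n)).
exact: measurable_mxfun expR_bounded_lipschitz Ss mS.
Qed.

Lemma measurable_mxadd d' (T' : measurableType d') m n (S S' : T' ->
  borel_mx R m n) :
  measurable_fun [set: T'] S -> measurable_fun [set: T'] S' ->
  measurable_fun [set: T'] ((fun w =>
    (S w + S' w : 'M[R]_(m, n))) : T' -> borel_mx R m n).
Proof.
move=> mS mS'; apply: measurable_fun_mx => i j.
rewrite (_ : (fun w => _) = (fun w => S w i j + S' w i j)); last first.
  by apply/funext => w; rewrite mxE.
by apply: measurable_funD; exact: measurable_mx_entry.
Qed.

Lemma measurable_mxsum d' (T' : measurableType d') m n k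
    (S : 'I_k -> T' -> borel_mx R m n) :
  (forall i, measurable_fun [set: T'] (S i)) ->
  measurable_fun [set: T'] ((fun w =>
    \sum_i (S i w : 'M[R]_(m, n))) : T' -> borel_mx R m n).
Proof.
move=> mS; apply: measurable_fun_mx => i j.
rewrite (_ : (fun w => _) = (fun w => \sum_l S l w i j)); last first.
  by apply/funext => w; rewrite summxE.
by apply: measurable_sum => l; exact: measurable_mx_entry.
Qed.

Lemma mexp_sum_bound N (F : E -> borel_mx R N N) (H : 'M[R]_N) :
  measurable_fun [set: E] F -> (forall z, (F z)^T = F z :> 'M[R]_N) ->
    H^T = H ->
  forall n (Z : 'I_n -> T -> E), (forall i, measurable_fun [set: T] (Z i)) ->
  mutually_independent P Z ->
  (forall i (K G : 'M[R]_N), K^T = K -> supergradient K G ->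
    \int[P]_w (\tr (mexp (K + F (Z i w))))%:E <= (\tr (G *m mexp H))%:E)%E ->
  forall K : 'M[R]_N, K^T = K ->
  (\int[P]_w (\tr (mexp (K + \sum_i (F (Z i w) : 'M[R]_N))))%:E
     <= (\tr (mexp (K + H *+ n)))%:E)%E.
Proof.
move=> mF Fs Hs; elim=> [|n IH] Z mZ iZ ZG K Ks.
  under eq_integral do rewrite big_ord0 addr0.
  by rewrite mulr0n addr0 integral_cst_probability.
pose Z' i := Z (widen_ord (leqnSn n) i).
pose U w : n.-tuple E := [tuple Z' i w | i < n].
pose S (u : n.-tuple E) : 'M[R]_N := \sum_i (F (tnth u i) : 'M[R]_N).
have Ss u : (S u)^T = S u by rewrite /S linear_sum /=; apply: eq_bigr => i _;
  exact: Fs.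
have mS : measurable_fun setT (S : n.-tuple E -> borel_mx R N N).
  by apply: measurable_mxsum => i; apply: measurableT_comp => //;
    exact: measurable_tnth.
have mU : measurable_fun [set: T] U.
  apply/measurable_fun_tnthP => i.
  rewrite (_ : _ \o _ = Z' i); first exact: mZ.
  by apply/funext => w; rewrite /= tnth_mktuple.
have SU w : S (U w) = \sum_(i < n) (F (Z' i w) : 'M[R]_N).
  by apply: eq_bigr => i _; rewrite tnth_mktuple.
pose f (z : n.-tuple E * E) := (\tr (mexp (K + S z.1 + F z.2)))%:E.
pose g (u : n.-tuple E) := (\tr (mexp (K + H + S u)))%:E.
have Ksym (M : 'M[R]_N) u : M^T = M -> (M + S u)^T = M + S u.
  by move=> Ms; rewrite linearD /= Ms Ss.
under eq_integral => w _.
  rewrite big_ord_recr /= -(SU w) addrA.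
  rewrite -/(f (U w, Z ord_max w)).
  over.
have KH : (K + H)^T = K + H by rewrite linearD /= Ks Hs.
apply: le_trans (_ : (\int[P]_w g (U w) <= _)%E); last first.
  rewrite mulrS addrA; under eq_integral do rewrite /g SU.
  apply: IH => //.
  - by move=> i; exact: mZ.
  - move=> B mB.
    pose B' (i : 'I_n.+1) := if unlift ord_max i is Some j then B j else setT.
    have B'w i : B' (widen_ord (leqnSn n) i) = B i.
      rewrite /B' (_ : widen_ord _ i = lift ord_max i) ?liftK //.
      by apply/val_inj => /=; rewrite /bump leqNgt ltn_ord.
    have B'm : B' ord_max = setT by rewrite /B' unlift_none.
    have mB' i : measurable (B' i).
      by rewrite /B'; case: unliftP => [j _|_]; [exact: mB|exact: measurableT].
    have := iZ B' mB'; rewrite big_ord_recr /= B'm preimage_setT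
      probability_setT mule1.
    under eq_bigr do rewrite B'w.
    move=> <-; congr (P _); apply/seteqP; split=> [w h i _|w h i _].
      rewrite /= /B'; case: unliftP => [j ->|_ //]; have := h j I.
      by rewrite /Z' /=; congr (B j (Z _ w)); apply/val_inj => /=;
        rewrite /bump leqNgt ltn_ord.
    by have := h (widen_ord (leqnSn n) i) I; rewrite /= B'w.
  - by move=> i; exact: ZG.
apply: (le_integral_independent2 (f := f) (g := g)) => //.
- exact: independent2_tuple.
- apply/measurable_EFinP; apply: (measurable_mxtrace_mexp (S := fun z =>
    K + S z.1 + F z.2)).
    by move=> z; rewrite linearD /= Ksym // Fs.
  apply: measurable_mxadd; last by apply: measurableT_comp.
  apply: measurable_mxadd; first exact: measurable_cst.
  by apply: measurableT_comp.
- by move=> z; rewrite lee_fin mxtrace_mexp_ge0.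
- apply/measurable_EFinP; apply: (measurable_mxtrace_mexp (S := fun u =>
    K + H + S u)).
    by move=> u; rewrite Ksym.
  by apply: measurable_mxadd => //; exact: measurable_cst.
- by move=> z; rewrite lee_fin mxtrace_mexp_ge0.
apply: aeW => w; rewrite /f /g /=.
(* [G] may vary with [w] in any manner: contact at [H] turns the bound into [g], from which [G] has
   disappeared. *)
have [G [GH KG]] := lieb_supergradient (Ksym _ (U w) Ks) Hs.
rewrite [K + H + _]addrAC -GH; apply: ZG => //; exact: Ksym.
Qed.

End matrix_laplace.

(** * Moments of the truncated summands *)

Section sandwich_algebra.
Context {R : realType} (d1 d2 : nat).
Implicit Types (A : 'M[R]_(d1, d2)) (v : 'cV[R]_(d2 * d1)).

Lemma vecE A j a : vec A (mxvec_index j a) 0 = A a j.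
Proof. by rewrite /vec mxE mxvecE mxE. Qed.

Lemma reshapeE v a j : Defs.reshape v a j = v (mxvec_index j a) 0 :> R.
Proof. by rewrite /Defs.reshape 3!mxE. Qed.

Lemma reshapeK A : Defs.reshape (vec A) = A.
Proof. by apply/matrixP => a j; rewrite reshapeE vecE. Qed.

Lemma sum_mxvec_index (f : 'I_(d2 * d1) -> R) :
  \sum_k f k = \sum_j \sum_a f (mxvec_index j a).
Proof.
rewrite pair_big_dep /= (reindex (uncurry (@mxvec_index d2 d1))) /=; last first.
  exact: curry_mxvec_bij.
by apply: eq_bigr => -[].
Qed.

Lemma mxdot_vec A (B : 'M[R]_(d1, d2)) :
  mxdot A B = \sum_k vec A k 0 * vec B k 0.
Proof.
rewrite /mxdot tr_mul_mx [RHS]sum_mxvec_index; apply: eq_bigr => j _.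
by apply: eq_bigr => a _; rewrite mxE !vecE.
Qed.

Lemma mxdotBl A (A' B : 'M[R]_(d1, d2)) :
  mxdot (A - A') B = mxdot A B - mxdot A' B.
Proof.
rewrite !mxdot_vec -sumrB; apply: eq_bigr => k _.
by rewrite -mulrBl; case/mxvec_indexP: k => j a; rewrite !vecE !mxE.
Qed.

Lemma mxdotNl A (B : 'M[R]_(d1, d2)) : mxdot (- A) B = - mxdot A B.
Proof.
rewrite !mxdot_vec -sumrN; apply: eq_bigr => k _.
by rewrite -mulNr; case/mxvec_indexP: k => j a; rewrite !vecE mxE.
Qed.

Definition dil v : 'M[R]_(d1 + d2) := dilation (Defs.reshape v).

Lemma dilZ c v : dil (c *: v) = c *: dil v.
Proof.
rewrite /dil -dilationZ; congr dilation.
by apply/matrixP => a j; rewrite [RHS]mxE !reshapeE [LHS]mxE.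
Qed.

Lemma dilD v v' : dil (v + v') = dil v + dil v'.
Proof.
rewrite /dil -dilationD; congr dilation.
by apply/matrixP => a j; rewrite [RHS]mxE !reshapeE [LHS]mxE.
Qed.

Lemma dil_mul (W : 'M[R]_(d2 * d1)) v :
  dil (W *m v) = \sum_k v k 0 *: dil (col k W).
Proof.
have -> : W *m v = \sum_k v k 0 *: col k W.
  apply/colP => i; rewrite mxE summxE; apply: eq_bigr => k _.
  by rewrite !mxE mulrC.
elim/big_ind2 : _ => [|x1 y1 x2 y2 <- <-|k _];
  [|by rewrite dilD|by rewrite dilZ].
by rewrite -(scale0r 0) dilZ !scale0r.
Qed.

(** If [Q] is the second moment of [vec x], the left side is the mean square of
    [dil (invmx Q *m vec x)]. The identity [W Q W^T = W] for [W = invmx Q] gives each entry, and the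
    inner index of the block products runs over the principal submatrices. *)
Lemma dil_sqr_sum (Q : 'M[R]_(d2 * d1)) : Q \in unitmx -> Q^T = Q ->
  \sum_k \sum_l Q k l *: (dil (col k (invmx Q)) *m dil (col l (invmx Q))) =
  block_mx (\sum_(i < d2) Dcol Q i) 0 0 (\sum_(i < d1) Drow Q i).
Proof.
move=> Qu Qs; set W := invmx Q.
have Ws : W^T = W by rewrite /W trmx_inv Qs.
have WQW x y : \sum_k \sum_l Q k l * (W x k * W y l) = W x y.
  have -> : W x y = (W *m Q *m W^T) x y by rewrite Ws mulVmx // mul1mx.
  rewrite mxE exchange_big; apply: eq_bigr => l _; rewrite !mxE mulr_suml.
  by apply: eq_bigr => k _; ring.
have blk k l : Q k l *: (dil (col k W) *m dil (col l W)) =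
    block_mx (Q k l *: (Defs.reshape (col k W) *m (Defs.reshape (col l W))^T))
      0 0
             (Q k l *: ((Defs.reshape (col k W))^T *m Defs.reshape (col l W))).
  rewrite /dil /dilation mulmx_block !mulmx0 !mul0mx !addr0 !add0r.
  by rewrite scale_block_mx !scaler0.
have sumblk (f : 'I_(d2 * d1) -> 'M[R]_d1) (g : 'I_(d2 * d1) -> 'M[R]_d2) :
    \sum_k block_mx (f k) 0 0 (g k) = block_mx (\sum_k f k) 0 0 (\sum_k g k).
  elim/big_ind3 : _ => [|? ? ? ? ? ? -> ->|//].
    by rewrite -[LHS](scale0r (block_mx 0 0 0 0)) scale_block_mx !scaler0.
  by rewrite add_block_mx !addr0.
have rW k j a : Defs.reshape (col k W) a j = W (mxvec_index j a) k.
  by rewrite reshapeE mxE.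
under eq_bigr => k _ do under eq_bigr => l _ do rewrite blk.
under eq_bigr => k _ do rewrite sumblk.
rewrite sumblk; congr block_mx; apply/matrixP => a b.
  rewrite !summxE.
  under eq_bigr => k _ do rewrite summxE.
  transitivity (\sum_(j < d2) \sum_k \sum_l Q k l * (W (mxvec_index j a) k * W
    (mxvec_index j b) l)).
    rewrite [RHS]exchange_big; apply: eq_bigr => k _; rewrite [RHS]exchange_big.
    apply: eq_bigr => l _; rewrite mxE [X in _ * X]mxE mulr_sumr.
    apply: eq_bigr => j _.
    by rewrite [(Defs.reshape (col l W))^T _ _]mxE !rW.
  by apply: eq_bigr => j _; rewrite WQW mxE.
rewrite !summxE.
under eq_bigr => k _ do rewrite summxE.
transitivity (\sum_(j < d1) \sum_k \sum_l Q k l * (W (mxvec_index a j) k * W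
  (mxvec_index b j) l)).
  rewrite [RHS]exchange_big; apply: eq_bigr => k _; rewrite [RHS]exchange_big.
  apply: eq_bigr => l _; rewrite mxE [X in _ * X]mxE mulr_sumr.
  apply: eq_bigr => j _.
  by rewrite [(Defs.reshape (col k W))^T _ _]mxE !rW.
by apply: eq_bigr => j _; rewrite WQW mxE.
Qed.

Lemma Dcol_tr (Q : 'M[R]_(d2 * d1)) i : Q^T = Q -> (Dcol Q i)^T = Dcol Q i.
Proof.
move=> Qs; apply/matrixP => a b; rewrite !mxE.
by rewrite -[in RHS]Qs -trmx_inv mxE.
Qed.

Lemma Drow_tr (Q : 'M[R]_(d2 * d1)) i : Q^T = Q -> (Drow Q i)^T = Drow Q i.
Proof.
move=> Qs; apply/matrixP => a b; rewrite !mxE.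
by rewrite -[in RHS]Qs -trmx_inv mxE.
Qed.

Lemma dil_sqr_sum_spec (Q : 'M[R]_(d2 * d1)) : Q^T = Q ->
  exists U l, [/\ orthogonal_mx U,
    block_mx (\sum_(i < d2) Dcol Q i) 0 0 (\sum_(i < d1) Drow Q i) = spec U l
    & forall k, l 0 k <= BQ Q].
Proof.
move=> Qs.
have [|U1 [l1 [oU1 E1]]] := @spectral_spec R _ (\sum_(i < d2) Dcol Q i).
  by rewrite linear_sum; apply: eq_bigr => i _; exact: Dcol_tr.
have [|U2 [l2 [oU2 E2]]] := @spectral_spec R _ (\sum_(i < d1) Drow Q i).
  by rewrite linear_sum; apply: eq_bigr => i _; exact: Drow_tr.
exists (block_mx U1 0 0 U2), (row_mx l1 l2); split.
- rewrite /orthogonal_mx tr_block_mx mulmx_block !trmx0 !mulmx0 !mul0mx !addr0.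
  by rewrite add0r oU1 oU2 -scalar_mx_block.
- rewrite E1 E2 /spec tr_block_mx diag_mx_row !mulmx_block !trmx0.
  by rewrite !mulmx0 !mul0mx !addr0 !add0r !mul0mx.
- move=> k; rewrite /BQ le_max E1 E2 mxE; case: (fintype.split k) => j.
    by rewrite lambda_max_ge.
  by rewrite [X in _ || X]lambda_max_ge ?orbT.
Qed.

(** The column blocks partition the diagonal of [invmx Q], so their sum has the positive trace of
    [invmx Q] and thus a positive eigenvalue. *)
Lemma BQ_gt0 (Q : 'M[R]_(d2 * d1)) : (0 < d1)%N -> (0 < d2)%N ->
  Q^T = Q -> Q \in unitmx ->
  (forall v : 'rV[R]_(d2 * d1), 0 <= (v *m Q *m v^T) 0 0) -> 0 < BQ Q.
Proof.
move=> d1_gt0 d2_gt0 Qs Qu Qpos.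
have [U [l [oU QE]]] := spectral_spec Qs.
have l0 k : 0 < l 0 k.
  rewrite lt_def; apply/andP; split.
    apply: contraTneq Qu => lk0; rewrite QE unitmxE !det_mulmx det_diag.
    by rewrite (bigD1 k) //= lk0 mul0r mulr0 mul0r unitr0.
  have := Qpos (row k U^T); rewrite QE spec_form -row_mul oU (bigD1 k) //=.
  rewrite [row _ _ _ _]mxE [1%:M _ _]mxE eqxx expr1n mulr1 big1 ?addr0 // =>
    j jk.
  by rewrite [row _ _ _ _]mxE [1%:M _ _]mxE eq_sym (negPf jk) expr0n mulr0.
have WE : invmx Q = spec U (map_mx (fun x => x^-1) l).
  rewrite -[RHS]mulmx1 -(mulmxV Qu) mulmxA [X in _ = X *m _](_ : _ = 1%:M)
    ?mul1mx //.
  rewrite QE /spec !mulmxA -[_ *m U^T *m U]mulmxA oU mulmx1.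
  rewrite -(mulmxA U) mulmx_diag (_ : \row_j _ = const_mx 1); last first.
    by apply/rowP => k; rewrite !mxE mulVf // gt_eqF.
  by rewrite diag_const_mx mulmx1 orthogonal_mxV.
have tr_gt0 : 0 < \tr (invmx Q).
  rewrite WE mxtrace_spec //.
  have k0 : 'I_(d2 * d1) := Ordinal (leq_ltn_trans (leq0n 0) (etrans (muln_gt0
    _ _) (introT andP (conj d2_gt0 d1_gt0)))).
  rewrite (bigD1 k0) //= ltr_wpDr ?sumr_ge0 // => [k _|];
    rewrite mxE ?invr_gt0 //.
  by rewrite ltW // invr_gt0.
have trE : \tr (\sum_(i < d2) Dcol Q i) = \tr (invmx Q).
  rewrite [RHS]sum_mxvec_index linear_sum; apply: eq_bigr => j _.
  by apply: eq_bigr => a _; rewrite mxE.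
have [|U1 [l1 [oU1 E1]]] := @spectral_spec R _ (\sum_(i < d2) Dcol Q i).
  by rewrite linear_sum; apply: eq_bigr => i _; exact: Dcol_tr.
rewrite /BQ lt_max; apply/orP; left; rewrite ltNge; apply/negP => lam0.
move: tr_gt0; rewrite -trE E1 mxtrace_spec // ltNge => /negP; apply.
apply: sumr_le0 => k _; apply: le_trans lam0; rewrite E1; exact: lambda_max_ge.
Qed.

End sandwich_algebra.

(** * Moments of subgaussian noise *)

Section subgaussian.
Context {R : realType} (d : measure_display) (T : measurableType d).
Variable P : probability T R.

Lemma le_of_small_mul (m s : R) : (forall u, 0 < u -> u < 1 ->
  m * (1 - u) <= s) -> m <= s.
Proof.
move=> h; have [//|sm] := leP m s.
have [m0|m0] := leP m 0.
  by have := h 2^-1; rewrite invr_gt0 ltr0n invf_lt1 ?ltr1n // =>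
    /(_ isT isT); lra.
have [s0|s0] := leP s 0.
  have := h 2^-1; rewrite invr_gt0 ltr0n invf_lt1 ?ltr1n // => /(_ isT isT).
  by lra.
(* This [u] makes [m * (1 - u)] the midpoint of [s] and [m], which exceeds [s]. *)
have := h ((m - s) / (2 * m)); rewrite divr_gt0 ?subr_gt0 ?mulr_gt0 //.
rewrite ltr_pdivrMr ?mulr_gt0 // => /(_ isT); rewrite mul1r.
have -> : m * (1 - (m - s) / (2 * m)) = (m + s) / 2 by field; rewrite gt_eqF.
by move=> H; have := H ltac:(lra); lra.
Qed.

Variables (sigma : R) (eta : T -> R).
Hypotheses (meta : measurable_fun [set: T] eta) (sg : centered_subgaussian P
  sigma eta).

Lemma integrable_subgaussian_expR s :
  P.-integrable [set: T] (EFin \o (fun w => expR (s * eta w))).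
Proof.
apply/integrableP; split.
  apply/measurable_EFinP; apply: measurableT_comp => //.
  exact: measurable_funM.
have H := sg.2 s; rewrite unlock in H.
apply: le_lt_trans (ltry (expR (s ^+ 2 * sigma ^+ 2 / 2))); apply: le_trans H.
rewrite le_eqVlt; apply/orP; left; apply/eqP.
by apply: eq_integral => w _ /=; rewrite ger0_norm ?expR_ge0.
Qed.

Lemma integrable_subgaussian_sqr :
  P.-integrable [set: T] (EFin \o (fun w => eta w ^+ 2)).
Proof.
have h := integrableD measurableT (integrable_subgaussian_expR 1)
   (integrable_subgaussian_expR (-1)).
apply: le_integrable h => //.
  by apply/measurable_EFinP; exact: measurable_funX.
move=> w _ /=; rewrite lee_fin !mul1r mulN1r.
rewrite ger0_norm ?sqr_ge0 // ger0_norm ?addr_ge0 ?expR_ge0 //.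
by apply: le_trans (expRDN_ge_sqr _); rewrite lerDr.
Qed.

Lemma integrable_subgaussian : P.-integrable [set: T] (EFin \o eta).
Proof.
have i1 : P.-integrable [set: T] (EFin \o cst 1) by exact:
  finite_measure_integrable_cst.
have h := integrableD measurableT i1 integrable_subgaussian_sqr.
apply: le_integrable h => //; first exact/measurable_EFinP.
move=> w _ /=; rewrite lee_fin [leRHS]ger0_norm ?addr_ge0 ?sqr_ge0 //.
rewrite -[in leRHS]real_normK ?num_real //.
have : 0 <= (`|eta w| - 1) ^+ 2 by exact: sqr_ge0.
have : 0 <= `|eta w| by [].
rewrite sqrrB expr1n mulr1; lra.
Qed.

(** The [cosh] bound at [s] gives [s^2 m + 2 <= 2 exp u] with [u = s^2 sigma^2 / 2], that is,
    [u m <= sigma^2 (exp u - 1)]. Since [exp u * (1 - u) <= 1], it follows that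
    [m * (1 - u) <= sigma^2], for [u] arbitrarily small. *)
Lemma subgaussian_second_moment :
  (\int[P]_w (eta w ^+ 2)%:E <= (sigma ^+ 2)%:E)%E.
Proof.
have i2 := integrable_subgaussian_sqr.
set m := (\int[P]_w (eta w ^+ 2)%:E)%E.
have mfin : m \is a fin_num by exact: integrable_fin_num i2.
rewrite -(fineK mfin) lee_fin.
have key s : s ^+ 2 * fine m + 2 <= 2 * expR (s ^+ 2 * sigma ^+ 2 / 2).
  rewrite -lee_fin EFinD EFinM fineK //.
  have -> : ((s ^+ 2)%:E * m + 2%:E = \int[P]_w (s ^+ 2 * eta w ^+ 2 + 2)%:E)%E.
    rewrite -integralZl //.
    rewrite -[X in (_ + X)%E = _](integral_cst_probability P).
    rewrite -integralD //; first exact: integrableZl.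
    exact: finite_measure_integrable_cst.
  apply: (@le_trans _ _ (\int[P]_w (expR (s * eta w) + expR (- s * eta
    w))%:E)%E).
    apply: le_integral => //.
    - have i3 : P.-integrable [set: T] (fun=> 2%:E).
        exact: finite_measure_integrable_cst.
      exact: (integrableD measurableT (integrableZl measurableT (s ^+ 2) i2)
        i3).
    - exact: (integrableD measurableT (integrable_subgaussian_expR s)
        (integrable_subgaussian_expR (- s))).
    - move=> w _; rewrite lee_fin mulNr -exprMn addrC; exact: expRDN_ge_sqr.
  under eq_integral do rewrite EFinD.
  rewrite integralD //; try exact: integrable_subgaussian_expR.
  rewrite mulr_natl mulr2n EFinD; have [_ mgf] := sg.
  by apply: leeD; have := mgf s; have := mgf (- s); rewrite unlock sqrrN.
have [sig0|sig0] := eqVneq sigma 0.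
  by have := key 1; rewrite sig0 !expr0n /= !mulr0 mul0r expR0 expr1n; lra.
have s2 : 0 < sigma ^+ 2 by rewrite lt_def sqrf_eq0 sig0 sqr_ge0.
apply: le_of_small_mul => u u0 u1.
have := key (Num.sqrt (2 * u / sigma ^+ 2)).
rewrite sqr_sqrtr; last by apply: divr_ge0 (ltW s2); lra.
have -> : 2 * u / sigma ^+ 2 * sigma ^+ 2 / 2 = u by field.
have e1 : expR u * (1 - u) <= 1.
  rewrite -[leRHS](expRxMexpNx_1 u) ler_wpM2l ?expR_ge0 //; exact: expR_ge1Dx.
move: (fine m) => x h.
have h2 : u * x <= sigma ^+ 2 * (expR u - 1).
  rewrite -(@ler_pM2l _ (2 / sigma ^+ 2)) ?divr_gt0 //.
  rewrite (_ : 2 / sigma ^+ 2 * (sigma ^+ 2 * _) = 2 * expR u - 2);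
    last by field.
  by rewrite mulrA mulrAC; lra.
have h3 : u * x * (1 - u) <= sigma ^+ 2 * u.
  apply: le_trans (_ : sigma ^+ 2 * (expR u - 1) * (1 - u) <= _).
    by rewrite ler_wpM2r // subr_ge0 ltW.
  by rewrite -mulrA ler_pM2l // mulrBl mul1r; lra.
by rewrite -(ler_pM2l u0) mulrA [u * sigma ^+ 2]mulrC.
Qed.

Lemma subgaussian_quadratic c0 c1 c2 : 0 <= c2 ->
  (\int[P]_w (c0 + c1 * eta w + c2 * eta w ^+ 2)%:E <= (c0 + c2 * sigma ^+
    2)%:E)%E.
Proof.
move=> c20; have i1 := integrable_subgaussian;
  have i2 := integrable_subgaussian_sqr.
have i0 : P.-integrable [set: T] (fun=> c0%:E) by exact:
  finite_measure_integrable_cst.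
under eq_integral do rewrite 2!EFinD !EFinM.
rewrite integralD //; last 2 first.
- by apply: integrableD => //; exact: integrableZl.
- exact: integrableZl.
rewrite integralD //; last exact: integrableZl.
rewrite !integralZl // integral_cst_probability.
have := sg.1; rewrite unlock => ->; rewrite mule0 adde0 EFinD EFinM leeD2l //.
by rewrite lee_wpmul2l ?lee_fin // subgaussian_second_moment.
Qed.

End subgaussian.

(** * Second moments of the actions *)

Section covariance.
Context {R : realType} (d1 d2 : nat).
Variables (pi : probability (borel_mx R d1 d2) R) (A : set 'M[R]_(d1, d2)).
Hypotheses (hA : forall a, A a -> opnorm a <= 1) (hpi : distribution_on pi A).

Lemma distribution_on_ae (B : set (borel_mx R d1 d2)) :
  measurable B -> A `<=` B -> {ae pi, forall a, B a}.
Proof.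
move=> mB AB; exists (~` B); split; first exact: measurableC.
  by rewrite probability_setC // (hpi mB AB) subee.
by move=> a /= nB.
Qed.

Lemma measurable_vec (k : 'I_(d2 * d1)) :
  measurable_fun setT (fun a : borel_mx R d1 d2 =>
    vec (a : 'M[R]_(d1, d2)) k 0).
Proof.
case/mxvec_indexP: k => j a.
rewrite (_ : (fun _ => _) = fun M : borel_mx R d1 d2 =>
  (M : 'M[R]_(d1, d2)) a j).
  by apply: measurable_mx_entry; exact: measurable_id.
by apply/funext => M; rewrite vecE.
Qed.

(** [A] itself may be nonmeasurable; the matrices with entries in [[-1, 1]] form a measurable
    superset, which has full measure. *)
Lemma vec_bounded_ae : {ae pi, forall a : borel_mx R d1 d2,
  forall k, `|vec (a : 'M[R]_(d1, d2)) k 0| <= 1}.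
Proof.
pose B : set (borel_mx R d1 d2) := \bigcap_(k in [set: 'I_(d2 * d1)])
  ((fun a : borel_mx R d1 d2 => vec (a : 'M[R]_(d1, d2)) k 0) @^-1` `[-1, 1]).
have mB : measurable B.
  apply: fin_bigcap_measurable => // k _; rewrite -[X in measurable X]setTI.
  exact: measurable_vec.
have : A `<=` B.
  move=> a /hA a1 k _; case/mxvec_indexP: k => j i /=.
  by rewrite vecE in_itv /= -ler_norml; exact: opnorm1_entry.
move=> /(distribution_on_ae mB); apply: filterS => a Ba k.
by have := Ba k I; rewrite /= in_itv /= ler_norml.
Qed.

(** Makes the entries of [covariance_mx] genuine integrals, to which linearity applies. *)
Lemma integrable_vec2 k l : pi.-integrable setT
  (EFin \o (fun a : borel_mx R d1 d2 =>
     vec (a : 'M[R]_(d1, d2)) k 0 * vec (a : 'M[R]_(d1, d2)) l 0)).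
Proof.
have mf : measurable_fun setT (fun a : borel_mx R d1 d2 =>
    vec (a : 'M[R]_(d1, d2)) k 0 * vec (a : 'M[R]_(d1, d2)) l 0).
  by apply: measurable_funM; exact: measurable_vec.
apply/integrableP; split; first exact/measurable_EFinP.
apply: (@le_lt_trans _ _ (1%:E * pi setT)%E).
  apply: integral_le_bound => //; first exact/measurable_EFinP.
  apply: filterS vec_bounded_ae => a ab _ /=.
  by rewrite lee_fin normrM -[leRHS]mulr1 ler_pM.
by rewrite probability_setT mule1 ltry.
Qed.

Lemma integral_quadratic c (N : 'M[R]_(d2 * d1)) :
  (\int[pi]_a (c + \sum_k \sum_l N k l *
     (vec (a : 'M[R]_(d1, d2)) k 0 * vec (a : 'M[R]_(d1, d2)) l 0))%:E =
   (c + \sum_k \sum_l N k l * covariance_mx pi k l)%:E)%E.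
Proof.
pose f k l (a : borel_mx R d1 d2) : \bar R := ((N k l)%:E *
  (vec (a : 'M[R]_(d1, d2)) k 0 * vec (a : 'M[R]_(d1, d2)) l 0)%:E)%E.
have fi k l : pi.-integrable setT (f k l) by apply: integrableZl => //;
  exact: integrable_vec2.
transitivity (\int[pi]_a (c%:E + \sum_k \sum_l f k l a))%E.
  apply: eq_integral => a _; rewrite EFinD; congr (_ + _)%E.
  rewrite -sumEFin; apply: eq_bigr => k _; rewrite -sumEFin.
  by apply: eq_bigr => l _; rewrite EFinM.
rewrite integralD //; last 2 first.
- exact: finite_measure_integrable_cst.
- by apply: integrable_sum => // k _; apply: integrable_sum.
rewrite integral_cst_probability EFinD; congr (_ + _)%E.
rewrite integral_sum //; last by move=> k; apply: integrable_sum.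
rewrite -sumEFin; apply: eq_bigr => k _; rewrite integral_sum //.
rewrite -sumEFin; apply: eq_bigr => l _; rewrite integralZl //;
  last exact: integrable_vec2.
rewrite EFinM mxE /Rintegral fineK //.
by apply: integrable_fin_num => //; exact: integrable_vec2.
Qed.

Lemma covariance_mx_tr : (covariance_mx pi)^T = covariance_mx pi.
Proof.
apply/matrixP => k l; rewrite !mxE; apply: eq_Rintegral => a _.
by rewrite mulrC.
Qed.

Lemma covariance_mx_ge0 (v : 'rV[R]_(d2 * d1)) :
  0 <= (v *m covariance_mx pi *m v^T) 0 0.
Proof.
have := integral_quadratic 0 (v^T *m v).
under eq_integral => a _.
  rewrite add0r (_ : \sum_k _ = (\sum_k v 0 k * vec (a : 'M[R]_(d1, d2)) k 0)
    ^+ 2); last first.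
    rewrite expr2 mulr_suml; apply: eq_bigr => k _.
    rewrite mulr_sumr; apply: eq_bigr => l _.
    by rewrite mxE big_ord1 !mxE; ring.
  over.
rewrite add0r => qE; rewrite (_ : _ 0 0 = \sum_k \sum_l (v^T *m v) k l *
  covariance_mx pi k l).
  rewrite -lee_fin -qE; apply: integral_ge0 => a _.
  by rewrite lee_fin sqr_ge0.
rewrite mxE exchange_big; apply: eq_bigr => l _; rewrite mxE mulr_suml.
apply: eq_bigr => k _; rewrite [v^T _ _]mxE [(v^T *m v) _ _]mxE big_ord1 [v^T _
  _]mxE; ring.
Qed.

End covariance.

Section sample_measurability.
Context {R : realType} (d1 d2 : nat) (Q : 'M[R]_(d2 * d1)) (nu : R).

Lemma dil_one_sample (th x : 'M[R]_(d1, d2)) y :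
  nu *: dilation (Defs.reshape (one_sample Q th x y)) =
  (nu * (y - mxdot th x)) *: dil (invmx Q *m vec x).
Proof. by rewrite -/(dil _) /one_sample dilZ scalerA. Qed.

(** Joint in the pilot matrix, the action and the response, since the pilot may be random. *)
Lemma measurable_dil_one_sample : measurable_fun setT
  ((fun z : borel_mx R d1 d2 * (borel_mx R d1 d2 * R) =>
      nu *: dilation (Defs.reshape (one_sample Q z.1 z.2.1 z.2.2)))
    : _ -> borel_mx R (d1 + d2) (d1 + d2)).
Proof.
apply: measurable_fun_mx => i j.
under eq_fun do rewrite dil_one_sample dil_mul mxE summxE mxdot_vec.
have mx k : measurable_fun setT
    (fun z : borel_mx R d1 d2 * (borel_mx R d1 d2 * R) =>
      vec (z.2.1 : 'M[R]_(d1, d2)) k 0).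
  apply: (measurableT_comp (measurable_vec k)).
  exact: (measurableT_comp measurable_fst measurable_snd).
apply: measurable_funM.
  apply: measurable_funM; first exact: measurable_cst.
  apply: measurable_funB.
    exact: (measurableT_comp measurable_snd measurable_snd).
  apply: measurable_sum => k; apply: measurable_funM => //.
  exact: (measurableT_comp (measurable_vec k) measurable_fst).
apply: measurable_sum => k; under eq_fun do rewrite mxE.
by apply: measurable_funM => //; exact: measurable_cst.
Qed.

End sample_measurability.

(** * One truncated summand against a supergradient *)

Section catoni_moment.
Context {R : realType} (d1 d2 : nat).
Variables (pi : probability (borel_mx R d1 d2) R) (A : set 'M[R]_(d1, d2)).
Hypotheses (hA : forall a, A a -> opnorm a <= 1) (hpi : distribution_on pi A).
Variable Q : 'M[R]_(d2 * d1).
Hypotheses (hQ : Q = covariance_mx pi) (hQu : Q \in unitmx).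
Context (disp : measure_display) (T : measurableType disp) (P : probability T
  R).
Variables (X : T -> borel_mx R d1 d2) (eta : T -> R) (sigma R0 nu : R).
Hypotheses (mX : measurable_fun [set: T] X) (meta : measurable_fun [set: T]
  eta).
Hypotheses (lawX : has_law P X pi) (sg : centered_subgaussian P sigma eta).
Hypothesis Xeta : independent2 P X eta.
Variable Del : 'M[R]_(d1, d2).
Hypotheses (hd1 : (0 < d1)%N) (hd2 : (0 < d2)%N).
Hypotheses (sigma_ge0 : 0 <= sigma) (R0_ge0 : 0 <= R0) (hDel : forall a, A a ->
  `|mxdot Del a| <= R0).

Let D (x : 'M[R]_(d1, d2)) : 'M[R]_(d1 + d2) := dil (invmx Q *m vec x).
Let Z (x : 'M[R]_(d1, d2)) (y : R) := (nu * (mxdot Del x + y)) *: D x.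

Let Qs : Q^T = Q. Proof. by rewrite hQ covariance_mx_tr. Qed.

Let D_tr x : (D x)^T = D x. Proof. exact: dilation_tr. Qed.

Let DE x : D x = \sum_k vec x k 0 *: dil (col k (invmx Q)).
Proof. exact: dil_mul. Qed.

Section fixed_supergradient.
Variables K G : 'M[R]_(d1 + d2).
Hypothesis KG : supergradient K G.

(** Coefficients of the bound [g] as a quadratic form in [vec x], so that its mean is a contraction
    of [N] with the covariance. *)
Let N : 'M[R]_(d2 * d1) := \matrix_(k, l)
  (nu * (vec Del k 0 * \tr (G *m dil (col l (invmx Q)))) +
   nu ^+ 2 / 2 * (R0 ^+ 2 + sigma ^+ 2) *
     \tr (G *m (dil (col k (invmx Q)) *m dil (col l (invmx Q))))).

Let alpha (x : 'M[R]_(d1, d2)) := \tr (G *m D x).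
Let beta (x : 'M[R]_(d1, d2)) := \tr (G *m (D x *m D x)).

Let beta_ge0 x : 0 <= beta x.
Proof.
have [U [l [oU DxE]]] := spectral_spec (D_tr x).
rewrite /beta DxE spec_sqr //; apply: supergradient_ge0 KG _ => // i.
by rewrite mxE sqr_ge0.
Qed.

Let alphaE x : alpha x = \sum_l vec x l 0 * \tr (G *m dil (col l (invmx Q))).
Proof.
rewrite /alpha DE mulmx_sumr linear_sum; apply: eq_bigr => l _.
by rewrite /= -scalemxAr linearZ.
Qed.

Let betaE x : beta x = \sum_k \sum_l vec x k 0 * vec x l 0 *
  \tr (G *m (dil (col k (invmx Q)) *m dil (col l (invmx Q)))).
Proof.
rewrite /beta DE mulmx_suml mulmx_sumr linear_sum; apply: eq_bigr => k _.
rewrite /= mulmx_sumr mulmx_sumr linear_sum; apply: eq_bigr => l _ /=.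
by rewrite -scalemxAl -scalemxAr -!scalemxAr scalerA linearZ /= mulrC.
Qed.

(** What remains after the noise is integrated out at fixed [x]: the terms linear in it vanish, and
    the second moment of the residual is at most [R0 ^+ 2 + sigma ^+ 2]. *)
Let g (x : 'M[R]_(d1, d2)) := \tr G + nu * (mxdot Del x * alpha x)
  + nu ^+ 2 / 2 * (R0 ^+ 2 + sigma ^+ 2) * beta x.

Let gE x : g x = \tr G + \sum_k \sum_l N k l * (vec x k 0 * vec x l 0).
Proof.
rewrite /g -addrA; congr (_ + _); rewrite mxdot_vec alphaE betaE.
rewrite mulr_suml !mulr_sumr -big_split /=; apply: eq_bigr => k _.
rewrite !mulr_sumr -big_split /=; apply: eq_bigr => l _.
by rewrite [N _ _]mxE; ring.
Qed.

Let f (z : borel_mx R d1 d2 * R) : R :=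
  \tr G + nu * (mxdot Del z.1 + z.2) * alpha z.1
   + (nu * (mxdot Del z.1 + z.2)) ^+ 2 / 2 * beta z.1.

Let fE z : f z = \tr (G *m (1%:M + Z z.1 z.2 + 2^-1 *: (Z z.1 z.2 *m Z z.1
  z.2))).
Proof.
rewrite /f /Z !mulmxDr mulmx1 !mxtraceD; congr (_ + _ + _).
  by rewrite -scalemxAr linearZ.
rewrite -!scalemxAl -!scalemxAr !scalerA linearZ /= /beta.
by congr (_ * _); rewrite expr2; ring.
Qed.

Let f_ge0 z : 0 <= f z.
Proof.
rewrite fE; have Zs : (Z z.1 z.2)^T = Z z.1 z.2 by rewrite /Z linearZ /= D_tr.
have [U [l [oU ->]]] := spectral_spec Zs.
rewrite spec_sqr // -specZ -(spec_scalar 1 oU) -!specD.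
apply: supergradient_ge0 KG _ => // i; rewrite !mxE mulrC; exact/ltW/quad_gt0.
Qed.

Let inner x : `|mxdot Del x| <= R0 ->
  (\int[P]_w (f (x, eta w))%:E <= (g x)%:E)%E.
Proof.
move=> xR0; have b0 := beta_ge0 x.
have n2 : 0 <= nu ^+ 2 / 2 by rewrite divr_ge0 ?sqr_ge0.
have -> : (\int[P]_w (f (x, eta w))%:E = \int[P]_w
  ((\tr G + nu * mxdot Del x * alpha x + nu ^+ 2 / 2 * mxdot Del x ^+ 2 * beta
    x)
   + (nu * alpha x + nu ^+ 2 * mxdot Del x * beta x) * eta w
   + nu ^+ 2 / 2 * beta x * eta w ^+ 2)%:E)%E.
  by apply: eq_integral => w _; rewrite /f /=; congr (_%:E); field.
apply: le_trans (subgaussian_quadratic meta sg _ _ _) _; first exact: mulr_ge0.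
rewrite lee_fin /g.
have : mxdot Del x ^+ 2 <= R0 ^+ 2.
  by rewrite -real_normK ?num_real // lerXn2r ?nnegrE.
move=> /(ler_wpM2l n2)/(ler_wpM2r b0); lra.
Qed.

(** A measurable superset of [A], hence of full measure, on which the pilot bound holds. *)
Let good : set (borel_mx R d1 d2) := [set x | `|mxdot Del x| <= R0].

Let m_mxdot : measurable_fun setT (fun x : borel_mx R d1 d2 => mxdot Del x).
Proof.
under eq_fun do rewrite mxdot_vec.
apply: measurable_sum => k; apply: measurable_funM; first exact: measurable_cst.
exact: measurable_vec.
Qed.

Let mgood : measurable good.
Proof.
rewrite (_ : good = (fun x : borel_mx R d1 d2 =>
  mxdot Del x) @^-1` `[- R0, R0]).
  exact: preimage_measurable.
by apply/seteqP; split=> x; rewrite /good /= in_itv /= ler_norml.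
Qed.

Let m_alpha : measurable_fun setT (fun x : borel_mx R d1 d2 => alpha x).
Proof.
under eq_fun do rewrite alphaE.
apply: measurable_sum => k; apply: measurable_funM; last exact: measurable_cst.
exact: measurable_vec.
Qed.

Let m_beta : measurable_fun setT (fun x : borel_mx R d1 d2 => beta x).
Proof.
under eq_fun do rewrite betaE.
apply: measurable_sum => k; apply: measurable_sum => l.
apply: measurable_funM; last exact: measurable_cst.
by apply: measurable_funM; exact: measurable_vec.
Qed.

Let m_g : measurable_fun setT (fun x : borel_mx R d1 d2 => g x).
Proof.
apply: measurable_funD.
  apply: measurable_funD; first exact: measurable_cst.
  by apply: measurable_funM; [exact: measurable_cst|exact: measurable_funM].
by apply: measurable_funM => //; exact: measurable_cst.
Qed.

Let m_f : measurable_fun setT f.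
Proof.
have m1 (h : borel_mx R d1 d2 -> R) : measurable_fun setT h ->
    measurable_fun setT (fun z : borel_mx R d1 d2 * R => h z.1).
  by move=> mh; exact: measurableT_comp.
have m2 : measurable_fun setT (fun z : borel_mx R d1 d2 * R =>
  nu * (mxdot Del z.1 + z.2)).
  apply: measurable_funM; first exact: measurable_cst.
  by apply: measurable_funD;
    [exact: (m1 (fun x => mxdot Del x))|exact: measurable_snd].
apply: measurable_funD.
  apply: measurable_funD; first exact: measurable_cst.
  by apply: measurable_funM => //; exact: (m1 (fun x => alpha x)).
apply: measurable_funM; last exact: (m1 (fun x => beta x)).
by apply: measurable_funM; [exact: measurable_funX|exact: measurable_cst].
Qed.

Let sum_NQ : \sum_k \sum_l N k l * Q k l = nu * \tr (G *m dilation Del)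
  + nu ^+ 2 / 2 * (R0 ^+ 2 + sigma ^+ 2) *
    \tr (G *m block_mx (\sum_(i < d2) Dcol Q i) 0 0 (\sum_(i < d1) Drow Q i)).
Proof.
rewrite -dil_sqr_sum // -[in dilation Del](reshapeK Del) -/(dil (vec Del)).
(* The cancellation of [Q] here is the unbiasedness of the one-sample estimator. *)
have -> : dil (vec Del) = dil (invmx Q *m (Q *m vec Del)) by rewrite mulmxA
  mulVmx // mul1mx.
rewrite dil_mul !mulmx_sumr !linear_sum /= !mulr_sumr.
under [X in _ = X + _]eq_bigr => l _.
  rewrite -scalemxAr linearZ /= mxE mulr_suml mulr_sumr.
  over.
rewrite [X in _ = X + _]exchange_big -big_split; apply: eq_bigr => k _ /=.
rewrite mulmx_sumr linear_sum mulr_sumr -big_split; apply: eq_bigr => l _ /=.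
rewrite mxE -scalemxAr linearZ /=.
have -> : Q l k = Q k l by rewrite -[in LHS]Qs mxE.
ring.
Qed.

Lemma integral_sandwich :
  (\int[P]_w (\tr (G *m (1%:M + Z (X w) (eta w)
      + 2^-1 *: (Z (X w) (eta w) *m Z (X w) (eta w)))))%:E <=
  (\tr G + nu * \tr (G *m dilation Del)
  + nu ^+ 2 / 2 * (R0 ^+ 2 + sigma ^+ 2) *
    \tr (G *m block_mx (\sum_(i < d2) Dcol Q i) 0 0 (\sum_(i < d1) Drow Q
      i)))%:E)%E.
Proof.
rewrite -addrA -sum_NQ.
have -> : \sum_k \sum_l N k l * Q k l = \sum_k \sum_l N k l * covariance_mx pi
  k l.
  by rewrite -hQ.
rewrite -(integral_quadratic hA hpi).
have gge0 : {ae pi, forall x : borel_mx R d1 d2, 0 <= g x}.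
  apply: filterS (distribution_on_ae hpi mgood hDel) => x xg.
  by rewrite -lee_fin; apply: le_trans (inner xg); apply: integral_ge0 => w _;
    rewrite lee_fin.
(* [g] is known to be nonnegative only on [good], where it dominates an integral of [f]. The
   absolute value supplies a bound nonnegative everywhere and agrees with [g] almost everywhere. *)
have mng : measurable_fun setT (fun x : borel_mx R d1 d2 => (`|g x|)%:E).
  apply/measurable_EFinP.
  exact: (measurableT_comp (@normr_measurable R setT) m_g).
apply: le_trans (_ : \int[P]_w (`|g (X w)|)%:E <= _)%E.
  under eq_integral do rewrite -(fE (X _, eta _)).
  apply: (le_integral_independent2 (f := fun z => (f z)%:E)
    (g := fun x : borel_mx R d1 d2 => (`|g x|)%:E) mX meta Xeta) => //.
  - exact/measurable_EFinP.
  exists (X @^-1` (~` good)); split.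
  - by apply: preimage_measurable => //; exact: measurableC.
  - rewrite lawX; last exact: measurableC.
    by rewrite probability_setC // (hpi mgood hDel) subee.
  move=> w /= nw Xw; apply: nw; apply: le_trans (inner Xw) _.
  by rewrite lee_fin ler_norm.
pose X' : {mfun T >-> borel_mx R d1 d2} :=
  HB.pack X (isMeasurableFun.Build _ _ _ _ _ mX).
have -> : (\int[P]_w (`|g (X w)|)%:E = \int[pi]_x (`|g x|)%:E)%E.
  transitivity (\int[distribution P X']_x (`|g x|)%:E)%E.
    by rewrite ge0_integral_distribution // => x; rewrite lee_fin.
  by apply: eq_measure_integral => B mB _; exact: lawX.
rewrite le_eqVlt; apply/orP; left; apply/eqP.
under [in RHS]eq_integral do rewrite -gE.
apply: ae_eq_integral; [exact: measurableT|exact: mng| |].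
  by apply/measurable_EFinP; exact: m_g.
by apply: filterS gge0 => x gx _; rewrite ger0_norm.
Qed.

Lemma measurable_sandwich : measurable_fun [set: T] (fun w =>
  \tr (G *m (1%:M + Z (X w) (eta w)
      + 2^-1 *: (Z (X w) (eta w) *m Z (X w) (eta w))))).
Proof.
under eq_fun do rewrite -(fE (X _, eta _)).
by apply: (measurableT_comp m_f); exact: measurable_fun_pair.
Qed.

End fixed_supergradient.

Lemma integral_catoni K G : K^T = K -> supergradient K G ->
  (\int[P]_w (\tr (mexp (K + mxfun phi0 (Z (X w) (eta w)))))%:E <=
  (\tr (G *m mexp (nu *: dilation Del +
     (nu ^+ 2 / 2 * ((sigma + R0) ^+ 2 * BQ Q))%:M)))%:E)%E.
Proof.
move=> Ks KG; have Bs := covariance_mx_ge0 hA hpi.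
have Zs w : (Z (X w) (eta w))^T = Z (X w) (eta w) by rewrite /Z linearZ /= D_tr.
apply: (@le_trans _ _ (\int[P]_w (\tr (G *m (1%:M + Z (X w) (eta w)
      + 2^-1 *: (Z (X w) (eta w) *m Z (X w) (eta w)))))%:E)%E).
  apply: ge0_le_integral => //.
  - by move=> w _; rewrite lee_fin mxtrace_mexp_ge0.
  - apply/measurable_EFinP; apply: (measurable_mxtrace_mexp
      (S := fun w => K + mxfun phi0 (Z (X w) (eta w)))).
      by move=> w; rewrite linearD /= Ks mxfun_tr.
    apply: measurable_mxadd; first exact: measurable_cst.
    apply: measurable_mxfun phi0_bounded_lipschitz _ _ => //.
    (* With pilot [- Del] and response [eta w], the residual is [mxdot Del (X w) + eta w], so [Z] is
       an instance of the one-sample map. *)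
    have mxe : measurable_fun [set: T] (fun w =>
        ((- Del : borel_mx R d1 d2), (X w, eta w))).
      by apply: measurable_fun_pair;
        [exact: measurable_cst|exact: measurable_fun_pair].
    have := measurableT_comp (measurable_dil_one_sample Q nu) mxe.
    congr (measurable_fun _ _); apply/funext => w /=.
    rewrite dil_one_sample /Z; congr (_ * _ *: _).
    by rewrite mxdotNl opprK addrC.
  - by apply/measurable_EFinP; exact: measurable_sandwich.
  - move=> w _; rewrite lee_fin; apply: le_trans (KG _ (mxfun_tr _ _)) _.
    have [U [l [oU ZE]]] := spectral_spec (Zs w).
    rewrite ZE mxfun_spec // mexp_spec // spec_sqr //
      -specZ -(spec_scalar 1 oU) -!specD.
    apply: supergradient_le KG _ => // i; rewrite !mxE [2^-1 * _]mulrC.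
    exact: expR_phi0_le.
apply: le_trans (integral_sandwich KG) _; rewrite lee_fin.
set c := nu ^+ 2 / 2 * ((sigma + R0) ^+ 2 * BQ Q).
have Hs : (nu *: dilation Del + c%:M)^T = nu *: dilation Del + c%:M.
  by rewrite linearD /= linearZ /= dilation_tr tr_scalar_mx.
have [V [h [oV HE]]] := spectral_spec Hs.
rewrite HE mexp_spec //.
(* The bound [1 + h <= expR h] on the eigenvalues puts the mean back into the exponential form that
   the induction over samples consumes. *)
apply: (@le_trans _ _ (\tr (G *m spec V (const_mx 1 + h)))); last first.
  by apply: supergradient_le KG _ => // i; rewrite !mxE expR_ge1Dx.
rewrite specD spec_scalar // -HE !mulmxDr mulmx1 !mxtraceD -scalemxAr mxtraceZ.
rewrite addrA lerD2l mul_mx_scalar mxtraceZ.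
have [U [l [oU -> lB]]] := dil_sqr_sum_spec Qs.
have trG : 0 <= \tr G.
  rewrite -(mulmx1 G) -(spec_scalar 1 oU);
    apply: supergradient_ge0 KG _ => // i.
  by rewrite mxE.
have B0 : 0 <= BQ Q.
  by apply/ltW/BQ_gt0 => // v; rewrite hQ.
have n2 : 0 <= nu ^+ 2 / 2 by rewrite divr_ge0 ?sqr_ge0.
have s2 : 0 <= R0 ^+ 2 + sigma ^+ 2 by rewrite addr_ge0 ?sqr_ge0.
apply: (@le_trans _ _ (nu ^+ 2 / 2 * (R0 ^+ 2 + sigma ^+ 2) * (BQ Q * \tr G))).
  rewrite ler_wpM2l //; first exact: mulr_ge0.
  rewrite -mxtraceZ -mul_mx_scalar -(spec_scalar _ oU).
  by apply: supergradient_le KG _ => // i; rewrite mxE.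
rewrite mulrA ler_wpM2r // /c -mulrA ler_wpM2l // ler_wpM2r //.
have : 0 <= sigma * R0 by exact: mulr_ge0.
by rewrite sqrrD; lra.
Qed.

End catoni_moment.

Lemma mexp_scalar (R : realType) n (c : R) : mexp (c%:M : 'M[R]_n) = (expR
  c)%:M.
Proof.
have o1 : orthogonal_mx (1%:M : 'M[R]_n) by rewrite /orthogonal_mx trmx1 mul1mx.
rewrite -(spec_scalar c o1) mexp_spec // -(spec_scalar _ o1); congr spec.
by apply/rowP => i; rewrite !mxE.
Qed.

Lemma probability_gt_le (R : realType) (d : measure_display) (T :
  measurableType d)
    (P : probability T R) (f : T -> R) (c m : R) : 0 < c ->
  measurable_fun [set: T] f -> (forall w, 0 <= f w) ->
  (\int[P]_w (f w)%:E <= m%:E)%E -> (P [set w | (c < f w)%R] <= (m / c)%:E)%E.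
Proof.
move=> c0 mf f0 fm.
have mE : measurable [set w | c < f w].
  rewrite (_ : mkset _ = f @^-1` `]c, +oo[); first exact: preimage_measurable.
  by apply/seteqP; split=> w /=; rewrite in_itv /= andbT.
have mF : measurable [set w | c <= f w].
  rewrite (_ : mkset _ = f @^-1` `[c, +oo[); first exact: preimage_measurable.
  by apply/seteqP; split=> w /=; rewrite in_itv /= andbT.
apply: (@le_trans _ _ (P [set w | (c <= f w)%R])).
  by apply: le_measure; rewrite ?inE // => w /= /ltW.
rewrite EFinM muleC -lee_pdivrMl ?invr_gt0 // invrK; apply: le_trans fm.
have mfE : measurable_fun [set: T] (EFin \o f) by exact/measurable_EFinP.
have := le_integral_abse P measurableT mfE c0; rewrite setTI.
rewrite (_ : [set x | _] = [set w | (c <= f w)%R]); last first.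
  by apply/seteqP; split=> w /=; rewrite lee_fin ger0_norm.
by under eq_integral do rewrite /= (ger0_norm (f0 _)).
Qed.

Section fixed_pilot.
Context {R : realType} (d1 d2 n0 : nat).
Variables (pi : probability (borel_mx R d1 d2) R) (A : set 'M[R]_(d1, d2)).
Hypotheses (hA : forall a, A a -> opnorm a <= 1) (hpi : distribution_on pi A).
Variable Q : 'M[R]_(d2 * d1).
Hypotheses (hQ : Q = covariance_mx pi) (hQu : Q \in unitmx).
Context (disp : measure_display) (T : measurableType disp) (P : probability T
  R).
Variables (X : 'I_n0 -> T -> borel_mx R d1 d2) (eta Y : 'I_n0 -> T -> R).
Variables (Tstar : 'M[R]_(d1, d2)) (sigma R0 nu : R).
Hypothesis hY : forall i w, Y i w = mxdot Tstar (X i w) + eta i w.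
Hypothesis mX : forall i, measurable_fun [set: T] (X i).
Hypothesis meta : forall i, measurable_fun [set: T] (eta i).
Hypothesis indep : mutually_independent P (fun i w => (X i w, Y i w)).
Hypothesis lawX : forall i, has_law P (X i) pi.
Hypothesis sg : forall i, centered_subgaussian P sigma (eta i).
Hypothesis Xeta : forall i, independent2 P (X i) (eta i).
Hypotheses (hd1 : (0 < d1)%N) (hd2 : (0 < d2)%N).
Hypotheses (sigma_ge0 : 0 <= sigma) (R0_ge0 : 0 <= R0).

Lemma measurable_response i : measurable_fun [set: T] (fun w => (X i w, Y i w)).
Proof.
apply: measurable_fun_pair => //.
rewrite (_ : Y i = (fun w => mxdot Tstar (X i w) + eta i w)); last exact/funext.
apply: measurable_funD => //; under eq_fun do rewrite mxdot_vec.
apply: measurable_sum => k; apply: measurable_funM; first exact: measurable_cst.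
exact: (measurableT_comp (measurable_vec k) (mX i)).
Qed.

Definition catoni_term (th : 'M[R]_(d1, d2)) (z : borel_mx R d1 d2 * R) :
    borel_mx R (d1 + d2) (d1 + d2) :=
  mxfun phi0 (nu *: dilation (Defs.reshape (one_sample Q th z.1 z.2))).

Lemma measurable_catoni_term : measurable_fun setT
  ((fun z : borel_mx R d1 d2 * (borel_mx R d1 d2 * R) => catoni_term z.1 z.2)
     : _ -> borel_mx R (d1 + d2) (d1 + d2)).
Proof.
apply: measurable_mxfun phi0_bounded_lipschitz _ (measurable_dil_one_sample Q
  nu).
by move=> z; rewrite linearZ /= dilation_tr.
Qed.

Lemma integral_catoni_sum th : (forall a, A a ->
  `|mxdot (th - Tstar) a| <= R0) ->
  (\int[P]_w (\tr (mexp (- (n0%:R * nu) *: dilation (Tstar - th) +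
     \sum_i (catoni_term th (X i w, Y i w) : 'M[R]_(d1 + d2)))))%:E <=
   ((d1 + d2)%:R * expR (n0%:R * (nu ^+ 2 / 2 * ((sigma + R0) ^+ 2 * BQ
     Q))))%:E)%E.
Proof.
move=> good; pose c := nu ^+ 2 / 2 * ((sigma + R0) ^+ 2 * BQ Q).
pose H : 'M[R]_(d1 + d2) := nu *: dilation (Tstar - th) + c%:M.
have Hs : H^T = H by rewrite /H linearD /= linearZ /= dilation_tr tr_scalar_mx.
pose K : 'M[R]_(d1 + d2) := - (n0%:R * nu) *: dilation (Tstar - th).
have Ks : K^T = K by rewrite /K linearZ /= dilation_tr.
have mth : measurable_fun setT (catoni_term th).
  apply: (measurableT_comp measurable_catoni_term (g := fun z =>
    (th : borel_mx R d1 d2, z))).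
  by apply: measurable_fun_pair; [exact: measurable_cst|exact: measurable_id].
(* [K] cancels the drift of the [n0] copies of [H] and only their scalar parts remain. *)
have -> : (d1 + d2)%:R * expR (n0%:R * c) = \tr (mexp (K + H *+ n0)).
  have -> : K + H *+ n0 = (n0%:R * c)%:M.
    rewrite -(scaler_nat n0 H) /K /H scalerDr scalerA scaleNr addrA addNr add0r.
    by rewrite scale_scalar_mx.
  by rewrite mexp_scalar mxtrace_scalar (mulr_natl (expR _)).
apply: (mexp_sum_bound mth _ Hs measurable_response indep) =>
  // [z|i K' G K's KG].
  exact: mxfun_tr.
have goodD a : A a -> `|mxdot (Tstar - th) a| <= R0.
  by move=> /good; rewrite -opprB mxdotNl normrN.
apply: le_trans (integral_catoni hA hpi hQ hQu nu (mX i) (meta i) (lawX i) (sg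
  i) (Xeta i) hd1 hd2 sigma_ge0 R0_ge0 goodD K's KG).
rewrite le_eqVlt; apply/orP; left; apply/eqP; apply: eq_integral => w _ /=.
have eE : Y i w - mxdot th (X i w) = mxdot (Tstar - th) (X i w) + eta i w.
  by rewrite hY mxdotBl addrAC.
by rewrite /catoni_term dil_one_sample /= eE.
Qed.

End fixed_pilot.

(** * High-probability bound *)

Lemma measurable_scale_dilation (R : realType) d1 d2 (c : R) (M : 'M[R]_(d1,
  d2)) :
  measurable_fun setT ((fun th : borel_mx R d1 d2 =>
    c *: dilation (M - (th : 'M[R]_(d1, d2)))) : _ ->
      borel_mx R (d1 + d2) (d1 + d2)).
Proof.
apply: measurable_fun_mx => i j.
rewrite (_ : (fun _ => _) = fun th : borel_mx R d1 d2 => c * (dilation M i j -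
    \sum_k vec (th : 'M[R]_(d1, d2)) k 0 * dil (col k 1%:M) i j)).
  apply: measurable_funM; first exact: measurable_cst.
  apply: measurable_funB; first exact: measurable_cst.
  apply: measurable_sum => k; apply: measurable_funM;
    last exact: measurable_cst.
  exact: measurable_vec.
apply/funext => th; rewrite mxE dilationB; congr (_ * _).
rewrite [LHS]mxE [X in _ + X]mxE; congr (_ - _).
rewrite -[in LHS](reshapeK th) -/(dil _) -[vec th]mul1mx dil_mul summxE.
by apply: eq_bigr => k _; rewrite mul1mx mxE.
Qed.

(* The exponent budget [2 L] gives the deviation [sqrt 2 * s * sqrt (B L / n0)];
   the cutoff has [2] in place of [sqrt 2]. *)
Lemma catoni_deviation_le (R : realType) (n0 : nat) (B L s : R) : (0 < n0)%N ->
  0 < B -> 0 < L -> 0 < s ->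
  2 * L / (n0%:R * (s^-1 * Num.sqrt (2 / (B * n0%:R) * L))) <=
  2 * s * Num.sqrt (B * L / n0%:R).
Proof.
move=> n0_gt0 B0 L0 s0; have n0R : 0 < n0%:R :> R by rewrite ltr0n.
set s1 := Num.sqrt _; set s2 := Num.sqrt _.
have s10 : 0 < s1 by rewrite sqrtr_gt0 mulr_gt0 // divr_gt0 ?mulr_gt0.
have key : L <= n0%:R * (s1 * s2).
  have Ln : 0 <= L / n0%:R by rewrite divr_ge0 // ltW.
  have r0 : 0 <= 2 / (B * n0%:R) * L by rewrite ltW // mulr_gt0 //
    divr_gt0 ?mulr_gt0.
  rewrite /s1 /s2 -sqrtrM // mulrC -ler_pdivrMr //
    -[leLHS](ger0_norm Ln) -sqrtr_sqr.
  rewrite ler_wsqrtr // [leRHS](_ : _ = 2 * (L / n0%:R) ^+ 2); last first.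
    by field; rewrite !gt_eqF.
  by rewrite ler_peMl ?sqr_ge0 // ler1n.
rewrite ler_pdivrMr ?mulr_gt0 ?invr_gt0 //.
rewrite [leRHS](_ : _ = 2 * (n0%:R * (s1 * s2))); last by field; rewrite gt_eqF.
by rewrite ler_pM2l.
Qed.

(** This balance fixes the scale: the second-order cost of all [n0] samples together is exactly
    [L]. *)
Lemma catoni_exponent (R : realType) (n0 : nat) (B L s : R) : (0 < n0)%N ->
  0 < B -> 0 < L -> 0 < s ->
  n0%:R * ((s^-1 * Num.sqrt (2 / (B * n0%:R) * L)) ^+ 2 / 2 * (s ^+ 2 * B)) = L.
Proof.
move=> n0_gt0 B0 L0 s0; have n0R : 0 < n0%:R :> R by rewrite ltr0n.
rewrite exprMn sqr_sqrtr; last by rewrite ltW // mulr_gt0 // divr_gt0 ?mulr_gt0.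
by field; rewrite !gt_eqF.
Qed.

Theorem theorem3p2 (R : realType) :
  exists2 C : R, 0 < C &
  forall (d1 d2 n0 r : nat) (hd1 : (0 < d1)%N) (hd2 : (0 < d2)%N)
    (hn0 : (0 < n0)%N)
    (A : set 'M[R]_(d1, d2)) (hspan : spans A)
    (hA : forall a, A a -> opnorm a <= 1)
    (pi : probability (borel_mx R d1 d2) R) (hpi : distribution_on pi A)
    (Q : 'M[R]_(d2 * d1)) (hQ : Q = covariance_mx pi) (hQu : Q \in unitmx)
    (Tstar : 'M[R]_(d1, d2)) (hrank : (\rank Tstar <= r)%N)
    (sigma : R) (hsigma : 0 < sigma)
    (disp : measure_display) (T : measurableType disp) (P : probability T R)
    (X : 'I_n0 -> T -> borel_mx R d1 d2) (eta : 'I_n0 -> T -> R)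
    (Y : 'I_n0 -> T -> R)
    (hY : forall i w, Y i w = mxdot Tstar (X i w) + eta i w)
    (hXm : forall i, measurable_fun [set: T] (X i))
    (hetam : forall i, measurable_fun [set: T] (eta i))
    (hindep : mutually_independent P (fun i w => (X i w, Y i w)))
    (hid : identically_distributed P (fun i w => (X i w, Y i w)))
    (hXlaw : forall i, has_law P (X i) pi)
    (hsub : forall i, centered_subgaussian P sigma (eta i))
    (hXeta : forall i, independent2 P (X i) (eta i))
    (Theta0 : T -> borel_mx R d1 d2)
    (hT0m : measurable_fun [set: T] Theta0)
    (hT0 : independent2 P Theta0
       (fun w => [tuple (X i w, Y i w) | i < n0]))
    (R0 : R)
    (hR0 : {ae P, forall w, forall a, A a ->
       `|mxdot (Theta0 w - Tstar) a| <= R0})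
    (delta : R) (hdelta : 0 < delta < 1)
    (That : T -> 'M[R]_(d1, d2))
    (hThat : forall w, LowPopArt_output sigma Q (Theta0 w) R0 delta
       (fun i => X i w) (fun i => Y i w) (That w)),
  with_probability_ge P (1 - delta)
    [set w | (\rank (That w) <= r)%N /\
       opnorm (That w - Tstar) <=
         C * (sigma + R0) *
         Num.sqrt (BQ Q / n0%:R * ln (2 * (maxn d1 d2)%:R / delta))].
Proof.
(* The error is at most twice the cutoff, and the cutoff carries a factor 2. *)
exists 4 => // d1 d2 n0 r hd1 hd2 hn0 A hspan hA pi hpi Q hQ hQu Tstar hrank.
move=> sigma hsigma disp T P X eta Y hY mX meta indep _ lawX sg Xeta Theta0 mT0.
move=> hT0 R0 hR0 delta /andP[delta0 delta1] That hThat.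
have R0_ge0 : 0 <= R0.
  (* A nonzero matrix is a combination of elements of [A], so [A] has an element. An outcome
     satisfying the pilot bound exists because the exceptional set is null, and the two together
     force [R0] to be nonnegative. *)
  have [k [c [a [Aa ME]]]] := hspan (const_mx 1).
  case: k c a Aa ME => [|k] c a Aa ME.
    move/matrixP/(_ (Ordinal hd1) (Ordinal hd2)) : ME.
    by rewrite big_ord0 !mxE => /eqP; rewrite oner_eq0.
  have [w hw] : exists w, forall a, A a -> `|mxdot (Theta0 w - Tstar) a| <= R0.
    apply: contrapT => /forallNP no; case: hR0 => N [mN N0 NT].
    have : P setT = 0%E.
      rewrite -N0; congr (P _); apply/esym/seteqP; split=> // w _.
      by apply: NT => /=; exact: no.
    by move/eqP; rewrite probability_setT onee_eq0.
  by apply: le_trans (hw _ (Aa ord0)).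
have Qs : Q^T = Q by rewrite hQ covariance_mx_tr.
have B0 : 0 < BQ Q by apply: BQ_gt0 => // v; rewrite hQ;
  exact: covariance_mx_ge0 hA hpi _.
have s0 : 0 < sigma + R0 by rewrite ltr_pwDl.
set d := maxn d1 d2; have d_gt0 : (0 < d)%N by rewrite leq_max hd1.
have dR : 0 < d%:R :> R by rewrite ltr0n.
pose L := ln (2 * d%:R / delta).
have expL : expR L = 2 * d%:R / delta by rewrite lnK //
  posrE divr_gt0 ?mulr_gt0.
have L0 : 0 < L.
  apply: ln_gt0; rewrite ltr_pdivlMr // mul1r (lt_le_trans delta1) //.
  by rewrite -natrM ler1n muln_gt0.
pose nu := (sigma + R0)^-1 * Num.sqrt (2 / (BQ Q * n0%:R) * L).
have n0R : 0 < n0%:R :> R by rewrite ltr0n.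
have nu0 : 0 < nu.
  by rewrite mulr_gt0 ?invr_gt0 // sqrtr_gt0 mulr_gt0 // divr_gt0 ?mulr_gt0.
pose U w : n0.-tuple (borel_mx R d1 d2 * R) := [tuple (X i w, Y i w) | i < n0].
pose W (z : borel_mx R d1 d2 * n0.-tuple (borel_mx R d1 d2 * R)) : 'M[R]_(d1 +
  d2) :=
  - (n0%:R * nu) *: dilation (Tstar - z.1) +
    \sum_i (catoni_term Q nu z.1 (tnth z.2 i) : 'M[R]_(d1 + d2)).
pose f z : R := \tr (mexp (W z)).
have mf : measurable_fun setT f.
  apply: (measurable_mxtrace_mexp (S :=
    W : _ -> borel_mx R (d1 + d2) (d1 + d2))).
    move=> z; rewrite /W linearD /= linearZ /= dilation_tr linear_sum /=.
    by congr (_ + _); apply: eq_bigr => i _; exact: mxfun_tr.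
  apply: measurable_mxadd.
    exact: (measurableT_comp (measurable_scale_dilation _ Tstar)
      measurable_fst).
  apply: measurable_mxsum => i;
    apply: (measurableT_comp (measurable_catoni_term Q nu)
    (g := fun z : borel_mx R d1 d2 * n0.-tuple (borel_mx R d1 d2 * R) =>
      (z.1, tnth z.2 i))).
  apply: measurable_fun_pair; first exact: measurable_fst.
  exact: (measurableT_comp (measurable_tnth i) measurable_snd).
have mU : measurable_fun [set: T] U.
  apply/measurable_fun_tnthP => i.
  rewrite (_ : _ \o _ = (fun w => (X i w, Y i w)));
    first exact: measurable_response hY mX meta i.
  by apply/funext => w; rewrite /= tnth_mktuple.
have expE : n0%:R * (nu ^+ 2 / 2 * ((sigma + R0) ^+ 2 * BQ Q)) = L.
  exact: catoni_exponent.
have [nuE LE] : nu = catoni_scale n0 sigma Q R0 delta /\ L = log_term d1 d2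
  delta by [].
have devE : 2 * L / (n0%:R * nu) <= 2 * (R0 + sigma) * Num.sqrt (BQ Q * L /
  n0%:R).
  by rewrite [R0 + _]addrC; exact: catoni_deviation_le.
clearbody nu L.
have a0 : 0 < n0%:R * nu by apply: mulr_gt0.
have anz := lt0r_neq0 a0.
have fle : (\int[P]_w (f (Theta0 w, U w))%:E <= ((d1 + d2)%:R * expR L)%:E)%E.
  rewrite -[leRHS](integral_cst_probability P).
  apply: (le_integral_independent2 (f := fun z => (f z)%:E)
    (g := fun=> ((d1 + d2)%:R * expR L)%:E) mT0 mU hT0) => //.
  - exact/measurable_EFinP.
  - by move=> z; rewrite lee_fin mxtrace_mexp_ge0.
  case: hR0 => N [mN N0 NT]; exists N; split=> // w /= nw.
  apply: NT => /= good; apply: nw.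
  have := integral_catoni_sum hA hpi hQ hQu nu hY mX meta indep lawX sg Xeta
    hd1 hd2
    (ltW hsigma) R0_ge0 good.
  rewrite expE; apply: le_trans.
  rewrite le_eqVlt; apply/orP; left; apply/eqP; apply: eq_integral => w' _.
  rewrite /f /W /=; congr ((\tr (mexp (_ + _)))%:E).
  by apply: eq_bigr => i _; rewrite tnth_mktuple.
have mfU : measurable_fun [set: T] (fun w => f (Theta0 w, U w)).
  by apply: (measurableT_comp mf); exact: measurable_fun_pair.
(* The event is written in terms of the pilot and the samples, whose measurability is known; [That]
   rests on an arbitrary choice of singular value decompositions. *)
exists [set w | f (Theta0 w, U w) <= expR (2 * L)].
  split.
    rewrite (_ : mkset _ = (fun w =>
      f (Theta0 w, U w)) @^-1` `]-oo, expR (2 * L)]).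
      exact: preimage_measurable.
    by apply/seteqP; split=> w /=; rewrite in_itv /=.
  have bad := probability_gt_le (expR_gt0 (2 * L)) mfU (fun w =>
    mxtrace_mexp_ge0 _) fle.
  have mbad : measurable [set w | expR (2 * L) < f (Theta0 w, U w)].
    rewrite (_ : mkset _ = (fun w =>
      f (Theta0 w, U w)) @^-1` `]expR (2 * L), +oo[).
      exact: preimage_measurable.
    by apply/seteqP; split=> w /=; rewrite in_itv /= andbT.
  rewrite (_ : mkset _ = ~` [set w | expR (2 * L) < f (Theta0 w, U w)]);
    last first.
    by apply/seteqP; split=> w /=; rewrite leNgt => /negP.
  rewrite probability_setC // EFinB; apply: leeB => //; apply: le_trans bad _.
  (* Markov's bound is [(d1 + d2) / expR L = (d1 + d2) * delta / (2 * d)], at most [delta]; this is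
     the origin of [2 d] in the logarithm. *)
  have -> : expR (2 * L) = expR L * expR L by rewrite -expRD; congr expR; ring.
  rewrite lee_fin -mulf_div divff ?mulr1 ?gt_eqF ?expR_gt0 //.
  rewrite ler_pdivrMr ?expR_gt0 // expL [leRHS](_ : _ = 2 * d%:R); last first.
    by field; rewrite gt_eqF.
  by rewrite -natrM ler_nat mul2n -addnn leq_add // ?leq_maxl ?leq_maxr.
move=> w /= fw; have [V [S [V' [svd ->]]]] := hThat w.
set Th1 := Theta1 _ _ _ _ _ _ _ in svd.
(* The sum of the truncated summands is itself a dilation, so passing to the upper right block loses
   nothing and [W] is exactly the scaled dilation of the error. *)
have WE : W (Theta0 w, U w) = (n0%:R * nu) *: dilation (Th1 - Tstar).
  pose N (i : 'I_n0) := catoni_term Q nu (Theta0 w) (X i w, Y i w) : 'M[R]_(d1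
    + d2).
  have -> : Th1 = Theta0 w + ursubmx ((n0%:R * nu)^-1 *: \sum_i N i).
    by rewrite /N /catoni_term nuE.
  have NE : \sum_i N i = dilation (\sum_i ursubmx (N i)).
    by rewrite dilation_sum; apply: eq_bigr => i _;
      rewrite /N /catoni_term -dilationZ; apply: mxfun_dilation; exact: phi0N.
  have UE : \sum_i (catoni_term Q nu (Theta0 w) (tnth (U w) i) : 'M[R]_(d1 +
    d2))
      = \sum_i N i.
    by apply: eq_bigr => i _; rewrite tnth_mktuple.
  rewrite /W [X in _ + X]UE.
  have -> : ursubmx ((n0%:R * nu)^-1 *: \sum_i N i) =
      (n0%:R * nu)^-1 *: \sum_i ursubmx (N i).
    apply/matrixP => a b; rewrite !mxE !summxE; congr (_ * _).
    by apply: eq_bigr => i _; rewrite !mxE.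
  rewrite NE addrAC [in RHS]dilationD dilationZ scalerDr scalerA.
  have TE : (Theta0 w : 'M[R]_(d1, d2)) - Tstar = -1 *: (Tstar - Theta0 w).
    by rewrite scaleN1r opprB.
  by rewrite (divff anz) scale1r TE dilationZ [in RHS]scalerA mulrN1.
have tau0 : 0 <= 2 * (R0 + sigma) * Num.sqrt (BQ Q * L / n0%:R).
  by rewrite !mulr_ge0 ?sqrtr_ge0 // addr_ge0 // ltW.
have dev x : sqnorm (x *m (Th1 - Tstar)) <=
    (2 * (R0 + sigma) * Num.sqrt (BQ Q * L / n0%:R)) ^+ 2 * sqnorm x.
  have L2 : 0 < 2 * L by rewrite mulr_gt0.
  apply: le_trans (dilation_mexp_bound x a0 L2 _) _; first by rewrite -WE.
  rewrite ler_wpM2r ?sqnorm_ge0 //; apply: lerXn2r devE; rewrite nnegrE //.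
  exact/ltW/divr_gt0.
rewrite /sv_cutoff -LE.
have [rk op] := hard_threshold_svd tau0 svd dev.
split; first exact: leq_trans rk hrank.
apply: le_trans op _; rewrite le_eqVlt; apply/orP; left; apply/eqP.
rewrite -[ln _]/(log_term d1 d2 delta) -LE.
rewrite [BQ Q / _ * _]mulrAC; ring.
Qed.
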